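(* Let $\mathcal{H}$ be a complex Hilbert space and suppose that $T\in\boldsymbol{B}(\mathcal{H})$ is a CPD operator. Let $M\colon\mathfrak{B}(\mathbb{R}_+)\to\boldsymbol{B}(\mathcal{H})$ be a compactly supported semispectral measure satisfying $$p\langle T\rangle=p(1)I-p'(1)(I-T^*T)+\int_{\mathbb{R}_+}(\mathfrak{D}_1^2p)(x)\,M(\mathrm{d}x),\quad p\in\mathbb{C}[X].$$ Then the map $\Lambda_T\colon L^\infty(M)\to\boldsymbol{B}(\mathcal{H})$ given by $\Lambda_T(f)=\int_{\mathbb{R}_+}f\,\mathrm{d}M$, $f\in L^\infty(M)$, is continuous and linear. It has the following properties: (i) $\Lambda_T(q)=((X-1)^2q)\langle T\rangle$ for every $q\in\mathbb{C}[X]$; (ii) $\Lambda_T$ is positive, i.e., $\Lambda_T(f)\geq0$ whenever $f\in L^\infty(M)$ and $f\geq0$ a.e. $[M]$; (iii) there exist a Hilbert space $\mathcal{K}$, $R\in\boldsymbol{B}(\mathcal{H},\mathcal{K})$ and $S\in\boldsymbol{B}(\mathcal{K})_+$ such that $\mathcal{K}=\bigvee\{S^n\mathscr{R}(R)\colon n\in\mathbb{Z}_+\}$ and $$\Lambda_T(f)=R^*f(S)R,\quad f\in L^\infty(M);$$ (iv) $\|\Lambda_T\|=\|\mathcal{B}_2(T)\|$; (v) if $M$ is nonzero and $\Omega:=\operatorname{supp}(M)$, then $\mathbb{C}[X]$ is dense in $C(\Omega)$ in the $L^\infty(M)$-norm, $\Lambda_T|_{C(\Omega)}\colon C(\Omega)\to\boldsymbol{B}(\mathcal{H})$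 is the unique continuous linear map satisfying (i), $\|\Lambda_T|_{C(\Omega)}\|=\|\Lambda_T\|$ and $$\Big\|\sum_{j=0}^n\alpha_jT^{*j}\mathcal{B}_2(T)T^j\Big\|\leq\|\mathcal{B}_2(T)\|\,\sup_{x\in\Omega}\Big|\sum_{j=0}^n\alpha_jx^j\Big|,\quad\{\alpha_j\}_{j=0}^n\subseteq\mathbb{C},\ n\in\mathbb{Z}_+.$$
   Context: $\boldsymbol{B}(\mathcal{H},\mathcal{K})$ denotes bounded linear operators from $\mathcal{H}$ to $\mathcal{K}$, $\boldsymbol{B}(\mathcal{H})=\boldsymbol{B}(\mathcal{H},\mathcal{H})$, $\boldsymbol{B}(\mathcal{K})_+$ the nonnegative operators; all Hilbert spaces are complex. $\mathbb{Z}_+=\{0,1,2,\ldots\}$, $\mathbb{R}_+=[0,\infty)$; $\mathfrak{B}(\mathbb{R}_+)$ is the Borel $\sigma$-algebra; $\mathscr{R}(R)$ is the range; $\bigvee$ is closed linear span; $\operatorname{supp}$ is the closed support. A real sequence $\{\gamma_n\}_{n=0}^\infty$ is conditionally positive definite (CPD) if $\sum_{i,j=0}^k \gamma_{i+j}\lambda_i\bar\lambda_j\geq 0$ for all finite complex sequences $\lambda_0,\ldots,\lambda_k$ with $\sum_{i=0}^k\lambda_i=0$. $T\in\boldsymbol{B}(\mathcal{H})$ is CPD if $\{\|T^nh\|^2\}_{n=0}^\infty$ is CPD for every $h\in\mathcal{H}$. (For CPD $T$, a measure $M$ as in the claim exists and is unique.) For $p=\sum_i\alpha_iX^i\in\mathbb{C}[X]$,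 $p\langle T\rangle:=\sum_i\alpha_iT^{*i}T^i$. $\mathcal{B}_2(T)=I-2T^*T+T^{*2}T^2$. $\mathfrak{D}_1^2p:=\frac{p-p(1)-p'(1)(X-1)}{(X-1)^2}\in\mathbb{C}[X]$. A semispectral measure $M\colon\mathfrak{B}(\mathbb{R}_+)\to\boldsymbol{B}(\mathcal{H})$ is a map that is $\sigma$-additive in the weak operator topology with $M(\Delta)\geq0$ for all $\Delta$ (no normalization); $\int\zeta\,\mathrm{d}M$ is the unique bounded operator with $\langle(\int\zeta\,\mathrm{d}M)h,h\rangle=\int\zeta(x)\langle M(\mathrm{d}x)h,h\rangle$ for all $h$. $L^\infty(M)$ is the Banach space of (classes modulo equality a.e. $[M]$ of) $M$-essentially bounded complex Borel functions on $\mathbb{R}_+$ with norm $\|f\|_{L^\infty(M)}=\min\{\alpha\in\mathbb{R}_+\colon M(\{x\colon|f(x)|>\alpha\})=0\}$. Polynomials are regarded as elements of $L^\infty(M)$ (as $M$ has compact support). In (iii), $f(S)=\int_{\mathbb{R}_+}f\,\mathrm{d}E$ with $E$ the spectral measure of $S$; the assertion includes that this is well defined for $f\in L^\infty(M)$. In (v), $C(\Omega)$ (continuous complex functions on compact $\Omega$ with sup norm) is viewed as a closed subspace of $L^\infty(M)$ by sending $g\in C(\Omega)$ to the class of any Borel extension of $g$ to $\mathbb{R}_+$ (this is an isometric embedding), and $\mathbb{C}[X]$ is viewed in $C(\Omega)$ by restriction to $\Omega$. *)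

(* Defs.v *)
(* MathComp-Analysis, over an arbitrary [R : realType]; the complex field is
   [R[i]].  Operators are plain functions satisfying [bounded_op], which gives
   sums and scalar multiples through the pointwise module structure. *)
From HB Require Import structures.
From mathcomp Require Import all_boot all_order all_algebra.
From mathcomp Require Import all_classical all_reals all_analysis.
From mathcomp Require Import sesquilinear.
From mathcomp Require Export complex.

Set Implicit Arguments.
Unset Strict Implicit.
Unset Printing Implicit Defensive.

Import Order.TTheory GRing.Theory Num.Theory.
Import numFieldNormedType.Exports.

Local Open Scope classical_set_scope.
Local Open Scope ring_scope.
Local Open Scope complex_scope.

(* [R[i]] as a normed module over itself, with its usual topology. *)
#[export, non_forgetful_inheritance]
HB.instance Definition _ (R : realType) :=
  NormedModule.copy R[i] (R[i])^o.

(* A complex Hilbert space.  The inner product is linear in its first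
   argument.  As everywhere for normed modules over [R[i]], [`|x|] is an
   element of [R[i]] (a nonnegative real number). *)
HB.mixin Record CompleteNormedModule_isHilbert (R : realType) H
    & CompleteNormedModule R[i] H := {
  hdot : {dot H for (@conjc R)} ;
  hdot_norm : forall x : H, hdot x x = `|x| ^+ 2 }.

#[short(type="hilbertType")]
HB.structure Definition Hilbert (R : realType) :=
  {H of CompleteNormedModule_isHilbert R H & CompleteNormedModule R[i] H}.

(* The norm as an element of [R], so that suprema in [R] can be taken. *)
Definition rnorm (R : realType) (V : normedZmodType R[i]) (x : V) : R :=
  complex.Re `|x|.

Section Operators.
Context {R : realType}.

Definition bounded_op (H K : hilbertType R) (A : H -> K) : Prop :=
  linear A /\ continuous A.

Definition opnorm (H K : hilbertType R) (A : H -> K) : R :=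
  sup [set rnorm (A h) | h in [set h : H | rnorm h <= 1]].

(* The Hilbert space adjoint; it exists (and is unique) for bounded [A]. *)
Definition adj (H K : hilbertType R) (A : H -> K) : K -> H :=
  xget (fun=> 0) [set B | bounded_op B /\
                          forall (h : H) (k : K), hdot (A h) k = hdot h (B k)].

(* On [R[i]], [0 <= z] says that [z] is a nonnegative real number. *)
Definition nonneg_op (H : hilbertType R) (A : H -> H) : Prop :=
  forall h, 0 <= hdot (A h) h.

Definition lspan (V : lmodType R[i]) (A : set V) : set V :=
  [set x | exists n (c : 'I_n -> R[i]) (v : 'I_n -> V),
     (forall i, A (v i)) /\ x = \sum_(i < n) c i *: v i].

Definition cpd_seq (g : nat -> R) : Prop :=
  forall (k : nat) (l : 'I_k.+1 -> R[i]), \sum_i l i = 0 ->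
    0 <= \sum_(i < k.+1) \sum_(j < k.+1) (g (i + j)%N)%:C * l i * (l j)^*.

Definition cpd_op (H : hilbertType R) (T : H -> H) : Prop :=
  forall h : H, cpd_seq (fun n => rnorm (iter n T h) ^+ 2).

(* p<T> = sum_i p_i T^{*i} T^i *)
Definition hereditary (H : hilbertType R) (T : H -> H) (p : {poly R[i]}) :
    H -> H :=
  \sum_(i < size p) p`_i *: (iter i (adj T) \o iter i T).

Definition B2 (H : hilbertType R) (T : H -> H) : H -> H := fun h =>
  h - 2%:R *: adj T (T h) + adj T (adj T (T (T h))).

(* The division is exact. *)
Definition D12 (p : {poly R[i]}) : {poly R[i]} :=
  (p - p.[1]%:P - p^`().[1] *: ('X - 1)) %/ ('X - 1) ^+ 2.

End Operators.

(* Continuity, linearity and norm of maps into B(H), for maps defined on a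
   subspace [D] of [V] carrying a seminorm [N]; when [N] is a seminorm, this
   describes maps on the quotient of [D] by the kernel of [N]. *)
Section MapsIntoBH.
Context {R : realType} (V : lmodType R[i]) (D : set V) (N : V -> R).
Context (H : hilbertType R) (Phi : V -> H -> H).

Definition into_BH : Prop := forall f, D f -> bounded_op (Phi f).

Definition linear_on : Prop := forall (a : R[i]) f g,
  D f -> D g -> Phi (a *: f + g) = a *: Phi f + Phi g.

Definition continuous_on : Prop := forall f, D f ->
  forall e : R, 0 < e -> exists2 d : R, 0 < d &
  forall g, D g -> N (g - f) < d -> opnorm (Phi g - Phi f) < e.

Definition mapnorm : R :=
  sup [set opnorm (Phi f) | f in [set f | D f /\ N f <= 1]].

End MapsIntoBH.

(* [0, +oo) as a topological and measurable space of its own. *)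
Definition Rplus (R : realType) : Type := set_type [set x : R | 0 <= x].

Section RplusStructures.
Context {R : realType}.

Definition Rval (x : Rplus R) : R := \val x.

HB.instance Definition _ :=
  Topological.copy (Rplus R) (set_type [set x : R | 0 <= x]).

Let Rplus0_subproof : (0 : R) \in [set x : R | 0 <= x].
Proof. by rewrite inE /=. Qed.

HB.instance Definition _ :=
  isPointed.Build (Rplus R) (exist _ 0 Rplus0_subproof).

HB.instance Definition _ :=
  Measurable.copy (Rplus R) (g_sigma_algebraType (@open (Rplus R))).

End RplusStructures.

(* Only the values on measurable sets are meaningful. *)
Record semispectral (R : realType) d (T : measurableType d)
    (H : hilbertType R) := Semispectral {
  sspm :> set T -> H -> H ;
  sspm_bounded : forall A, measurable A -> bounded_op (sspm A) ;
  sspm_ge0 : forall A, measurable A -> nonneg_op (sspm A) ;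
  sspm_sigma_additive : forall F : nat -> set T,
    (forall n, measurable (F n)) -> trivIset setT F ->
    forall h g : H,
      (fun n => \sum_(0 <= k < n) hdot (sspm (F k) h) g) @ \oo -->
        hdot (sspm (\bigcup_n F n) h) g }.

Section Semispectral.
Context {R : realType} d (T : measurableType d) (H : hilbertType R).
Variable M : semispectral T H.

(* The scalar measure <M(.)h, h>; set to 0 off the sigma-algebra because the
   library's measures are nonnegative on all sets. *)
Definition sspm_diag (h : H) (A : set T) : \bar R :=
  (if `[< measurable A >] then complex.Re (hdot (M A h) h) else 0)%:E.

Let Re_cvg (u : nat -> R[i]) (l : R[i]) :
  u @ \oo --> l -> (fun n => complex.Re (u n)) @ \oo --> complex.Re l.
Proof.
move=> /cvgrPdist_lt ul; apply/cvgrPdist_lt => e e0.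
have := ul e%:C; rewrite ltcR => /(_ e0); apply: filterS => n.
rewrite -raddfB/= normc_def ltcR; apply: le_lt_trans.
case: (l - u n) => a b /=.
by rewrite -[leLHS]sqrtr_sqr ler_wsqrtr// lerDl sqr_ge0.
Qed.

Let sspm_diag0 h : sspm_diag h set0 = 0%E.
Proof.
rewrite /sspm_diag; case: asboolP => // _; congr EFin.
have := @sspm_sigma_additive _ _ _ _ M (fun=> set0) (fun=> measurable0)
  (@trivIset_set0 _ _ _) h h.
rewrite bigcup0// => /Re_cvg cM.
set c := hdot (M set0 h) h in cM *.
have /cvgB/(_ cM) : (fun n => complex.Re (\sum_(0 <= k < n.+1) c)) @ \oo -->
    complex.Re c.
  by rewrite (cvg_shiftS (fun n => complex.Re (\sum_(0 <= k < n) c))).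
rewrite subrr; set v := (X in X @ _ --> _); have -> : v = fun=> complex.Re c.
  apply/funext => n; rewrite /v -[LHS]/(_ - _) big_nat_recr//= raddfD/=.
  by rewrite addrAC subrr add0r.
by move/(cvg_lim (@norm_hausdorff _ _)); rewrite lim_cst.
Qed.

Let sspm_diag_ge0 h A : (0 <= sspm_diag h A)%E.
Proof.
rewrite /sspm_diag lee_fin; case: asboolP => // mA.
by have := sspm_ge0 M mA h; rewrite lecE => /andP[].
Qed.

Let sspm_diag_sigma_additive h : semi_sigma_additive (sspm_diag h).
Proof.
move=> F mF tF mUF.
rewrite [X in _ --> X]/sspm_diag asboolT//.
have -> : (fun n => \sum_(0 <= i < n) sspm_diag h (F i))%E =
    EFin \o (fun n => complex.Re (\sum_(0 <= k < n) hdot (M (F k) h) h)).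
  apply/funext => n /=; rewrite raddf_sum/= -sumEFin; apply: eq_bigr => i _.
  by rewrite /sspm_diag asboolT.
apply: cvg_EFin; first exact: nearW.
have := Re_cvg (@sspm_sigma_additive _ _ _ _ M F mF tF h h).
exact.
Qed.

HB.instance Definition _ h := isMeasure.Build _ _ _ (sspm_diag h)
  (sspm_diag0 h) (sspm_diag_ge0 h) (@sspm_diag_sigma_additive h).

Definition sspm_ae (P : set T) : Prop :=
  exists N, [/\ measurable N, M N = 0 & ~` P `<=` N].

(* The integral of [f] with respect to [M]: the bounded operator A such that
   <Ah, h> is the integral of [f] with respect to <M(.)h, h> for all h. *)
Definition is_opint (f : T -> R[i]) (A : H -> H) : Prop :=
  bounded_op A /\ forall h, hdot (A h) h =
    Complex (\int[sspm_diag h]_x complex.Re (f x))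
            (\int[sspm_diag h]_x complex.Im (f x)).

Definition opint (f : T -> R[i]) : H -> H := xget (fun=> 0) (is_opint f).

(* Complex Borel functions: C is identified with R^2. *)
Definition cmeasurable (f : T -> R[i]) : Prop :=
  measurable_fun setT (fun x => complex.Re (f x)) /\
  measurable_fun setT (fun x => complex.Im (f x)).

(* Representatives of the elements of L^oo(M). *)
Definition Linf : set (T -> R[i]) := [set f | cmeasurable f /\
  exists2 a : R, 0 <= a & M [set x | a < rnorm (f x)] = 0].

Definition Linf_norm (f : T -> R[i]) : R :=
  inf [set a : R | 0 <= a /\ M [set x | a < rnorm (f x)] = 0].

End Semispectral.

Section OnRplus.
Context {R : realType} (H : hilbertType R).

Definition supp (M : semispectral (Rplus R) H) : set (Rplus R) :=
  [set x | forall U, open U -> U x -> M U <> 0].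

Definition polyfun (q : {poly R[i]}) : Rplus R -> R[i] :=
  fun x => q.[(Rval x)%:C].

(* [E] is the spectral measure of [S] (a nonnegative idempotent is an
   orthogonal projection); for a bounded nonnegative operator it
   exists, is unique and lives on a compact subset of R_+. *)
Definition spectral_measure_of (S : H -> H) (E : semispectral (Rplus R) H) :
    Prop :=
  [/\ E setT = id,
      forall A, measurable A -> E A \o E A = E A,
      compact (supp E) &
      is_opint E (fun x => (Rval x)%:C) S].

End OnRplus.

Section ContinuousFunctions.
Context {R : realType} (Omega : set (Rplus R)).

Definition Cspace : set (Omega -> R[i]) := [set g | continuous g].

Definition supnorm (g : Omega -> R[i]) : R :=
  sup [set rnorm (g x) | x in setT].

(* A Borel extension of [g] when [Omega] is closed and [g] is continuous. *)
Definition ext0 (g : Omega -> R[i]) : Rplus R -> R[i] := 'valL_0 g.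

End ContinuousFunctions.

Arguments Cspace {R} Omega.
Arguments supnorm {R} Omega.

(* Main.v *)
Require Import Defs.
From HB Require Import structures.
From mathcomp Require Import all_boot all_order all_algebra.
From mathcomp Require Import all_classical all_reals all_analysis.
From mathcomp Require finmap.
From mathcomp Require Import sesquilinear measurable_realfun ring lra.

Set Implicit Arguments.
Unset Strict Implicit.
Unset Printing Implicit Defensive.

Import Order.TTheory GRing.Theory Num.Theory.
Import numFieldNormedType.Exports.

Local Open Scope classical_set_scope.
Local Open Scope ring_scope.
Local Open Scope complex_scope.

(* A Naimark dilation of [M] gives everything at once.  Formal combinations of
   symbols 1_A (x) h, with the form <1_A (x) h, 1_B (x) g> = <M(A & B) h, g>,
   complete to a Hilbert space on which cutting down to A is a spectral measure
   E, and <M(A) h, g> = <E(A) V h, V g> for V h = 1 (x) h.  Hence the integral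
   of f against M is V^* f(S) V, with S the integral of x against E, and its
   norm is at most ||f|| ||V^* V|| = ||f|| ||M(R_+)||, attained at f = 1.  The
   representation formula applied to p = (X - 1)^2 q reads
   int q dM = ((X - 1)^2 q)<T>; for q = 1 it gives M(R_+) = B_2(T), for
   q = sum_j a_j X^j the operator sum_j a_j T^{*j} B_2(T) T^j.  Density of the
   polynomials in C(supp M) yields uniqueness, and also the cyclicity of V for
   S: a closed subspace invariant under S is invariant under continuous
   functions of S, hence under E(A) for open, and then for all Borel, sets A. *)

(** * Complex numbers and Hilbert spaces *)

(** Positivity of [M] alone bounds the integral of a complex function only up to a factor, because
    real and imaginary parts are estimated separately. The exact constant 1 needs the dilation: [E]
    is multiplicative, so the integral of f applied to a vector has an L^2 norm of f as its norm.
    Off-diagonal values <(int f dM) h, k> are polarizations of integrals against the positive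
    measures <M(.)h, h>, so complex measures never appear. Their sesquilinearity is invisible in the
    polarization and is carried over from indicators by uniform approximation. The form of the
    dilation is nonnegative because finitely many sets cut the space into pieces on which a
    combination reduces to a single vector. The dilation is built from all measurable sets, so it is
    minimal for [E] by construction, whereas cyclicity for [S] is a separate claim. [E] and [M] have
    the same null sets, which makes f(S) depend only on the class of f in L^oo(M) and gives both
    measures the same support. *)

Section ComplexNumbers.
Context {R : realType}.
Implicit Types (z w : R[i]) (V : normedModType R[i]).

Lemma rnormE (V : normedZmodType R[i]) (x : V) : (rnorm x)%:C = `|x|.
Proof.
rewrite /rnorm; have : 0 <= `|x| by [].
by move/ger0_Im; case: `|x| => a b /= ->.
Qed.

Lemma rnorm_ge0 (V : normedZmodType R[i]) (x : V) : 0 <= rnorm x.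
Proof. by rewrite -ler0c rnormE. Qed.

Lemma ler_rnormD (V : normedZmodType R[i]) (x y : V) :
  rnorm (x + y) <= rnorm x + rnorm y.
Proof. by rewrite -lecR rmorphD/= !rnormE ler_normD. Qed.

Lemma rnormN (V : normedZmodType R[i]) (x : V) : rnorm (- x) = rnorm x.
Proof. by rewrite /rnorm normrN. Qed.

Lemma rnormB (V : normedZmodType R[i]) (x y : V) :
  rnorm (x - y) = rnorm (y - x).
Proof. by rewrite /rnorm distrC. Qed.

Lemma rnorm0 (V : normedZmodType R[i]) : rnorm (0 : V) = 0.
Proof. by rewrite /rnorm normr0. Qed.

Lemma rnorm_eq0 (V : normedZmodType R[i]) (x : V) : rnorm x = 0 -> x = 0.
Proof.
by move=> x0; apply/eqP; rewrite -normr_eq0 -rnormE x0.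
Qed.

Lemma ler_rnormB (V : normedZmodType R[i]) (x y : V) :
  rnorm (x - y) <= rnorm x + rnorm y.
Proof. by rewrite -[leRHS]/(_ + _) -(rnormN y) ler_rnormD. Qed.

Lemma rnormZ V (a : R[i]) (x : V) : rnorm (a *: x) = rnorm a * rnorm x.
Proof. by apply: complexI; rewrite rmorphM/= !rnormE normrZ. Qed.

Lemma rnormM z w : rnorm (z * w) = rnorm z * rnorm w.
Proof. by apply: complexI; rewrite rmorphM/= !rnormE normrM. Qed.

Lemma rnorm1 : rnorm (1 : R[i]) = 1.
Proof. by rewrite /rnorm normr1. Qed.

Lemma rnormR (x : R) : rnorm x%:C = `|x|.
Proof. by rewrite /rnorm normc_def /= expr0n addr0 sqrtr_sqr. Qed.

Lemma rnorm_sqr z : rnorm z ^+ 2 = complex.Re z ^+ 2 + complex.Im z ^+ 2.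
Proof.
by rewrite /rnorm normc_def/= sqr_sqrtr// addr_ge0// sqr_ge0.
Qed.

Lemma rnormJ z : rnorm (conjc z) = rnorm z.
Proof. by rewrite /rnorm normcJ. Qed.

Lemma mulcJ z : z * conjc z = (rnorm z ^+ 2)%:C.
Proof. by rewrite rmorphXn/= rnormE sqr_normc. Qed.

Lemma ge0_ReE z : 0 <= z -> (complex.Re z)%:C = z.
Proof. by move/ger0_Im; case: z => a b /= ->. Qed.

Lemma ler_Re_rnorm z : `|complex.Re z| <= rnorm z.
Proof. by rewrite -lecR rnormE normc_ge_Re. Qed.

Lemma ler_Im_rnorm z : `|complex.Im z| <= rnorm z.
Proof.
rewrite -(@ler_pXn2r _ 2)// ?nnegrE ?rnorm_ge0// rnorm_sqr real_normK ?num_real//.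
by rewrite lerDr sqr_ge0.
Qed.

Lemma ler_rnorm_ReIm z : rnorm z <= `|complex.Re z| + `|complex.Im z|.
Proof.
rewrite -(@ler_pXn2r _ 2)// ?nnegrE ?rnorm_ge0 ?addr_ge0// rnorm_sqr.
rewrite sqrrD !real_normK ?num_real// -addrA lerD2l addrC.
by rewrite lerDl mulrn_wge0// mulr_ge0.
Qed.

Lemma Re_mulCr (a : R) z : complex.Re (a%:C * z) = a * complex.Re z.
Proof. by case: z => x y /=; rewrite mul0r subr0. Qed.

Lemma eq_ReIm z w : complex.Re z = complex.Re w ->
  complex.Im z = complex.Im w -> z = w.
Proof. by case: z w => a b [c d] /= -> ->. Qed.

Lemma gtc0_Re (e : R[i]) : 0 < e -> 0 < complex.Re e /\ (complex.Re e)%:C = e.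
Proof.
move=> e0; have eE := ge0_ReE (ltW e0); split=> //.
by rewrite -eE ltcR in e0.
Qed.

Lemma cvg_rnormP V (T : Type) (F : set_system T) {FF : Filter F} (f : T -> V)
    (l : V) :
  f @ F --> l <-> forall e : R, 0 < e -> \forall x \near F, rnorm (l - f x) < e.
Proof.
split=> [/cvgrPdist_lt fl e e0|fl].
  have e0' : 0 < e%:C by rewrite ltcR.
  by have := fl _ e0'; apply: filterS => x; rewrite -rnormE ltcR.
apply/cvgrPdist_lt => e /gtc0_Re[e0 <-].
by have := fl _ e0; apply: filterS => x; rewrite -rnormE ltcR.
Qed.

Lemma cvgn_rnormP V (f : nat -> V) (l : V) :
  f @ \oo --> l <->
  forall e : R, 0 < e -> exists N, forall n, (N <= n)%N -> rnorm (l - f n) < e.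
Proof.
split=> [/cvg_rnormP fl e /fl[N _ NP]|fl]; first by exists N => n /NP.
by apply/cvg_rnormP => e /fl[N NP]; exists N => // n /= /NP.
Qed.

Lemma cvgn_unique V (f : nat -> V) (l l' : V) :
  f @ \oo --> l -> f @ \oo --> l' -> l = l'.
Proof.
move=> fl fl'; exact: (@cvg_unique V (@norm_hausdorff R[i] V) _ _ _ _ fl fl').
Qed.

Lemma cvgn_lin V (f g : nat -> V) (l m : V) (a : R[i]) :
  f @ \oo --> l -> g @ \oo --> m ->
  (fun n => a *: f n + g n) @ \oo --> a *: l + m.
Proof.
move=> fl gm; apply: cvgD; last exact: gm.
by apply: cvgZ; [exact: cvg_cst|exact: fl].
Qed.

Lemma cvgn_linC (f g : nat -> R[i]) (l m a : R[i]) :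
  f @ \oo --> l -> g @ \oo --> m ->
  (fun n => a * f n + g n) @ \oo --> a * l + m.
Proof.
move=> fl gm; apply: cvgD; last exact: gm.
by apply: cvgM; [exact: cvg_cst|exact: fl].
Qed.

(* The discriminant argument behind the Cauchy-Schwarz inequality. *)
Lemma discr_rnorm (A D : R) (b : R[i]) : 0 <= A -> 0 <= D ->
  (forall a : R[i],
    0 <= A + 2 * complex.Re (conjc a * b) + rnorm a ^+ 2 * D) ->
  rnorm b ^+ 2 <= A * D.
Proof.
move=> A0 D0 h; set n := rnorm b ^+ 2.
have n0 : 0 <= n by rewrite sqr_ge0.
have h' (t : R) : 0 <= A + 2 * t * n + t ^+ 2 * n * D.
  have := h (t%:C * b).
  have -> : conjc (t%:C * b) = t%:C * conjc b by rewrite (rmorphM (@conjc R))/= oppr0.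
  rewrite -mulrA [conjc b * _]mulrC mulcJ.
  rewrite -rmorphM/= rnormM rnormR exprMn real_normK ?num_real// -/n.
  by rewrite mulrA.
have [D00|Dn0] := eqVneq D 0; first last.
  have Dp : 0 < D by rewrite lt_def Dn0.
  (* The value [t = - D^-1] minimizes the quadratic polynomial in t. *)
  have := h' (- D^-1); have DV : D^-1 * D = 1 by rewrite mulVf.
  have -> : A + 2 * - D^-1 * n + (- D^-1) ^+ 2 * n * D =
     A - 2 * (D^-1 * n) + D^-1 * n * (D^-1 * D) by ring.
  rewrite DV mulr1 => h1.
  have : 0 <= (A - D^-1 * n) * D by rewrite mulr_ge0//; lra.
  by rewrite mulrBl mulrAC DV mul1r subr_ge0.
rewrite D00 mulr0 leNgt; apply/negP => np.
(* With [D = 0] the expression is affine in t, and this t gives it the negative value [- A - 2]. *)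
have := h' (- (A + 1) * n^-1).
rewrite D00 mulr0 addr0 -2!mulrA mulVf ?gt_eqF//; lra.
Qed.

End ComplexNumbers.

Section HilbertBasics.
Context {R : realType}.
Implicit Types (H K : hilbertType R).

Lemma hdotC H (x y : H) : hdot x y = conjc (hdot y x).
Proof. by rewrite hermC/= expr0 mul1r. Qed.

Lemma hdotDl H (x y z : H) : hdot (x + y) z = hdot x z + hdot y z.
Proof. by rewrite linearDl. Qed.

Lemma hdotDr H (x y z : H) : hdot z (x + y) = hdot z x + hdot z y.
Proof. by rewrite linearDr. Qed.

Lemma hdotZl H a (x z : H) : hdot (a *: x) z = a * hdot x z.
Proof. by rewrite linearZl_LR. Qed.

Lemma hdotZr H a (x z : H) : hdot z (a *: x) = conjc a * hdot z x.
Proof. by rewrite linearZr_LR. Qed.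

Lemma hdot0l H (z : H) : hdot 0 z = 0.
Proof. by rewrite linear0l. Qed.

Lemma hdotNr H (x z : H) : hdot z (- x) = - hdot z x.
Proof. by rewrite linearNr. Qed.

Lemma hdotBl H (x y z : H) : hdot (x - y) z = hdot x z - hdot y z.
Proof. by rewrite linearBl. Qed.

Lemma hdotBr H (x y z : H) : hdot z (x - y) = hdot z x - hdot z y.
Proof. by rewrite linearBr. Qed.

Lemma hdot_suml H I (r : seq I) (P : pred I) (F : I -> H) z :
  hdot (\sum_(i <- r | P i) F i) z = \sum_(i <- r | P i) hdot (F i) z.
Proof.
by elim/big_rec2: _ => [|i a b _ <-]; rewrite ?hdot0l// hdotDl.
Qed.

Lemma hdot_rnorm H (x : H) : hdot x x = (rnorm x ^+ 2)%:C.
Proof. by rewrite hdot_norm rmorphXn/= rnormE. Qed.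

Lemma Re_hdot_rnorm H (x : H) : complex.Re (hdot x x) = rnorm x ^+ 2.
Proof. by rewrite hdot_rnorm. Qed.

Lemma rnorm_sqrD H (x y : H) :
  rnorm (x + y) ^+ 2 = rnorm x ^+ 2 + rnorm y ^+ 2 + 2 * complex.Re (hdot x y).
Proof.
rewrite -!Re_hdot_rnorm hdotDl !hdotDr !raddfD/= (hdotC y x).
by case: (hdot x y) => a b /=; ring.
Qed.

Lemma rnorm_sqrB H (x y : H) :
  rnorm (x - y) ^+ 2 = rnorm x ^+ 2 + rnorm y ^+ 2 - 2 * complex.Re (hdot x y).
Proof. by rewrite rnorm_sqrD rnormN hdotNr raddfN/= mulrN. Qed.

Lemma cauchy_schwarz H (x y : H) : rnorm (hdot x y) <= rnorm x * rnorm y.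
Proof.
rewrite -(@ler_pXn2r _ 2)// ?nnegrE ?mulr_ge0 ?rnorm_ge0// exprMn.
apply: discr_rnorm => [||a]; rewrite ?sqr_ge0// -exprMn -rnormZ.
by rewrite -hdotZr addrAC -rnorm_sqrD sqr_ge0.
Qed.

Lemma hdot_ext H (x y : H) : (forall z, hdot x z = hdot y z) -> x = y.
Proof.
move=> xy; apply/eqP; rewrite -subr_eq0; apply/eqP/rnorm_eq0/eqP.
by rewrite -sqrf_eq0 -Re_hdot_rnorm hdotBl xy subrr.
Qed.

Lemma polarization (V : lmodType R[i]) (B : V -> V -> R[i]) :
  (forall z, {morph B^~ z : x y / x + y}) ->
  (forall z, {morph B z : x y / x + y}) ->
  (forall a x y, B (a *: x) y = a * B x y) ->
  (forall a x y, B x (a *: y) = conjc a * B x y) ->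
  forall x y, 4%:R * B x y = B (x + y) (x + y) - B (x - y) (x - y) +
   'i%C * (B (x + 'i%C *: y) (x + 'i%C *: y)
        - B (x - 'i%C *: y) (x - 'i%C *: y)).
Proof.
move=> Dl Dr Zl Zr x y.
have N1 z w : B (- z) w = - B z w by rewrite -scaleN1r Zl mulN1r.
have N2 z w : B z (- w) = - B z w by rewrite -scaleN1r Zr rmorphN1 mulN1r.
rewrite !(Dl, Dr, N1, N2, Zl, Zr).
case: (B x x) (B x y) (B y x) (B y y) => [a a'] [b b'] [c c'] [d d'].
by simpc; apply/eqP; rewrite eq_complex/=; apply/andP; split; apply/eqP; ring.
Qed.

Lemma linear_D (V W : lmodType R[i]) (A : V -> W) : linear A ->
  {morph A : x y / x + y}.
Proof. by move=> lA x y; have := lA 1 x y; rewrite !scale1r. Qed.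

Lemma linear_0 (V W : lmodType R[i]) (A : V -> W) : linear A -> A 0 = 0.
Proof.
by move=> lA; have := lA (-1) 0 0; rewrite scaler0 addr0 scaleN1r addNr.
Qed.

Lemma linear_Z (V W : lmodType R[i]) (A : V -> W) : linear A ->
  forall a, {morph A : x / a *: x}.
Proof. by move=> lA a x; have := lA a x 0; rewrite (linear_0 lA) !addr0. Qed.

Lemma linear_B (V W : lmodType R[i]) (A : V -> W) : linear A ->
  {morph A : x y / x - y}.
Proof.
by move=> lA x y; rewrite (linear_D lA) -scaleN1r (linear_Z lA) scaleN1r.
Qed.

(** The sign condition matters on the zero space, where the inequality alone would admit negative
    c. *)
Definition op_bound H K (A : H -> K) (c : R) :=
  0 <= c /\ forall h, rnorm (A h) <= c * rnorm h.

(** Over the complex field polarization recovers the whole form from its diagonal. Operator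
    integrals are specified on the diagonal only, so this is how identities between them are
    proved. *)
Lemma form_ext H (A B : H -> H) : linear A -> linear B ->
  (forall h, hdot (A h) h = hdot (B h) h) -> A = B.
Proof.
move=> lA lB AB; apply/funext => x; apply: hdot_ext => y.
have n4 : (4%:R : R[i]) != 0 by rewrite pnatr_eq0.
have pol (C : H -> H) : linear C ->
    (forall z, {morph (fun x => hdot (C x) z) : x y / x + y}) /\
    (forall a x y, hdot (C (a *: x)) y = a * hdot (C x) y).
  move=> lC; split=> [z u v|a u v]; first by rewrite (linear_D lC) hdotDl.
  by rewrite (linear_Z lC) hdotZl.
have [DA ZA] := pol _ lA; have [DB ZB] := pol _ lB.
apply: (mulfI n4).
rewrite (@polarization _ (fun x y => hdot (A x) y))//; last 2 first.
- by move=> z u v; rewrite hdotDr.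
- by move=> *; rewrite hdotZr.
rewrite (@polarization _ (fun x y => hdot (B x) y))//; last 2 first.
- by move=> z u v; rewrite hdotDr.
- by move=> *; rewrite hdotZr.
by rewrite !AB.
Qed.

Lemma bounded_opP H K (A : H -> K) :
  bounded_op A <-> linear A /\ exists c, op_bound A c.
Proof.
split=> [[lA cA]|[lA [c [c0 Ac]]]]; split=> //.
  have /cvg_rnormP/(_ 1 ltr01) := cA 0.
  rewrite (linear_0 lA) => /nbhs_normP[d' /gtc0_Re[d0 <-]].
  set d := complex.Re _ in d0 *; rewrite /ball_ => dP.
  have dP' h : rnorm h < d -> rnorm (A h) < 1.
    move=> hd; rewrite -rnormN -sub0r; apply: dP => /=.
    by rewrite sub0r normrN -rnormE ltcR.
  exists (2 / d); split=> [|h]; first by rewrite divr_ge0// ltW.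
  have [->|h0] := eqVneq h 0; first by rewrite (linear_0 lA) !rnorm0 mulr0.
  have hp : 0 < rnorm h.
    rewrite lt_def rnorm_ge0 andbT; apply: contra_neq h0; exact: rnorm_eq0.
  (* The vector is rescaled to norm d / 2, inside the ball where [A] stays below 1; hence the
     constant 2 / d. *)
  have := dP' ((d / (2 * rnorm h))%:C *: h).
  rewrite (linear_Z lA) !rnormZ rnormR gtr0_norm ?divr_gt0 ?mulr_gt0//.
  have -> : d / (2 * rnorm h) * rnorm h = d / 2 by field; lra.
  have dlt : d / 2 < d by lra.
  move=> /(_ dlt); rewrite -ltr_pdivlMl ?divr_gt0 ?mulr_gt0// => /ltW.
  by rewrite mulr1 invf_div mulrAC.
move=> x; apply/cvg_rnormP => e e0.
have c1 : 0 < c + 1 by lra.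
apply/nbhs_normP; exists (e / (c + 1))%:C; first by rewrite /= ltcR divr_gt0.
move=> y; rewrite /ball_/= -rnormE ltcR -(linear_B lA) ltr_pdivlMr// => xy.
rewrite (le_lt_trans (Ac _))// (le_lt_trans _ xy)// mulrC.
by rewrite ler_wpM2l ?rnorm_ge0//; lra.
Qed.

Lemma bounded_opD H K (A B : H -> K) : bounded_op A -> bounded_op B ->
  bounded_op (A + B).
Proof.
move=> /bounded_opP[lA [c [c0 cA]]] /bounded_opP[lB [d [d0 dB]]].
apply/bounded_opP; split=> [a x y|].
  have E z : (A + B) z = A z + B z by [].
  rewrite !E (linear_D lA) (linear_D lB) (linear_Z lA) (linear_Z lB).
  by rewrite scalerDr addrACA.
exists (c + d); split=> [|h]; first by rewrite addr_ge0.
by rewrite mulrDl (le_trans (ler_rnormD _ _))// lerD.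
Qed.

Lemma bounded_opZ H K (a : R[i]) (A : H -> K) : bounded_op A ->
  bounded_op (a *: A).
Proof.
move=> /bounded_opP[lA [c [c0 cA]]].
apply/bounded_opP; split=> [b x y|].
  have E z : (a *: A) z = a *: A z by [].
  by rewrite !E (linear_D lA) (linear_Z lA) scalerDr !scalerA mulrC.
exists (rnorm a * c); split=> [|h]; first by rewrite mulr_ge0// rnorm_ge0.
by rewrite rnormZ -mulrA ler_wpM2l// rnorm_ge0.
Qed.

Lemma bounded_op_comp H K (L : hilbertType R) (A : K -> L) (B : H -> K) :
  bounded_op A -> bounded_op B -> bounded_op (A \o B).
Proof.
move=> [lA cA] [lB cB]; split=> [a x y|x].
  by rewrite /= (linear_D lB) (linear_Z lB) (linear_D lA) (linear_Z lA).
by apply: continuous_comp; [exact: cB|exact: cA].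
Qed.

Lemma bounded_op0 H K : bounded_op (0 : H -> K).
Proof.
apply/bounded_opP; split=> [a x y|]; first by rewrite scaler0 addr0.
by exists 0; split=> // h; rewrite rnorm0 mul0r.
Qed.

Section OperatorNorm.
Variables H K : hilbertType R.
Implicit Types A B : H -> K.

Lemma opnorm_le A c : op_bound A c -> opnorm A <= c.
Proof.
move=> [c0 Ac]; apply: ge_sup; first by exists (rnorm (A 0)), 0 => //=; rewrite rnorm0.
move=> _ [h h1 <-]; rewrite (le_trans (Ac _))// -[leRHS]mulr1 ler_wpM2l//.
Qed.

Lemma opnorm_ub A h : bounded_op A -> rnorm h <= 1 -> rnorm (A h) <= opnorm A.
Proof.
move=> /bounded_opP[lA [c [c0 cA]]] h1; apply: ub_le_sup; last by exists h.
exists c => _ [k k1 <-]; rewrite (le_trans (cA _))// -[leRHS]mulr1 ler_wpM2l//.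
Qed.

Lemma opnorm_ge0 A : bounded_op A -> 0 <= opnorm A.
Proof.
move=> bA; apply: le_trans (opnorm_ub (h := 0) bA _); first exact: rnorm_ge0.
by rewrite rnorm0.
Qed.

Lemma opnorm_bound A : bounded_op A -> op_bound A (opnorm A).
Proof.
move=> bA; split=> [|h]; first exact: opnorm_ge0.
have [lA _] := bA.
have [->|h0] := eqVneq h 0; first by rewrite (linear_0 lA) !rnorm0 mulr0.
have hp : 0 < rnorm h.
  rewrite lt_def rnorm_ge0 andbT; apply: contra_neq h0; exact: rnorm_eq0.
have := @opnorm_ub A ((rnorm h)^-1%:C *: h) bA.
rewrite (linear_Z lA) !rnormZ rnormR gtr0_norm ?invr_gt0// mulVf ?gt_eqF//.
by move=> /(_ (lexx _)); rewrite ler_pdivrMl// mulrC.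
Qed.

End OperatorNorm.

End HilbertBasics.

(** * Riesz representation, operators from bounded sesquilinear forms, adjoints *)

Section Riesz.
Context {R : realType}.
Implicit Types (H K : hilbertType R).

Definition rcauchy (V : normedModType R[i]) (u : nat -> V) :=
  forall e : R, 0 < e -> exists N, forall m n, (N <= m)%N -> (N <= n)%N ->
    rnorm (u m - u n) < e.

Lemma hilbert_complete H (u : nat -> H) : rcauchy u ->
  exists l : H, u @ \oo --> l.
Proof.
move=> cu; suff : cauchy (u @ \oo) by move/cauchy_cvg => ?; exists (lim (u @ \oo)).
apply/cauchy_ballP => e /gtc0_Re[e0 <-].
have [N NP] := cu _ e0.
pose U := u @` [set n | (N <= n)%N].
have oU : (u @ \oo) U by exists N => // n /= Nn; exists n.
exists (U, U) => //= -[x y] [/= [m Nm <-] [n Nn <-]].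
by rewrite -ball_normE/= -rnormE ltcR NP.
Qed.

(** The representing vector is found as the minimizer of [J]: if phi x = <x, y>, then J x = |x -
    y|^2 - |y|^2. *)
Lemma riesz H (phi : H -> R[i]) : scalar phi ->
  (exists2 c : R, 0 <= c & forall x, rnorm (phi x) <= c * rnorm x) ->
  exists y, forall x, phi x = hdot x y.
Proof.
move=> lphi [c c0 phic].
have phiD x y : phi (x + y) = phi x + phi y.
  by have := lphi 1 x y; rewrite scale1r mul1r.
have phi0 : phi 0 = 0 by apply: (@addIr _ (phi 0)); rewrite -phiD !add0r.
have phiZ a x : phi (a *: x) = a * phi x.
  by have := lphi a x 0; rewrite phi0 !addr0.
pose J x : R := rnorm x ^+ 2 - 2 * complex.Re (phi x).
have Jlb x : - c ^+ 2 <= J x.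
  have h1 : `|complex.Re (phi x)| <= c * rnorm x.
    exact: le_trans (ler_Re_rnorm _) (phic x).
  have := ler_norm (complex.Re (phi x)).
  by have := sqr_ge0 (rnorm x - c); rewrite /J; nra.
have hinf : has_inf (range J).
  by split; [exists (J 0), 0|exists (- c ^+ 2) => _ [x _ <-]].
set m := inf (range J).
have mJ x : m <= J x by apply: ge_inf; [case: hinf|exists x].
have [u uP] : exists u : nat -> H, forall n, J (u n) < m + n.+1%:R^-1.
  have E n : exists x, J x < m + n.+1%:R^-1.
    have n0 : (0 : R) < n.+1%:R^-1 by rewrite invr_gt0.
    by have [_ [x _ <-] xm] := inf_adherent n0 hinf; exists x.
  by exists (fun n => xget 0 [set x | J x < m + n.+1%:R^-1]) => n; exact: (xgetPex 0 (E n)).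
(* Parallelogram law: [J] is at least m at the midpoint, so near-minimizers are close to each
   other. *)
have Jpar x y : rnorm (x - y) ^+ 2 <= 2 * (J x + J y - 2 * m).
  have := mJ ((2^-1)%:C *: (x + y)).
  rewrite /J rnormZ rnormR phiZ phiD Re_mulCr raddfD/= ger0_norm ?invr_ge0//.
  by rewrite exprMn rnorm_sqrD rnorm_sqrB expr2; lra.
have small (e : R) : 0 < e -> exists N, forall n, (N <= n)%N -> n.+1%:R^-1 < e.
  by move=> e0; have [N _ NP] := near_infty_natSinv_lt (PosNum e0); exists N => n /NP.
have [y uy] : exists y : H, u @ \oo --> y.
  apply: hilbert_complete => e e0.
  have e4 : 0 < e ^+ 2 / 4 by rewrite divr_gt0 ?exprn_gt0.
  have [N NP] := small _ e4.
  exists N => p q Np Nq.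
  rewrite -(@ltr_pXn2r _ 2)// ?nnegrE ?rnorm_ge0 ?ltW//.
  have uN n : (N <= n)%N -> J (u n) < m + e ^+ 2 / 4.
    by move=> Nn; rewrite (lt_trans (uP n))// ltrD2l NP.
  by have := Jpar (u p) (u q); have := uN _ Np; have := uN _ Nq; lra.
(* The right-hand side is J (y + z) - J y, nonnegative at a minimizer. It is obtained from the
   approximants [u n] rather than from continuity of [J]. *)
have var (z : H) : 0 <= rnorm z ^+ 2 + 2 * complex.Re (hdot y z - phi z).
  rewrite leNgt; apply/negP; set v := _ + _ => v0.
  (* With this d the approximation error d (1 + 2 |z|) equals - v / 2, so a negative v would push
     [J (u n + z)] below m. *)
  have d0 : 0 < - v / (2 * (1 + 2 * rnorm z)).
    by rewrite divr_gt0 ?oppr_gt0// mulr_gt0// ltr_pwDl// mulr_ge0// rnorm_ge0.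
  set d := _ / _ in d0.
  have [N1 N1P] := small d d0.
  have [N2 N2P] := (cvgn_rnormP _ _).1 uy d d0.
  pose n := maxn N1 N2.
  have h2 := N2P n (leq_maxr _ _).
  have h3 : J (u n) < m + d.
    by rewrite (lt_trans (uP n))// ltrD2l N1P// leq_maxl.
  have h4 := mJ (u n + z).
  have h5 := cauchy_schwarz (y - u n) z.
  have h6 := le_trans (ler_Re_rnorm _) h5.
  have := ler_norm (- complex.Re (hdot (y - u n) z)); rewrite normrN => h7.
  have h8 : rnorm (y - u n) * rnorm z <= d * rnorm z.
    by rewrite ler_wpM2r ?rnorm_ge0// ltW.
  have h9 : d * (2 * (1 + 2 * rnorm z)) = - v.
    have z0 := rnorm_ge0 z; rewrite /d divfK// gt_eqF//; lra.
  rewrite hdotBl raddfB/= in h7 h6.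
  move: h3 h4; rewrite /J rnorm_sqrD phiD raddfD/=.
  have vE : v = rnorm z ^+ 2 + 2 * (complex.Re (hdot y z) - complex.Re (phi z)).
    by rewrite /v raddfB.
  by clearbody d v; lra.
exists y => x; apply/eqP; rewrite -subr_eq0; apply/eqP/rnorm_eq0/eqP.
rewrite -sqrf_eq0 eq_le sqr_ge0 andbT.
pose b := hdot y x - conjc (phi x).
have -> : phi x - hdot x y = - conjc b by rewrite /b raddfB/= conjcK -hdotC opprB.
rewrite rnormN rnormJ -[leRHS](mul0r (rnorm x ^+ 2)).
(* Along the multiples of x the variation is a quadratic with constant term 0, so the discriminant
   bound forces b = 0. *)
apply: discr_rnorm => // [|a]; first exact: sqr_ge0.
have := var (a *: x); rewrite rnormZ exprMn hdotZr phiZ add0r addrC.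
congr (0 <= 2 * _ + _); rewrite /b mulrBr !raddfB/=; congr (_ - _).
by case: a (phi x) => [a a'] [p p'] /=; ring.
Qed.

Definition is_adj H K (A : H -> K) (B : K -> H) :=
  bounded_op B /\ forall h k, hdot (A h) k = hdot h (B k).

(** Riesz is applied to the conjugate of [B h], which is linear because [B] is conjugate linear in
    its second argument; testing against [A h] itself gives the bound. *)
Lemma sesquilinear_op H K (B : H -> K -> R[i]) (c : R) :
  0 <= c ->
  (forall k, scalar (B^~ k)) ->
  (forall h a x y, B h (a *: x + y) = conjc a * B h x + B h y) ->
  (forall h k, rnorm (B h k) <= c * rnorm h * rnorm k) ->
  exists2 A : H -> K, linear A /\ op_bound A c & forall h k, B h k = hdot (A h) k.
Proof.
move=> c0 lB sB cB.
have ex h : exists y, forall k, conjc (B h k) = hdot k y.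
  apply: riesz => [a x y|]; first by rewrite sB raddfD/= rmorphM/= conjcK.
  exists (c * rnorm h) => [|x]; first by rewrite mulr_ge0 ?rnorm_ge0.
  by rewrite rnormJ.
pose A h := xget 0 [set y | forall k, conjc (B h k) = hdot k y].
have AP h k : B h k = hdot (A h) k.
  by rewrite hdotC -(xgetPex 0 (ex h)) conjcK.
exists A => //; split=> [a x y|].
  by apply: hdot_ext => z; rewrite hdotDl hdotZl -!AP lB.
split=> // h; have [->|Ah0] := eqVneq (rnorm (A h)) 0.
  by rewrite mulr_ge0 ?rnorm_ge0.
have Ap : 0 < rnorm (A h) by rewrite lt_def Ah0 rnorm_ge0.
have := cB h (A h); rewrite AP hdot_rnorm rnormR ger0_norm ?sqr_ge0// expr2.
by rewrite ler_pM2r.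
Qed.

Lemma is_adj_ex H K (A : H -> K) : bounded_op A -> exists B, is_adj A B.
Proof.
move=> /bounded_opP[lA [c [c0 cA]]].
have [||||B [lB cB] BE] := @sesquilinear_op K H (fun k h => hdot k (A h)) c.
- by [].
- by move=> k a x y; rewrite hdotDl hdotZl.
- by move=> h a x y; rewrite (linear_D lA) (linear_Z lA) hdotDr hdotZr.
- move=> h k; rewrite (le_trans (cauchy_schwarz _ _))// mulrC mulrAC.
  by rewrite ler_wpM2r ?rnorm_ge0.
exists B; split=> [|h k]; first by apply/bounded_opP; split=> //; exists c.
by rewrite hdotC BE -hdotC.
Qed.

Lemma adjP H K (A : H -> K) : bounded_op A -> is_adj A (adj A).
Proof.
move=> bA; rewrite /adj; apply: (xgetPex (fun=> 0)); exact: is_adj_ex.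
Qed.

Lemma bounded_adj H K (A : H -> K) : bounded_op A -> bounded_op (adj A).
Proof. by case/adjP. Qed.

Lemma hdot_adj H K (A : H -> K) h k : bounded_op A ->
  hdot (A h) k = hdot h (adj A k).
Proof. by case/adjP. Qed.

Lemma hdot_adjC H K (A : H -> K) h k : bounded_op A ->
  hdot (adj A k) h = hdot k (A h).
Proof. by move=> bA; rewrite hdotC -hdot_adj// -hdotC. Qed.

End Riesz.

(** * Integration against a semispectral measure *)

Section BoundedFunctions.
Context {R : realType} d (T : measurableType d).
Implicit Types (f g : T -> R[i]) (A B : set T).

(** Bounded everywhere rather than essentially, so that the class is independent of any measure.
    Essentially bounded functions are brought into it by [ctrunc]. *)
Definition bdd_mfun f := cmeasurable f /\ exists c : R, forall x, rnorm (f x) <= c.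

Definition cindic A : T -> R[i] := fun x => (\1_A x)%:C.

Lemma fct_linE (a : R[i]) f g x : (a *: f + g) x = a * f x + g x.
Proof. by []. Qed.

Lemma cmeasurable_lin (a : R[i]) f g :
  cmeasurable f -> cmeasurable g -> cmeasurable (a *: f + g).
Proof.
case: a => a a' [f1 f2] [g1 g2]; split.
  rewrite (_ : (fun _ => _) = (fun x => a * complex.Re (f x) -
      a' * complex.Im (f x) + complex.Re (g x))); last first.
    by apply/funext => x; rewrite fct_linE; case: (f x) (g x) => [u v] [u' v'].
  apply: measurable_funD => //; apply: measurable_funB; exact: measurable_funM.
rewrite (_ : (fun _ => _) = (fun x => a * complex.Im (f x) +
    a' * complex.Re (f x) + complex.Im (g x))); last first.
  by apply/funext => x; rewrite fct_linE; case: (f x) (g x) => [u v] [u' v'].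
apply: measurable_funD => //; apply: measurable_funD; exact: measurable_funM.
Qed.

Lemma cmeasurableM f g :
  cmeasurable f -> cmeasurable g -> cmeasurable (fun x => f x * g x).
Proof.
move=> [f1 f2] [g1 g2]; split.
  rewrite (_ : (fun _ => _) = (fun x => complex.Re (f x) * complex.Re (g x) -
      complex.Im (f x) * complex.Im (g x))); last first.
    by apply/funext => x; case: (f x) (g x) => [u v] [u' v'].
  by apply: measurable_funB; exact: measurable_funM.
rewrite (_ : (fun _ => _) = (fun x => complex.Re (f x) * complex.Im (g x) +
    complex.Im (f x) * complex.Re (g x))); last first.
  by apply/funext => x; case: (f x) (g x) => [u v] [u' v'].
by apply: measurable_funD; exact: measurable_funM.
Qed.

Lemma cmeasurableR (u : T -> R) :
  measurable_fun setT u -> cmeasurable (fun x => (u x)%:C).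
Proof. by move=> mu; split => //=; exact: measurable_cst. Qed.

Lemma cmeasurableJ f : cmeasurable f -> cmeasurable (fun x => conjc (f x)).
Proof.
move=> [f1 f2]; split.
  by rewrite (_ : (fun _ => _) = fun x => complex.Re (f x))//;
    apply/funext => x; case: (f x).
rewrite (_ : (fun _ => _) = fun x => - complex.Im (f x)).
  exact: measurableT_comp.
by apply/funext => x; case: (f x).
Qed.

Lemma bdd_mfun_lin a f g : bdd_mfun f -> bdd_mfun g -> bdd_mfun (a *: f + g).
Proof.
move=> [mf [c fc]] [mg [c' gc']]; split; first exact: cmeasurable_lin.
exists (rnorm a * c + c') => x; rewrite (le_trans (ler_rnormD _ _))//.
by rewrite lerD// rnormM ler_wpM2l ?rnorm_ge0.
Qed.

Lemma bdd_mfunM f g : bdd_mfun f -> bdd_mfun g -> bdd_mfun (fun x => f x * g x).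
Proof.
move=> [mf [c fc]] [mg [c' gc']]; split; first exact: cmeasurableM.
by exists (c * c') => x; rewrite rnormM ler_pM ?rnorm_ge0.
Qed.

Lemma bdd_mfunJ f : bdd_mfun f -> bdd_mfun (fun x => conjc (f x)).
Proof.
move=> [mf [c fc]]; split; first exact: cmeasurableJ.
by exists c => x; rewrite rnormJ.
Qed.

Lemma bdd_cindic A : measurable A -> bdd_mfun (cindic A).
Proof.
move=> mA; split; first by apply: cmeasurableR; exact: measurable_indic.
by exists 1 => x; rewrite rnormR indicE; case: (_ \in _); rewrite ?normr1 ?normr0.
Qed.

Lemma bdd_cst (a : R[i]) : bdd_mfun (fun=> a).
Proof. by split; [split; exact: measurable_cst|exists (rnorm a)]. Qed.

Lemma bdd_mfun0 : bdd_mfun 0. Proof. exact: bdd_cst. Qed.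

Lemma bdd_mfunB f g : bdd_mfun f -> bdd_mfun g -> bdd_mfun (f - g).
Proof. by move=> bf bg; rewrite addrC -scaleN1r; exact: bdd_mfun_lin. Qed.

(** S is the minimum of N and the integer part of s. It evaluates a sum of N layers of superlevel
    indicators at a point. *)
Lemma count_le_floor (s : R) N : 0 <= s ->
  let S : R := \sum_(0 <= k < N) (k.+1%:R <= s)%R%:R in
  [/\ S <= s, N%:R <= s -> S = N%:R & s < N%:R -> s - 1 < S].
Proof.
move=> s0; elim: N => [|N [h1 h2 h3]] /=.
  by rewrite big_nil; split=> //; lra.
rewrite big_nat_recr//=; case: (leP N.+1%:R s) => hN; last first.
  rewrite addr0; split=> // _; case: (leP N%:R s) => [/h2 ->|/h3//].
  by rewrite -natr1 in hN; lra.
have hN' : N%:R <= s by rewrite -natr1 in hN; lra.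
rewrite (h2 hN') natr1; split=> //; lra.
Qed.

(* Bounded measurable functions are uniform limits of combinations of
   indicators of superlevel sets. *)
Lemma bdd_mfun_ind (P : (T -> R[i]) -> Prop) :
  (forall A, measurable A -> P (cindic A)) ->
  (forall a f g, bdd_mfun f -> bdd_mfun g -> P f -> P g -> P (a *: f + g)) ->
  (forall f, bdd_mfun f -> (forall e : R, 0 < e -> exists g,
     [/\ bdd_mfun g, P g & forall x, rnorm (f x - g x) <= e]) -> P f) ->
  forall f, bdd_mfun f -> P f.
Proof.
move=> Pind Plin Plim.
have P0 : P 0.
  rewrite (_ : 0 = cindic set0); first exact: Pind.
  by apply/funext => x; rewrite /cindic indic0.
have Ppos (u : T -> R) (c : R) : measurable_fun setT u ->
    (forall x, 0 <= u x <= c) -> P (fun x => (u x)%:C).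
  move=> mu uc; have bu : bdd_mfun (fun x => (u x)%:C).
    split; first exact: cmeasurableR.
    by exists c => x; have /andP[u0 uc'] := uc x; rewrite rnormR ger0_norm.
  apply: Plim => // e e0; have [n _ /(_ n (leqnn n)) nP] := near_infty_natSinv_lt (PosNum e0).
  (* N layers of height 1 / (n + 1) reach above c, so the staircase is nowhere cut off. *)
  have [N NP] : exists N : nat, c * n.+1%:R < N%:R.
    exists (Num.bound `|c * n.+1%:R|); exact: le_lt_trans (ler_norm _) (archi_boundP (normr_ge0 _)).
  pose A k := [set x | k.+1%:R <= u x * n.+1%:R].
  have mA k : measurable (A k).
    rewrite -[A k]setTI; apply: measurable_fun_le => //.
    exact: measurable_funM.
  pose g N : T -> R[i] := \sum_(0 <= k < N) n.+1%:R^-1 *: cindic (A k).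
  have gP m : bdd_mfun (g m) /\ P (g m).
    rewrite /g; elim: m => [|m [IH1 IH2]].
      by rewrite big_nil; split=> //; exact: bdd_mfun0.
    rewrite big_nat_recr//= addrC; have bA := bdd_cindic (mA m).
    by split; [exact: bdd_mfun_lin|apply: Plin => //; exact: Pind].
  exists (g N); split; [exact: (gP N).1|exact: (gP N).2|move=> x].
  have -> : g N x =
      (n.+1%:R^-1 * \sum_(0 <= k < N) (k.+1%:R <= u x * n.+1%:R)%R%:R)%:C.
    rewrite /g fct_sumE mulr_sumr rmorph_sum/=; apply: eq_bigr => k _.
    rewrite rmorphM/= fmorphV rmorph_nat; congr (_ * _%:C).
    by rewrite indicE; congr (_%:R); rewrite /A mem_setE.
  rewrite -rmorphB/= rnormR.
  have n0 : (0 : R) < n.+1%:R by rewrite ltr0n.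
  have /andP[u0 uc'] := uc x.
  have [h1 _ h3] := count_le_floor N (mulr_ge0 u0 (ltW n0)).
  have {}h3 := h3 (le_lt_trans (ler_wpM2r (ltW n0) uc') NP).
  rewrite (le_trans _ (ltW nP))// -(ler_pM2r n0) mulVf ?gt_eqF//.
  rewrite -[X in _ * X]gtr0_norm// -normrM mulrBl mulrAC mulVf ?gt_eqF// mul1r.
  by rewrite ger0_norm; lra.
have Preal (u : T -> R) (c : R) : measurable_fun setT u ->
    (forall x, `|u x| <= c) -> P (fun x => (u x)%:C).
  move=> mu uc.
  (* Adding c makes the function nonnegative; the constant is taken off again as a multiple of the
     indicator of the whole space. *)
  have -> : (fun x => (u x)%:C) =
      (- c%:C) *: cindic setT + (fun x => (u x + c)%:C).
    apply/funext => x; rewrite -[RHS]/(- c%:C * cindic setT x + (u x + c)%:C).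
    by rewrite /cindic indicT mulr1 rmorphD/= addrC addrK.
  have mu' : measurable_fun setT (fun x => u x + c).
    by apply: measurable_funD => //; exact: measurable_cst.
  have uc2 x : 0 <= u x + c <= 2 * c.
    by have := uc x; rewrite ler_norml => /andP[? ?]; apply/andP; split; lra.
  apply: Plin; last exact: (Ppos _ (2 * c)).
  - exact: bdd_cindic.
  - split; first exact: cmeasurableR.
    exists (2 * c) => x; have /andP[h1 h2] := uc2 x.
    by rewrite rnormR ger0_norm.
  - exact: Pind.
move=> f [[f1 f2] [c fc]].
have Ref x : `|complex.Re (f x)| <= c := le_trans (ler_Re_rnorm _) (fc x).
have Imf x : `|complex.Im (f x)| <= c := le_trans (ler_Im_rnorm _) (fc x).
have -> : f = 'i%C *: (fun x => (complex.Im (f x))%:C) +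
    (fun x => (complex.Re (f x))%:C).
  by apply/funext => x; rewrite {1}[f x]complexE addrC.
apply: Plin; [| |exact: (Preal _ c)|exact: (Preal _ c)].
- by split; [exact: cmeasurableR|exists c => x; rewrite rnormR].
- by split; [exact: cmeasurableR|exists c => x; rewrite rnormR].
Qed.

Definition bdd_functional (Phi : (T -> R[i]) -> R[i]) :=
  (forall a f g, bdd_mfun f -> bdd_mfun g ->
     Phi (a *: f + g) = a * Phi f + Phi g) /\
  exists2 C : R, 0 <= C & forall f c, bdd_mfun f ->
     (forall x, rnorm (f x) <= c) -> 0 <= c -> rnorm (Phi f) <= C * c.

Lemma bdd_functional_lin a Phi Psi : bdd_functional Phi ->
  bdd_functional Psi -> bdd_functional (fun f => a * Phi f + Psi f).
Proof.
move=> [l1 [C1 C10 h1]] [l2 [C2 C20 h2]]; split=> [b f g bf bg|].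
  by rewrite l1// l2//; ring.
exists (rnorm a * C1 + C2) => [|f c bf fc c0].
  by rewrite addr_ge0// mulr_ge0// rnorm_ge0.
rewrite (le_trans (ler_rnormD _ _))// rnormM mulrDl lerD//; last exact: h2.
by rewrite -mulrA ler_wpM2l ?rnorm_ge0//; exact: h1.
Qed.

Lemma bdd_functional0 : bdd_functional (fun=> 0).
Proof.
split=> [*|]; first by rewrite mulr0 addr0.
by exists 0 => // f c *; rewrite rnorm0 mul0r.
Qed.

Lemma bdd_functionalZ a Phi : bdd_functional Phi ->
  bdd_functional (fun f => a * Phi f).
Proof.
move=> /(bdd_functional_lin a)/(_ bdd_functional0).
by under eq_fun do rewrite addr0.
Qed.

Lemma bdd_functionalD Phi Psi : bdd_functional Phi ->
  bdd_functional Psi -> bdd_functional (fun f => Phi f + Psi f).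
Proof.
move=> h1 h2; have := bdd_functional_lin 1 h1 h2.
by under eq_fun do rewrite mul1r.
Qed.

Lemma bdd_functionalB Phi Psi : bdd_functional Phi ->
  bdd_functional Psi -> bdd_functional (fun f => Phi f - Psi f).
Proof.
move=> h1 h2; have := bdd_functional_lin (-1) h2 h1.
by under eq_fun do rewrite mulN1r addrC.
Qed.

(** The difference is bounded for the sup norm, so its vanishing survives the uniform limits of
    [bdd_mfun_ind]. Most identities between integrals below are checked on indicators and extended
    by this. *)
Lemma bdd_functional_ext Phi Psi : bdd_functional Phi -> bdd_functional Psi ->
  (forall A, measurable A -> Phi (cindic A) = Psi (cindic A)) ->
  forall f, bdd_mfun f -> Phi f = Psi f.
Proof.
move=> h1 h2 PP f bf; apply/eqP; rewrite -subr_eq0; apply/eqP; move: f bf.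
have [l3 [C C0 h3]] := bdd_functionalB h1 h2.
apply: bdd_mfun_ind.
- by move=> A mA; rewrite PP// subrr.
- by move=> a f g bf bg e1 e2; rewrite l3// e1 e2 mulr0 addr0.
move=> f bf fP; apply: rnorm_eq0; apply/eqP; rewrite eq_le rnorm_ge0 andbT.
apply/ler_addgt0Pr => e e0; rewrite add0r.
have e1 : 0 < e / (C + 1) by rewrite divr_gt0// ltr_wpDl.
have [g [bg g0 gf]] := fP _ e1.
have -> : Phi f - Psi f = (Phi (f - g) - Psi (f - g)).
  have := l3 (-1) g f bg bf.
  by rewrite g0 mulr0 add0r scaleN1r [- g + f]addrC => <-.
rewrite (le_trans (h3 _ _ (bdd_mfunB bf bg) gf (ltW e1)))//.
by rewrite mulrA ler_pdivrMr ?ltr_wpDl//; nra.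
Qed.

End BoundedFunctions.

(** * Complex integrals against a finite positive measure *)

Section ComplexIntegral.
Context {R : realType} d (T : measurableType d).
Context (mu : {measure set T -> \bar R}) (mufin : (mu setT < +oo)%E).
Implicit Types (f g : T -> R[i]).

(** Written as the right-hand side of [is_opint], so that the two agree by conversion. *)
Definition cint f : R[i] :=
  Complex (\int[mu]_x complex.Re (f x)) (\int[mu]_x complex.Im (f x)).

Let mass : R := fine (mu setT).

Let mass_ge0 : 0 <= mass. Proof. exact: fine_ge0. Qed.

Lemma bdd_integrable (u : T -> R) (c : R) : measurable_fun setT u ->
  (forall x, `|u x| <= c) -> mu.-integrable setT (EFin \o u).
Proof.
move=> mu' uc; apply: measurable_bounded_integrable => //.
exists c; split; first by rewrite num_real.
by move=> M cM x _ /=; rewrite (le_trans (uc x))// ltW.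
Qed.

Lemma bdd_Rintegral_le (u : T -> R) (c : R) : measurable_fun setT u ->
  (forall x, `|u x| <= c) -> `|\int[mu]_x u x| <= c * mass.
Proof.
move=> mu' uc; have iu := bdd_integrable mu' uc.
rewrite (le_trans (le_normr_Rintegral _ iu))//.
rewrite -(Rintegral_cst mu measurableT c) le_Rintegral//.
- apply: (@bdd_integrable _ c) => [|x]; last by rewrite normr_id.
  exact: measurableT_comp.
- by apply: (@bdd_integrable _ `|c|) => //; exact: measurable_cst.
Qed.

Lemma bdd_mfun_integrable f : bdd_mfun f ->
  mu.-integrable setT (EFin \o (fun x => complex.Re (f x))) /\
  mu.-integrable setT (EFin \o (fun x => complex.Im (f x))).
Proof.
move=> [[f1 f2] [c fc]]; split; apply: (@bdd_integrable _ c) => // x.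
  exact: le_trans (ler_Re_rnorm _) (fc x).
exact: le_trans (ler_Im_rnorm _) (fc x).
Qed.

(** The factor 2 comes from bounding real and imaginary parts separately. It is harmless here: this
    estimate only serves to show that functionals and operators are bounded. *)
Lemma rnorm_cint_le f (c : R) : cmeasurable f ->
  (forall x, rnorm (f x) <= c) -> rnorm (cint f) <= 2 * mass * c.
Proof.
move=> [f1 f2] fc.
rewrite (le_trans (ler_rnorm_ReIm _))//= -mulrA mulr_natl mulr2n mulrC.
by rewrite lerD// bdd_Rintegral_le// => x; rewrite (le_trans _ (fc x))//
  (ler_Re_rnorm, ler_Im_rnorm).
Qed.

Lemma bdd_functional_cint : bdd_functional cint.
Proof.
split=> [[a a'] f g bf bg|].
  have [f1 f2] := bdd_mfun_integrable bf.
  have [g1 g2] := bdd_mfun_integrable bg.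
  have Zint (b : R) (u : T -> R) : mu.-integrable setT (EFin \o u) ->
      mu.-integrable setT (EFin \o (fun x => b * u x)).
    move=> iu; rewrite (_ : _ \o _ = (fun x => b%:E * (EFin \o u) x)%E)//.
    exact: integrableZl.
  have Dint (u v : T -> R) : mu.-integrable setT (EFin \o u) ->
      mu.-integrable setT (EFin \o v) ->
      mu.-integrable setT (EFin \o (fun x => u x + v x)).
    move=> iu iv; rewrite (_ : _ \o _ = (EFin \o u) \+ (EFin \o v))%E//.
    exact: integrableD.
  rewrite /cint.
  have -> : (fun x => complex.Re (((a +i* a') *: f + g) x)) =
      (fun x => (a * complex.Re (f x) + (- a') * complex.Im (f x)) + complex.Re (g x)).
    apply/funext => x; rewrite fct_linE.
    by case: (f x) (g x) => [u v] [u' v'] /=; rewrite mulNr.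
  have -> : (fun x => complex.Im (((a +i* a') *: f + g) x)) =
      (fun x => (a * complex.Im (f x) + a' * complex.Re (f x)) + complex.Im (g x)).
    by apply/funext => x; rewrite fct_linE; case: (f x) (g x) => [u v] [u' v'].
  have iD1 := Dint _ _ (Zint a _ f1) (Zint (- a') _ f2).
  have iD2 := Dint _ _ (Zint a _ f2) (Zint a' _ f1).
  rewrite !RintegralD ?RintegralZl//; do ?exact: Zint.
  by apply: eq_ReIm => /=; rewrite ?mulNr.
exists (2 * mass) => [|f c [mf _] fc c0]; first by rewrite mulr_ge0.
exact: rnorm_cint_le.
Qed.

Lemma cint_indic A : measurable A -> cint (cindic A) = (fine (mu A))%:C.
Proof.
move=> mA; rewrite /cint /cindic /=; congr Complex; last first.
  by rewrite Rintegral_cst// mul0r.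
by rewrite /Rintegral integral_indic// setIT.
Qed.

End ComplexIntegral.

Lemma ae_eq_cint (R : realType) d (T : measurableType d)
    (mu : {measure set T -> \bar R}) (f g : T -> R[i]) (N : set T) :
  cmeasurable f -> cmeasurable g ->
  measurable N -> mu N = 0%E -> ~` [set x | f x = g x] `<=` N ->
  cint mu f = cint mu g.
Proof.
move=> [f1 f2] [g1 g2] mN N0 fgN.
by congr Complex; congr fine; apply: ae_eq_integral => //;
  do ?[exact/measurable_EFinP]; exists N; split=> // x /= fgx; apply: fgN => /= fx;
  apply: fgx => _; rewrite fx.
Qed.

(** * Existence of operator integrals and the calculus of L^oo(M) *)

Section OperatorIntegral.
Context {R : realType} d (T : measurableType d) (H : hilbertType R).
Variable M : semispectral T H.
Implicit Types (f g : T -> R[i]) (A B : set T) (h k : H).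

Lemma sspm_diagE h A : measurable A ->
  sspm_diag M h A = (complex.Re (hdot (M A h) h))%:E.
Proof. by move=> mA; rewrite /sspm_diag asboolT. Qed.

Lemma sspm_hdot h A : measurable A ->
  hdot (M A h) h = (fine (sspm_diag M h A))%:C.
Proof.
by move=> mA; rewrite sspm_diagE//= ge0_ReE//; exact: sspm_ge0.
Qed.

Lemma sspm_diag_fin h : (sspm_diag M h setT < +oo)%E.
Proof. by rewrite sspm_diagE// ltry. Qed.

Local Notation q f h := (cint (sspm_diag M h) f).

(* Polarization of the quadratic form to be represented by the integral. *)
Definition sform f h k : R[i] :=
  4%:R^-1 * (q f (h + 1 *: k) - q f (h + (-1) *: k) +
    'i%C * (q f (h + 'i%C *: k) - q f (h + (- 'i%C) *: k))).

Lemma bdd_functional_sform h k : bdd_functional (fun f => sform f h k).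
Proof.
have bq l : bdd_functional (fun f => q f l).
  by apply: bdd_functional_cint; exact: sspm_diag_fin.
apply: bdd_functionalZ; apply: bdd_functionalD; first exact: bdd_functionalB.
by apply: bdd_functionalZ; exact: bdd_functionalB.
Qed.

(** On indicators polarization returns the form of the operator [M A]. Linearity in h and conjugate
    linearity in k are plain there and extend to all bounded functions by [bdd_functional_ext]. *)
Lemma sform_indic A h k : measurable A -> sform (cindic A) h k = hdot (M A h) k.
Proof.
move=> mA; rewrite /sform !cint_indic// -!sspm_hdot//.
have [lM _] := sspm_bounded M mA.
have n4 : (4%:R : R[i]) != 0 by rewrite pnatr_eq0.
apply: (mulfI n4); rewrite mulrA divff// mul1r.
rewrite (@polarization _ _ (fun h k => hdot (M A h) k)).
- by rewrite scale1r scaleN1r scaleNr.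
- by move=> z x y; rewrite (linear_D lM) hdotDl.
- by move=> z x y; rewrite hdotDr.
- by move=> a x y; rewrite (linear_Z lM) hdotZl.
- by move=> a x y; rewrite hdotZr.
Qed.

Lemma sform_lin f : bdd_mfun f -> forall k, scalar ((sform f)^~ k).
Proof.
move=> bf k a h h'; move: f bf; apply: bdd_functional_ext.
- exact: bdd_functional_sform.
- by apply: bdd_functional_lin; exact: bdd_functional_sform.
move=> A mA; have [lM _] := sspm_bounded M mA.
by rewrite !sform_indic// (linear_D lM) (linear_Z lM) hdotDl hdotZl.
Qed.

Lemma sform_sesqui f : bdd_mfun f -> forall h a k k',
  sform f h (a *: k + k') = conjc a * sform f h k + sform f h k'.
Proof.
move=> bf h a k k'; move: f bf; apply: bdd_functional_ext.
- exact: bdd_functional_sform.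
- by apply: bdd_functional_lin; exact: bdd_functional_sform.
by move=> A mA; rewrite !sform_indic// hdotDr hdotZr.
Qed.

Lemma sform_diag f : bdd_mfun f -> forall h, sform f h h = q f h.
Proof.
move=> bf h; move: f bf; apply: bdd_functional_ext.
- exact: bdd_functional_sform.
- by apply: bdd_functional_cint; exact: sspm_diag_fin.
by move=> A mA; rewrite sform_indic// cint_indic// sspm_hdot.
Qed.

(** The bound is proved on unit balls and extended by homogeneity. There the four polarization terms
    are taken at vectors of norm at most 2; each is at most 2 (4 m) c, and their sum is divided by
    4. *)
Lemma sform_bound f : bdd_mfun f -> exists2 c : R, 0 <= c &
  forall h k, rnorm (sform f h k) <= c * rnorm h * rnorm k.
Proof.
move=> bf; have [mf [c fc]] := bf.
have c0 : 0 <= c by rewrite (le_trans _ (fc point))// rnorm_ge0.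
have [lM [m [m0 mP]]] := (bounded_opP _).1 (sspm_bounded M measurableT).
have qle h : rnorm h <= 2 -> rnorm (q f h) <= 2 * (4 * m) * c.
  move=> h2; rewrite (le_trans (rnorm_cint_le (sspm_diag_fin h) mf fc))//.
  rewrite ler_wpM2r// ler_wpM2l// -[leLHS]/(fine (sspm_diag M h setT)).
  rewrite sspm_diagE//=.
  rewrite (le_trans (ler_norm _))// (le_trans (ler_Re_rnorm _))//.
  rewrite (le_trans (cauchy_schwarz _ _))//.
  have := mP h; have := rnorm_ge0 h; have := rnorm_ge0 (M setT h); nra.
have unit h k : rnorm h <= 1 -> rnorm k <= 1 ->
    rnorm (sform f h k) <= 8 * m * c.
  move=> h1 k1.
  have two a : rnorm a = 1 -> rnorm (q f (h + a *: k)) <= 2 * (4 * m) * c.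
    move=> a1; apply: qle; rewrite (le_trans (ler_rnormD _ _))// rnormZ a1 mul1r.
    lra.
  have ri : rnorm ('i%C : R[i]) = 1.
    by rewrite /rnorm normc_def/= expr0n expr1n add0r sqrtr1.
  have r1 : rnorm (1 : R[i]) = 1 := rnorm1.
  have q1 := two _ r1; have q2 := two (-1) (etrans (rnormN _) r1).
  have q3 := two _ ri; have q4 := two (- 'i%C) (etrans (rnormN _) ri).
  rewrite /sform rnormM.
  have -> : rnorm (4%:R^-1 : R[i]) = 4^-1.
    rewrite (_ : 4%:R^-1 = (4^-1)%:C) ?rnormR ?ger0_norm ?invr_ge0//.
    by rewrite fmorphV rmorph_nat.
  rewrite ler_pdivrMl// (le_trans (ler_rnormD _ _))// rnormM ri mul1r.
  set K := 2 * (4 * m) * c in q1 q2 q3 q4.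
  have -> : 4 * (8 * m * c) = (K + K) + (K + K) by rewrite /K; ring.
  by rewrite lerD// (le_trans (ler_rnormB _ _))// lerD.
exists (8 * m * c) => [|h k]; first by rewrite !mulr_ge0.
have z1 (a : R[i]) (k' : H) : sform f 0 k' = 0.
  by have := sform_lin bf k' (-1) 0 0; rewrite scaler0 addr0 mulN1r addNr.
have z2 h' : sform f h' 0 = 0.
  have := sform_sesqui bf h' (-1) 0 0.
  by rewrite scaler0 addr0 rmorphN1 mulN1r addNr.
have [->|h0] := eqVneq h 0; first by rewrite z1// !rnorm0 mulr0 mul0r.
have [->|k0] := eqVneq k 0; first by rewrite z2 !rnorm0 mulr0.
have pos (x : H) : x != 0 -> 0 < rnorm x.
  by move=> x0; rewrite lt_def rnorm_ge0 andbT; apply: contra_neq x0;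
    exact: rnorm_eq0.
have hp := pos _ h0; have kp := pos _ k0.
have := unit ((rnorm h)^-1%:C *: h) ((rnorm k)^-1%:C *: k).
have Zl a x y : sform f (a *: x) y = a * sform f x y.
  by have := sform_lin bf y a x 0; rewrite z1// !addr0.
have Zr a x y : sform f x (a *: y) = conjc a * sform f x y.
  by have := sform_sesqui bf x a y 0; rewrite z2 !addr0.
rewrite Zl Zr !rnormZ !rnormM rnormJ !rnormR !gtr0_norm ?invr_gt0//.
rewrite !mulVf ?gt_eqF// => /(_ (lexx _) (lexx _)).
rewrite ler_pdivrMl// ler_pdivrMl// => h1.
by rewrite (le_trans h1)// [leRHS]mulrC [8 * m * c * _]mulrC.
Qed.

Lemma is_opint_uniq f (A B : H -> H) : is_opint M f A -> is_opint M f B -> A = B.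
Proof.
move=> [[lA _] hA] [[lB _] hB]; apply: form_ext => // h; by rewrite hA hB.
Qed.

Lemma is_opint_opint f (A : H -> H) : is_opint M f A -> opint M f = A.
Proof.
move=> hA; apply: (is_opint_uniq _ hA).
by rewrite /opint; apply: (xgetPex (fun=> 0)); exists A.
Qed.

(** Existence of the integral: the bounded sesquilinear form [sform f] is represented by an
    operator, and its diagonal is the scalar integral. *)
Lemma bdd_opintP f : bdd_mfun f ->
  is_opint M f (opint M f) /\ forall h k, hdot (opint M f h) k = sform f h k.
Proof.
move=> bf; have [c c0 cP] := sform_bound bf.
have [A [lA Ac] AP] := sesquilinear_op c0 (sform_lin bf) (sform_sesqui bf) cP.
have hA : is_opint M f A.
  split; first by apply/bounded_opP; split=> //; exists c.
  by move=> h; rewrite -AP sform_diag.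
by rewrite (is_opint_opint hA); split=> // h k; rewrite AP.
Qed.

Lemma bounded_opint f : bdd_mfun f -> bounded_op (opint M f).
Proof. by move=> bf; have [[]] := bdd_opintP bf. Qed.

Lemma hdot_opint f : bdd_mfun f -> forall h,
  hdot (opint M f h) h = cint (sspm_diag M h) f.
Proof. by move=> bf; have [[]] := bdd_opintP bf. Qed.

Lemma bdd_functional_opint h k :
  bdd_functional (fun f => hdot (opint M f h) k).
Proof.
have [l [C C0 CP]] := bdd_functional_sform h k.
split=> [a f g bf bg|].
  by rewrite !(bdd_opintP _).2//; [exact: l|exact: bdd_mfun_lin].
by exists C => // f c bf fc c0; rewrite (bdd_opintP bf).2 CP.
Qed.

Lemma opint_indic A : measurable A -> opint M (cindic A) = M A.
Proof.
move=> mA; apply: is_opint_opint; split; first exact: sspm_bounded.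
move=> h; have := cint_indic (sspm_diag M h) mA; rewrite /cint => ->.
exact: sspm_hdot.
Qed.

Lemma opint_lin a f g : bdd_mfun f -> bdd_mfun g ->
  opint M (a *: f + g) = a *: opint M f + opint M g.
Proof.
move=> bf bg; apply/funext => h; apply: hdot_ext => k.
rewrite -[(_ + _) h]/(a *: opint M f h + opint M g h) hdotDl hdotZl.
by have [-> //] := bdd_functional_opint h k.
Qed.

Lemma sspm_nullP A : measurable A ->
  M A = 0 <-> forall h, sspm_diag M h A = 0%E.
Proof.
move=> mA; split=> [A0 h|A0]; first by rewrite sspm_diagE// A0 hdot0l.
have [lM _] := sspm_bounded M mA.
apply: form_ext => // [a x y|h]; first by rewrite scaler0 addr0.
by rewrite sspm_hdot// A0 hdot0l.
Qed.

Lemma sspm_null_sub A B : measurable A -> measurable B -> A `<=` B ->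
  M B = 0 -> M A = 0.
Proof.
move=> mA mB AB /(sspm_nullP mB) B0; apply/(sspm_nullP mA) => h.
by apply: (subset_measure0 mA mB AB); exact: B0.
Qed.

Lemma sspm_null_bigcup (F : nat -> set T) : (forall n, measurable (F n)) ->
  (forall n, M (F n) = 0) -> M (\bigcup_n F n) = 0.
Proof.
move=> mF F0; have mU : measurable (\bigcup_n F n) by exact: bigcup_measurable.
apply/(sspm_nullP mU) => h; apply/negligibleP => //.
apply: negligible_bigcup => n; apply/negligibleP => //.
exact: (sspm_nullP (mF n)).1 (F0 n) h.
Qed.

Lemma measurable_rnorm_gt f (a : R) : cmeasurable f ->
  measurable [set x | a < rnorm (f x)].
Proof.
move=> [f1 f2]; have [a0|a0] := ltP a 0.
  rewrite (_ : [set _ | _] = setT); first exact: measurableT.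
  by apply/seteqP; split=> // x _ /=; rewrite (lt_le_trans a0)// rnorm_ge0.
rewrite (_ : [set _ | _] =
  ~` (setT `&` [set x | complex.Re (f x) * complex.Re (f x) +
                   complex.Im (f x) * complex.Im (f x) <= a ^+ 2])); last first.
  apply/seteqP; split=> x /=; rewrite -(@ltr_pXn2r _ 2)// ?nnegrE ?rnorm_ge0//
   rnorm_sqr -!expr2 ltNge; first by move=> /negP h [_ /h].
  by move=> h; apply/negP => h'; apply: h.
apply: measurableC; apply: measurable_fun_le => //.
by apply: measurable_funD; exact: measurable_funM.
Qed.

Lemma sspm_ae_sub (P Q : set T) : P `<=` Q -> sspm_ae M P -> sspm_ae M Q.
Proof.
by move=> PQ [N [mN N0 PN]]; exists N; split=> // x Qx; apply: PN => /PQ.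
Qed.

Lemma opint_ae f g : cmeasurable f -> cmeasurable g ->
  sspm_ae M [set x | f x = g x] -> opint M f = opint M g.
Proof.
move=> mf mg [N [mN N0 fgN]]; rewrite /opint; congr xget.
apply/funext => A; apply/propext; rewrite /is_opint.
have E h : cint (sspm_diag M h) f = cint (sspm_diag M h) g.
  exact: (ae_eq_cint mf mg mN ((sspm_nullP mN).1 N0 h) fgN).
by split=> -[bA hA]; split=> // h; rewrite hA; [exact: E|exact/esym/E].
Qed.

(** An everywhere bounded representative of an essentially bounded f. *)
Definition ctrunc f (a : R) : T -> R[i] :=
  fun x => f x * cindic (~` [set x | a < rnorm (f x)]) x.

Lemma rnorm_ctrunc f a x : 0 <= a -> rnorm (ctrunc f a x) <= a.
Proof.
move=> a0; rewrite /ctrunc rnormM /cindic rnormR indicE in_setC.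
have [_|] := boolP (x \in _); first by rewrite normr0 mulr0.
by rewrite notin_setE /= => /negP; rewrite -leNgt normr1 mulr1.
Qed.

Lemma bdd_ctrunc f a : cmeasurable f -> 0 <= a -> bdd_mfun (ctrunc f a).
Proof.
move=> mf a0; split; last by exists a => x; exact: rnorm_ctrunc.
apply: cmeasurableM => //; apply: (bdd_cindic _).1.
by apply: measurableC; exact: measurable_rnorm_gt.
Qed.

Lemma ctrunc_ae f a : cmeasurable f -> M [set x | a < rnorm (f x)] = 0 ->
  sspm_ae M [set x | f x = ctrunc f a x].
Proof.
move=> mf fa; exists [set x | a < rnorm (f x)]; split=> //.
  exact: measurable_rnorm_gt.
move=> x /=; apply: contra_notP => fax; rewrite /ctrunc /cindic indicE.
by rewrite mem_set// mulr1.
Qed.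

Lemma Linf_opint f : Linf M f ->
  exists2 g, bdd_mfun g & sspm_ae M [set x | f x = g x] /\ opint M f = opint M g.
Proof.
move=> [mf [a a0 fa]]; exists (ctrunc f a); first exact: bdd_ctrunc.
have h := ctrunc_ae mf fa; split=> //; apply: opint_ae => //.
by have [] := bdd_ctrunc mf a0.
Qed.

Lemma Linf_norm_ge0 f : Linf M f -> 0 <= Linf_norm M f.
Proof. by move=> [_ [a a0 fa]]; apply: lb_le_inf; [exists a|move=> b []]. Qed.

(** The infimum defining the essential norm is attained: its exceptional set is the countable union
    of the null sets obtained at distance 1 / (n + 1) above it. *)
Lemma Linf_norm_null f : Linf M f ->
  M [set x | Linf_norm M f < rnorm (f x)] = 0.
Proof.
move=> [mf [a a0 fa]].
rewrite (_ : [set _ | _] =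
  \bigcup_n [set x | Linf_norm M f + n.+1%:R^-1 < rnorm (f x)]); last first.
  apply/seteqP; split=> [x /= fx|x [n _ /=]]; last first.
    by apply: le_lt_trans; rewrite lerDl invr_ge0.
  have fx' : 0 < rnorm (f x) - Linf_norm M f by rewrite subr_gt0.
  have [n _ /(_ n (leqnn n)) nP] := near_infty_natSinv_lt (PosNum fx').
  by exists n => //=; rewrite -ltrBrDl.
apply: sspm_null_bigcup => n; first exact: measurable_rnorm_gt.
have n0 : (0 : R) < n.+1%:R^-1 by rewrite invr_gt0.
have hi : has_inf [set b : R | 0 <= b /\ M [set x | b < rnorm (f x)] = 0].
  by split; [exists a|exists 0 => b []].
have [b [b0 fb] bn] := inf_adherent n0 hi.
apply: sspm_null_sub fb; do ?exact: measurable_rnorm_gt.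
by move=> x /=; apply: lt_trans.
Qed.

Lemma Linf_norm_le f (a : R) : 0 <= a -> M [set x | a < rnorm (f x)] = 0 ->
  Linf_norm M f <= a.
Proof. by move=> a0 fa; apply: ge_inf; [exists 0 => b []|]. Qed.

Lemma bdd_Linf f : bdd_mfun f -> Linf M f.
Proof.
move=> [mf [c fc]]; split=> //; exists `|c| => //.
rewrite (_ : [set _ | _] = set0); last first.
  apply/seteqP; split=> // x /=; apply/negP; rewrite -leNgt.
  by rewrite (le_trans (fc x))// ler_norm.
by apply/(sspm_nullP measurable0) => h; exact: measure0.
Qed.

Lemma Linf_lin a f g : Linf M f -> Linf M g -> Linf M (a *: f + g).
Proof.
move=> [mf [c c0 fc]] [mg [c' c'0 gc]]; split; first exact: cmeasurable_lin.
exists (rnorm a * c + c'); first by rewrite addr_ge0// mulr_ge0// rnorm_ge0.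
have mfg : measurable ([set x | c < rnorm (f x)] `|` [set x | c' < rnorm (g x)]).
  by apply: measurableU; exact: measurable_rnorm_gt.
apply: sspm_null_sub (mfg) _ _; first exact: measurable_rnorm_gt (cmeasurable_lin a mf mg).
  move=> x /=; apply: contraPP => /not_orP[/negP h1 /negP h2].
  rewrite -leNgt in h1; rewrite -leNgt in h2; apply/negP; rewrite -leNgt.
  rewrite fct_linE (le_trans (ler_rnormD _ _))// rnormM lerD//.
  by rewrite ler_wpM2l ?rnorm_ge0.
rewrite -bigcup2E; apply: sspm_null_bigcup => -[|[|n]]//=;
  do ?exact: measurable_rnorm_gt.
by apply/(sspm_nullP measurable0) => h; exact: measure0.
Qed.

Lemma sspm_aeI (P Q : set T) : sspm_ae M P -> sspm_ae M Q -> sspm_ae M (P `&` Q).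
Proof.
move=> [N [mN N0 PN]] [N' [mN' N'0 QN]]; exists (N `|` N'); split.
- exact: measurableU.
- rewrite -bigcup2E; apply: sspm_null_bigcup => -[|[|n]]//=.
  by apply/(sspm_nullP measurable0) => h; exact: measure0.
- by rewrite setCI; apply: setUSS.
Qed.

Lemma bounded_Linf_opint f : Linf M f -> bounded_op (opint M f).
Proof. by move=> /Linf_opint[g bg [_ ->]]; exact: bounded_opint. Qed.

Lemma opint_Linf_lin a f g : Linf M f -> Linf M g ->
  opint M (a *: f + g) = a *: opint M f + opint M g.
Proof.
move=> Lf Lg; have [f' bf [fE ->]] := Linf_opint Lf.
have [g' bg [gE ->]] := Linf_opint Lg.
rewrite -opint_lin//; apply: opint_ae.
- by have [] := Linf_lin a Lf Lg.
- by have [] := bdd_mfun_lin a bf bg.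
apply: sspm_ae_sub (sspm_aeI fE gE) => x [/= fx gx].
by rewrite !fct_linE fx gx.
Qed.

Lemma opint_ge0 f : Linf M f -> sspm_ae M [set x | 0 <= f x] ->
  nonneg_op (opint M f).
Proof.
move=> Lf f0 h; have [g bg [fE ->]] := Linf_opint Lf.
have [N [mN N0 gN]] : sspm_ae M [set x | 0 <= g x].
  by apply: sspm_ae_sub (sspm_aeI fE f0) => x [/= ->].
rewrite hdot_opint//.
(* [g'] is nonnegative everywhere and equals g off a null set, so each scalar integral is visibly
   nonnegative. *)
pose g' x := (`|complex.Re (g x)|)%:C.
have mg' : cmeasurable g'.
  by apply: cmeasurableR; apply: measurableT_comp => //; exact: bg.1.1.
rewrite (@ae_eq_cint _ _ _ _ g g' N)//; [|exact: bg.1|exact: (sspm_nullP mN).1|].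
  rewrite /cint /= Rintegral_cst// mul0r lecE/= eqxx/=.
  by apply: Rintegral_ge0.
apply: subset_trans gN => x /=; apply: contra_not => g0.
by rewrite /g' ger0_norm ?ge0_ReE//; move: g0; rewrite lecE => /andP[].
Qed.

End OperatorIntegral.

(** * Spectral measures *)

Section SpectralCalculus.
Context {R : realType} d (T : measurableType d) (K : hilbertType R).
Variable E : semispectral T K.
Implicit Types (f g : T -> R[i]) (A B : set T) (h k : K).

(** A nonnegative form has a real diagonal, so the operator and its adjoint have the same diagonal
    and coincide. *)
Lemma nonneg_sym (H : hilbertType R) (A : H -> H) : bounded_op A ->
  nonneg_op A -> forall h k : H, hdot (A h) k = hdot h (A k).
Proof.
move=> bA A0 h k; suff AE : adj A = A by rewrite hdot_adj// AE.
apply: form_ext; [by have [] := bounded_adj bA|by have [] := bA|move=> x].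
rewrite hdot_adjC// hdotC; have := A0 x; move/ger0_Im.
by case: (hdot _ _) => u v /= ->; rewrite oppr0.
Qed.

Lemma bdd_functionalMl (Phi : (T -> R[i]) -> R[i]) f : bdd_mfun f ->
  bdd_functional Phi -> bdd_functional (fun g => Phi (fun x => f x * g x)).
Proof.
move=> bf [l [C C0 CP]]; split=> [a g g' bg bg'|].
  rewrite -l; [|exact: bdd_mfunM|exact: bdd_mfunM].
  by congr Phi; apply/funext => x; rewrite !fct_linE; ring.
have [_ [c fc]] := bf; have c0 : 0 <= c := le_trans (rnorm_ge0 _) (fc point).
exists (C * c) => [|g e bg ge e0]; first exact: mulr_ge0.
rewrite -mulrA; apply: CP; [exact: bdd_mfunM| |exact: mulr_ge0].
by move=> x; rewrite rnormM ler_pM ?rnorm_ge0.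
Qed.

Lemma opint_conj f : bdd_mfun f -> forall h k,
  hdot (opint E f h) k = hdot h (opint E (fun x => conjc (f x)) k).
Proof.
move=> bf h k; rewrite [RHS]hdotC; move: f bf; apply: bdd_functional_ext.
- exact: bdd_functional_opint.
- have [l [C C0 CP]] := bdd_functional_opint E k h.
  split=> [a f g bf bg|].
    rewrite (_ : (fun x => conjc _) =
      conjc a *: (fun x => conjc (f x)) + (fun x => conjc (g x))).
      rewrite l; [|exact: bdd_mfunJ|exact: bdd_mfunJ].
      by rewrite raddfD/= (rmorphM (@conjc R))/= conjcK.
    by apply/funext => x; rewrite !fct_linE raddfD/= (rmorphM (@conjc R)).
  exists C => // f c bf fc c0; rewrite rnormJ; apply: CP => //.
    exact: bdd_mfunJ.
  by move=> x; rewrite rnormJ.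
move=> A mA; rewrite opint_indic// (_ : (fun x => conjc _) = cindic A).
  rewrite opint_indic// -hdotC; apply: nonneg_sym; first exact: sspm_bounded.
  exact: sspm_ge0.
by apply/funext => x; rewrite /cindic conjc_real.
Qed.

Hypothesis Emul : forall A B, measurable A -> measurable B ->
  E (A `&` B) = E A \o E B.
Hypothesis ET : E setT = id.

Lemma cindicM A B : (fun x => cindic A x * cindic B x) = cindic (A `&` B) :> (T -> R[i]).
Proof. by apply/funext => x; rewrite /cindic indicI/= rmorphM. Qed.

(** Multiplicativity on indicators is extended one factor at a time: [step] frees g with f still an
    indicator, then f is freed. Symmetry of [E A] moves it to the other side of the inner product,
    leaving a functional of g alone. *)
Lemma opintM f g : bdd_mfun f -> bdd_mfun g ->
  opint E (fun x => f x * g x) = opint E f \o opint E g.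
Proof.
move=> bf bg; apply/funext => h; apply: hdot_ext => k /=.
have step A : measurable A -> forall g, bdd_mfun g -> forall k,
    hdot (opint E (fun x => cindic A x * g x) h) k = hdot (E A (opint E g h)) k.
  move=> mA g' bg' k'.
  rewrite (nonneg_sym (sspm_bounded E mA) (sspm_ge0 E mA)).
  move: g' bg'; apply: bdd_functional_ext.
  - apply: (@bdd_functionalMl (fun f => hdot (opint E f h) k')).
      exact: bdd_cindic.
    exact: bdd_functional_opint.
  - exact: bdd_functional_opint.
  move=> B mB; rewrite cindicM !opint_indic//; last exact: measurableI.
  rewrite Emul//= (nonneg_sym (sspm_bounded E mA) (sspm_ge0 E mA))//.
move: f bf; apply: bdd_functional_ext.
- have -> : (fun f => hdot (opint E (fun x => f x * g x) h) k) =
            (fun f => hdot (opint E (fun x => g x * f x) h) k).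
    by apply/funext => f; congr (hdot (opint E _ h) k); apply/funext => x;
      rewrite mulrC.
  by apply: (@bdd_functionalMl (fun f => hdot (opint E f h) k));
    last exact: bdd_functional_opint.
- exact: bdd_functional_opint.
by move=> A mA; rewrite step// opint_indic.
Qed.

(** Source of the sharp norm bound, and of norm convergence of operator integrals by dominated
    convergence. *)
Lemma opint_sqr f h : bdd_mfun f ->
  hdot (opint E f h) (opint E f h) =
  cint (sspm_diag E h) (fun x => conjc (f x) * f x).
Proof.
move=> bf; have bJ := bdd_mfunJ bf.
rewrite -hdot_opint; last exact: bdd_mfunM.
rewrite opintM//= (opint_conj bJ).
by congr (hdot _ (opint E _ h)); apply/funext => x; rewrite conjcK.
Qed.

Lemma rnorm_opint_le f c h : bdd_mfun f -> (forall x, rnorm (f x) <= c) ->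
  rnorm (opint E f h) <= c * rnorm h.
Proof.
move=> bf fc; have c0 : 0 <= c := le_trans (rnorm_ge0 _) (fc point).
rewrite -(@ler_pXn2r _ 2)// ?nnegrE ?mulr_ge0 ?rnorm_ge0// -Re_hdot_rnorm.
rewrite opint_sqr// /cint/= exprMn -Re_hdot_rnorm.
have -> : hdot h h = hdot (E setT h) h by rewrite ET.
rewrite sspm_hdot//= (_ : (fun x => complex.Re _) = (fun x => rnorm (f x) ^+ 2)).
  rewrite (le_trans (ler_norm _))//; apply: bdd_Rintegral_le.
  - exact: sspm_diag_fin.
  - have [[f1 f2] _] := bf; under eq_fun do rewrite rnorm_sqr !expr2.
    by apply: measurable_funD; exact: measurable_funM.
  - by move=> x; rewrite ger0_norm ?sqr_ge0// ler_pXn2r// nnegrE rnorm_ge0.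
by apply/funext => x; rewrite mulrC mulcJ.
Qed.

Lemma rnorm_opint_Linf f h : Linf E f ->
  rnorm (opint E f h) <= Linf_norm E f * rnorm h.
Proof.
move=> Lf; have n0 := Linf_norm_ge0 Lf; have [mf _] := Lf.
have bt := bdd_ctrunc mf n0.
rewrite (@opint_ae _ _ _ _ _ f (ctrunc f (Linf_norm E f)))//; last 2 first.
- exact: bt.1.
- exact: ctrunc_ae (Linf_norm_null Lf).
by apply: rnorm_opint_le => // x; exact: rnorm_ctrunc.
Qed.

Lemma iter_opint f n : bdd_mfun f ->
  bdd_mfun (fun x => f x ^+ n) /\ iter n (opint E f) = opint E (fun x => f x ^+ n).
Proof.
move=> bf; elim: n => [|n [IH1 IH2]].
  have -> : (fun x => f x ^+ 0) = cindic setT.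
    by apply/funext => x; rewrite expr0 /cindic indicT.
  by split; [exact: bdd_cindic|rewrite opint_indic//= ET].
have -> : (fun x => f x ^+ n.+1) = (fun x => f x * (f x ^+ n)).
  by apply/funext => x; rewrite exprS.
split; first exact: bdd_mfunM.
by rewrite opintM// -IH2.
Qed.

Lemma opint_horner f (p : {poly R[i]}) : bdd_mfun f ->
  bdd_mfun (fun x => p.[f x]) /\
  opint E (fun x => p.[f x]) = \sum_(i < size p) p`_i *: iter i (opint E f).
Proof.
move=> bf.
have -> : (fun x => p.[f x]) = \sum_(i < size p) p`_i *: (fun x => f x ^+ i).
  by apply/funext => x; rewrite horner_coef fct_sumE.
elim/big_rec2: _ => [|i A g _ [bg <-]].
  split; first exact: bdd_mfun0.
  apply: is_opint_opint; split; first exact: bounded_op0.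
  move=> h; rewrite hdot0l; have := Rintegral_cst (sspm_diag E h) measurableT 0.
  by rewrite mul0r => ->.
have [bi ->] := iter_opint i bf.
by split; [exact: bdd_mfun_lin|rewrite opint_lin].
Qed.

End SpectralCalculus.

(** * Completion of a semi-inner product *)

(* No algebraic law is required of the carrier: the completion only sees a
   vector [u] through the function [pre_dot u], so that sequences can serve as
   formal linear combinations. *)
Record preHilbert (R : realType) := PreHilbert {
  pre_sort :> Type ;
  pre0 : pre_sort ;
  pre_add : pre_sort -> pre_sort -> pre_sort ;
  pre_scale : R[i] -> pre_sort -> pre_sort ;
  pre_dot : pre_sort -> pre_sort -> R[i] ;
  pre_dot0 : forall w, pre_dot pre0 w = 0 ;
  pre_dotD : forall u v w, pre_dot (pre_add u v) w = pre_dot u w + pre_dot v w ;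
  pre_dotZ : forall a u w, pre_dot (pre_scale a u) w = a * pre_dot u w ;
  pre_dotC : forall u v, pre_dot u v = conjc (pre_dot v u) ;
  pre_dot_ge0 : forall u, 0 <= pre_dot u u }.

Section Completion.
Context {R : realType} (U : preHilbert R).
Implicit Types (u v w : U).

Definition pre_norm u : R := Num.sqrt (complex.Re (pre_dot u u)).

Lemma pre_norm_ge0 u : 0 <= pre_norm u.
Proof. exact: sqrtr_ge0. Qed.

Lemma pre_norm_sqr u : (pre_norm u ^+ 2)%:C = pre_dot u u.
Proof.
have := pre_dot_ge0 u => u0; rewrite sqr_sqrtr ?ge0_ReE//.
by move: u0; rewrite lecE => /andP[].
Qed.

Lemma pre_cauchy_schwarz u v : rnorm (pre_dot u v) <= pre_norm u * pre_norm v.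
Proof.
rewrite -(@ler_pXn2r _ 2)// ?nnegrE ?mulr_ge0 ?rnorm_ge0 ?sqrtr_ge0// exprMn.
apply: discr_rnorm => [||a]; rewrite ?sqr_ge0//.
have := pre_dot_ge0 (pre_add u (pre_scale a v)).
rewrite !(pre_dotD, pre_dotZ) ![pre_dot _ (pre_add _ _)]pre_dotC.
rewrite !(pre_dotD, pre_dotZ) -!pre_norm_sqr (pre_dotC v u).
rewrite lecE => /andP[_]; case: (pre_dot u v) => b b'.
rewrite (rnorm_sqr a); case: a => a a' /=; lra.
Qed.

(* The completion consists of the functions that are limits of functions
   [pre_dot u], in the norm dual to [pre_norm]. *)
Definition pre_approx : {pred U -> R[i]} := fun F =>
  `[< forall e : R, 0 < e ->
      exists u, forall w, rnorm (F w - pre_dot u w) <= e * pre_norm w >].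

Lemma pre_approx_submod : submod_closed pre_approx.
Proof.
split=> [|a F G /asboolP FU /asboolP GU]; apply/asboolP => e e0.
  exists (pre0 U) => w; rewrite pre_dot0 subrr rnorm0.
  by rewrite mulr_ge0 ?pre_norm_ge0// ltW.
have a0 : 0 < rnorm a + 1 by rewrite ltr_wpDl// rnorm_ge0.
have e1 : 0 < e / (2 * (rnorm a + 1)) by rewrite divr_gt0 ?mulr_gt0.
have e2 : 0 < e / 2 by rewrite divr_gt0.
have [u uP] := FU _ e1; have [v vP] := GU _ e2.
exists (pre_add (pre_scale a u) v) => w.
rewrite pre_dotD pre_dotZ.
have -> : (a *: F + G) w - (a * pre_dot u w + pre_dot v w) =
  a * (F w - pre_dot u w) + (G w - pre_dot v w).
  by rewrite mulrBr opprD [RHS]addrACA.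
rewrite (le_trans (ler_rnormD _ _))// rnormM.
have h1 := vP w; have h2 := uP w; have h3 := pre_norm_ge0 w.
have h4 : rnorm a * rnorm (F w - pre_dot u w) <= e / 2 * pre_norm w.
  rewrite (le_trans (ler_wpM2l (rnorm_ge0 _) h2))// mulrA ler_wpM2r//.
  by rewrite mulrA ler_pdivrMr ?mulr_gt0//; lra.
lra.
Qed.

HB.instance Definition _ := GRing.isSubmodClosed.Build R[i] (U -> R[i])
  pre_approx pre_approx_submod.

Record hcompletion := HCompletion {
  hcompl_fun :> U -> R[i] ;
  hcompl_funP : hcompl_fun \in pre_approx }.

HB.instance Definition _ := [isSub for hcompl_fun].
HB.instance Definition _ := [Choice of hcompletion by <:].
HB.instance Definition _ := [SubChoice_isSubLmodule of hcompletion by <:].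

Implicit Types (F G : hcompletion).

Lemma hcompl_ext F G : (forall w, F w = G w) -> F = G.
Proof. by move=> FG; apply: val_inj; apply/funext. Qed.

Lemma hcomplD F G w : (F + G) w = F w + G w. Proof. by []. Qed.

Lemma hcomplZ a F w : (a *: F) w = a * F w. Proof. by []. Qed.

Lemma hcomplB F G w : (F - G) w = F w - G w. Proof. by []. Qed.

Lemma hcompl_approx F (e : R) : 0 < e ->
  exists u, forall w, rnorm (F w - pre_dot u w) <= e * pre_norm w.
Proof. by move: (hcompl_funP F) => /asboolP; exact. Qed.

Definition hcompl_bounds F :=
  [set e : R | 0 <= e /\ forall w, rnorm (F w) <= e * pre_norm w].

Definition hcompl_norm F : R := inf (hcompl_bounds F).

Lemma has_inf_hcompl_bounds F : has_inf (hcompl_bounds F).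
Proof.
split; last by exists 0 => e [].
have [u uP] := hcompl_approx F ltr01.
exists (1 + pre_norm u); split=> [|w]; first by rewrite addr_ge0// pre_norm_ge0.
rewrite -(subrK (pre_dot u w) (F w)) (le_trans (ler_rnormD _ _))// mulrDl.
by rewrite lerD// pre_cauchy_schwarz.
Qed.

Lemma hcompl_norm_ge0 F : 0 <= hcompl_norm F.
Proof.
by apply: lb_le_inf; [case: (has_inf_hcompl_bounds F)|move=> e []].
Qed.

Lemma hcompl_normP F w : rnorm (F w) <= hcompl_norm F * pre_norm w.
Proof.
have [w0|w0] := eqVneq (pre_norm w) 0.
  have [[e [_ eP]] _] := has_inf_hcompl_bounds F.
  by have := eP w; rewrite w0 !mulr0.
have wp : 0 < pre_norm w by rewrite lt_def w0 pre_norm_ge0.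
rewrite -ler_pdivrMr//; apply: lb_le_inf.
  by case: (has_inf_hcompl_bounds F).
by move=> e [e0 eP]; rewrite ler_pdivrMr.
Qed.

Lemma hcompl_norm_le F (e : R) : 0 <= e ->
  (forall w, rnorm (F w) <= e * pre_norm w) -> hcompl_norm F <= e.
Proof.
by move=> e0 eP; apply: ge_inf; [case: (has_inf_hcompl_bounds F)|split].
Qed.

Lemma hcompl_normD F G :
  (hcompl_norm (F + G))%:C <= (hcompl_norm F)%:C + (hcompl_norm G)%:C.
Proof.
rewrite -rmorphD/= lecR; apply: hcompl_norm_le => [|w].
  by rewrite addr_ge0// hcompl_norm_ge0.
rewrite hcomplD (le_trans (ler_rnormD _ _))// mulrDl.
by rewrite lerD// hcompl_normP.
Qed.

Lemma hcompl_normZ (a : R[i]) F :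
  (hcompl_norm (a *: F))%:C = `|a| * (hcompl_norm F)%:C.
Proof.
rewrite -rnormE -rmorphM/=; congr _%:C.
have le b G : hcompl_norm (b *: G) <= rnorm b * hcompl_norm G.
  apply: hcompl_norm_le => [|w].
    by rewrite mulr_ge0// ?rnorm_ge0 ?hcompl_norm_ge0.
  by rewrite hcomplZ rnormM -mulrA ler_wpM2l ?rnorm_ge0// hcompl_normP.
apply/eqP; rewrite eq_le le/=.
have [->|a0] := eqVneq a 0; first by rewrite rnorm0 mul0r hcompl_norm_ge0.
have ap : 0 < rnorm a.
  by rewrite lt_def rnorm_ge0 andbT; apply: contra_neq a0; exact: rnorm_eq0.
have := le a^-1 (a *: F); rewrite scalerA mulVf// scale1r.
have aV : rnorm a^-1 = (rnorm a)^-1.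
  apply: (mulIf (x := rnorm a)); first by rewrite gt_eqF.
  by rewrite -rnormM mulVf// rnorm1 mulVf// gt_eqF.
by rewrite aV ler_pdivlMl.
Qed.

Lemma hcompl_norm0_eq0 F : (hcompl_norm F)%:C = 0 -> F = 0.
Proof.
move=> /complexI F0; apply: hcompl_ext => w; apply: rnorm_eq0.
by apply/eqP; rewrite eq_le rnorm_ge0 andbT (le_trans (hcompl_normP _ _))// F0 mul0r.
Qed.

HB.instance Definition _ := @Lmodule_isNormed.Build R[i] hcompletion
  (fun F => (hcompl_norm F)%:C) hcompl_normD hcompl_normZ hcompl_norm0_eq0.

Lemma rnorm_hcompl F : rnorm F = hcompl_norm F.
Proof. by []. Qed.

(** Limits are taken pointwise in w, on real and imaginary parts, where completeness of the reals
    applies. The Cauchy estimate is uniform relative to [pre_norm w], so the limit is again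
    approximable. *)
Lemma hcompl_complete (FF : set_system hcompletion) : ProperFilter FF ->
  cauchy FF -> cvg FF.
Proof.
move=> PF /cauchyP cF.
have cR (e : R) : 0 < e -> exists G : hcompletion,
    FF [set F | hcompl_norm (G - F) < e].
  move=> e0; have e0' : 0 < e%:C by rewrite ltcR.
  have [G GP] := cF _ e0'; exists G; move: GP; apply: filterS => F.
  by rewrite -ball_normE/= ltcR.
have cw (f : R[i] -> R) w : (forall z, `|f z| <= rnorm z) ->
    {morph f : z z' / z - z'} ->
    cvg ((fun F : hcompletion => f (F w)) @ FF).
  move=> f1 fB; apply: cauchy_cvg; apply: cauchy_exP => e e0.
  have w1 : 0 < pre_norm w + 1 by rewrite ltr_wpDl// pre_norm_ge0.
  have e1 : 0 < e / (pre_norm w + 1) by rewrite divr_gt0.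
  have [G GP] := cR _ e1; exists (f (G w)).
  change (FF [set F : hcompletion | ball (f (G w)) e (f (F w))]); move: GP.
  apply: filterS => F /= GF; rewrite -ball_normE/= -fB.
  rewrite (le_lt_trans (f1 _))// -hcomplB (le_lt_trans (hcompl_normP _ _))//.
  have := hcompl_norm_ge0 (G - F); rewrite ltr_pdivlMr// in GF.
  by have := pre_norm_ge0 w; nra.
pose lR w := lim ((fun F : hcompletion => complex.Re (F w)) @ FF).
pose lI w := lim ((fun F : hcompletion => complex.Im (F w)) @ FF).
have lP (f : R[i] -> R) w (G : hcompletion) (e : R) :
    (forall z, `|f z| <= rnorm z) ->
    {morph f : z z' / z - z'} ->
    FF [set F | hcompl_norm (G - F) < e] ->
    `|lim ((fun F : hcompletion => f (F w)) @ FF) - f (G w)| <= e * pre_norm w.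
  move=> f1 fB GP; have cf := cw f w f1 fB.
  set l := lim _.
  have h : (fun F : hcompletion => `|f (F w) - f (G w)|) @ FF --> `|l - f (G w)|.
    by apply: cvg_norm; apply: cvgB cf _; exact: cvg_cst.
  apply: (cvgr_to_le h).
  move: GP; apply: filterS => F /= GF.
  rewrite distrC -fB (le_trans (f1 _))// -hcomplB (le_trans (hcompl_normP _ _))//.
  by rewrite ler_wpM2r ?pre_norm_ge0// ltW.
pose L w : R[i] := Complex (lR w) (lI w).
(* The factor 2 adds the estimates of the real and imaginary parts. *)
have LP (G : hcompletion) (e : R) : FF [set F | hcompl_norm (G - F) < e] ->
    forall w, rnorm (L w - G w) <= 2 * e * pre_norm w.
  move=> GP w; rewrite (le_trans (ler_rnorm_ReIm _))//.
  have := lP _ w G e ler_Re_rnorm (raddfB _) GP.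
  have := lP _ w G e ler_Im_rnorm (raddfB _) GP.
  by rewrite /L -/(lR w) -/(lI w) !raddfB/=; lra.
have LU : L \in pre_approx.
  apply/asboolP => e e0.
  have e3 : 0 < e / 3 by rewrite divr_gt0.
  have [G GP] := cR _ e3.
  have [u uP] := hcompl_approx G e3; exists u => w.
  have := LP _ _ GP w; have := uP w.
  have := ler_rnormD (L w - G w) (G w - pre_dot u w).
  by rewrite subrKA; lra.
apply/cvg_ex; exists (HCompletion LU).
apply/cvg_rnormP => e e0.
have e3 : 0 < e / 4 by rewrite divr_gt0.
have [G GP] := cR _ e3; move: (GP); apply: filterS => F /= GF.
have h1 := ler_rnormD (HCompletion LU - G) (G - F).
rewrite subrKA in h1; rewrite (le_lt_trans h1)//.
have h2 : rnorm (HCompletion LU - G) <= 2 * (e / 4).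
  by apply: hcompl_norm_le => [|w]; [lra|exact: LP].
have h3 : rnorm (G - F) < e / 4 by [].
by lra.
Qed.

HB.instance Definition _ :=
  Uniform_isComplete.Build hcompletion hcompl_complete.

Lemma hcompl_emb_subproof u : pre_dot u \in pre_approx.
Proof.
apply/asboolP => e e0; exists u => w; rewrite subrr rnorm0.
by rewrite mulr_ge0 ?pre_norm_ge0 ?ltW.
Qed.

Definition hcompl_emb u := HCompletion (hcompl_emb_subproof u).

Lemma hcompl_emb_add u v :
  hcompl_emb (pre_add u v) = hcompl_emb u + hcompl_emb v.
Proof. by apply: hcompl_ext => w; rewrite hcomplD /= pre_dotD. Qed.

Lemma hcompl_emb_scale a u : hcompl_emb (pre_scale a u) = a *: hcompl_emb u.
Proof. by apply: hcompl_ext => w; rewrite hcomplZ /= pre_dotZ. Qed.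

Lemma rnorm_hcompl_emb u : rnorm (hcompl_emb u) = pre_norm u.
Proof.
apply/eqP; rewrite eq_le; apply/andP; split.
  by apply: hcompl_norm_le => [|w]; rewrite ?pre_norm_ge0 ?pre_cauchy_schwarz.
have [u0|u0] := eqVneq (pre_norm u) 0; first by rewrite u0 rnorm_ge0.
have up : 0 < pre_norm u by rewrite lt_def u0 pre_norm_ge0.
have := hcompl_normP (hcompl_emb u) u.
rewrite /= -pre_norm_sqr rnormR ger0_norm ?sqr_ge0// expr2.
by rewrite ler_pM2r.
Qed.

Lemma hcompl_emb_dense F : exists u : nat -> U,
  (fun n => hcompl_emb (u n)) @ \oo --> F.
Proof.
have n0 n : (0 : R) < n.+1%:R^-1 by rewrite invr_gt0.
have [u uP] := choice (fun n => hcompl_approx F (n0 n)).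
exists u; apply/cvgn_rnormP => e e0.
have [N _ NP] := near_infty_natSinv_lt (PosNum e0); exists N => n Nn.
rewrite (le_lt_trans _ (NP n Nn))//.
apply: hcompl_norm_le => // w; exact: uP.
Qed.

(* Polarization of the norm, which is extended by continuity. *)
Definition hcompl_dot F G : R[i] := let q a := `|F + a *: G| ^+ 2 in
  4%:R^-1 * (q 1 - q (-1) + 'i%C * (q 'i%C - q (- 'i%C))).

Arguments hcompl_dot : simpl never.

(** The reason for defining the product through norms: joint continuity follows from continuity of
    the norm, and every algebraic law then passes from the dense image of [hcompl_emb] to the
    completion. *)
Lemma hcompl_dot_cvg (f g : nat -> hcompletion) F G :
  f @ \oo --> F -> g @ \oo --> G ->
  (fun n => hcompl_dot (f n) (g n)) @ \oo --> hcompl_dot F G.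
Proof.
move=> fF gG.
have sq (h : nat -> hcompletion) K : h @ \oo --> K ->
    (fun n => `|h n| ^+ 2) @ \oo --> `|K| ^+ 2.
  by move=> hK; rewrite expr2; under eq_fun do rewrite expr2;
     apply: cvgM; exact: cvg_norm.
have Z (h : nat -> hcompletion) K (a : R[i]) : h @ \oo --> K ->
    (fun n => `|f n + a *: h n| ^+ 2) @ \oo --> `|F + a *: K| ^+ 2.
  by move=> hK; apply: sq; apply: cvgD => //; apply: cvgZ => //; exact: cvg_cst.
have B (a b : nat -> R[i]) x y : a @ \oo --> x -> b @ \oo --> y ->
  (fun n => a n - b n) @ \oo --> x - y by exact: cvgB.
apply: cvgM; first exact: cvg_cst.
apply: cvgD; first by apply: B; exact: Z.
by apply: cvgM; [exact: cvg_cst|apply: B; exact: Z].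
Qed.

Lemma hcompl_dot_emb u v :
  hcompl_dot (hcompl_emb u) (hcompl_emb v) = pre_dot u v.
Proof.
have sq w : `|hcompl_emb w| ^+ 2 = pre_dot w w.
  by rewrite -rnormE rnorm_hcompl_emb -rmorphXn/= pre_norm_sqr.
rewrite /hcompl_dot -!(hcompl_emb_scale, hcompl_emb_add) !sq.
rewrite !(pre_dotD, pre_dotZ) ![pre_dot _ (pre_add _ _)]pre_dotC.
rewrite !(pre_dotD, pre_dotZ) -!pre_norm_sqr (pre_dotC v u).
have n4 : (4%:R : R[i]) != 0 by rewrite pnatr_eq0.
apply: (mulfI n4); rewrite mulrA divff// mul1r.
case: (pre_dot u v) => b b'.
by simpc; apply/eqP; rewrite eq_complex/=; apply/andP; split; apply/eqP; ring.
Qed.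

Lemma hcompl_dotC F G : hcompl_dot F G = conjc (hcompl_dot G F).
Proof.
have [u uF] := hcompl_emb_dense F; have [v vG] := hcompl_emb_dense G.
have h1 := hcompl_dot_cvg uF vG; have h2 := hcompl_dot_cvg vG uF.
apply: (cvgn_unique h1).
apply/cvgn_rnormP => e e0.
have [N NP] := (cvgn_rnormP _ _).1 h2 e e0; exists N => n /NP.
by rewrite !hcompl_dot_emb -rnormJ raddfB/= -pre_dotC.
Qed.

Lemma hcompl_dotP a F F' G :
  hcompl_dot (a *: F + F') G = a * hcompl_dot F G + hcompl_dot F' G.
Proof.
have [u uF] := hcompl_emb_dense F; have [u' uF'] := hcompl_emb_dense F'.
have [v vG] := hcompl_emb_dense G.
have h1 := hcompl_dot_cvg uF vG; have h2 := hcompl_dot_cvg uF' vG.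
have h3 : (fun n => a *: hcompl_emb (u n) + hcompl_emb (u' n)) @ \oo -->
    a *: F + F'.
  exact: cvgn_lin.
apply: (cvgn_unique (hcompl_dot_cvg h3 vG)).
under eq_fun do rewrite -hcompl_emb_scale -hcompl_emb_add hcompl_dot_emb
  pre_dotD pre_dotZ -!hcompl_dot_emb.
exact: cvgn_linC.
Qed.

Lemma hcompl_dot_norm F : hcompl_dot F F = `|F| ^+ 2.
Proof.
have [u uF] := hcompl_emb_dense F.
apply: (cvgn_unique (hcompl_dot_cvg uF uF)).
under eq_fun do rewrite hcompl_dot_emb -pre_norm_sqr -rnorm_hcompl_emb
  rmorphXn/= rnormE expr2.
by rewrite expr2; apply: cvgM; exact: cvg_norm.
Qed.

Lemma hcompl_dot_bilinear : bilinear_for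
  ( *%R : GRing.Scale.law R[i] R[i])
  (@conjc R \; *%R : GRing.Scale.law R[i] R[i]) hcompl_dot.
Proof.
split=> [G a F F'|F a G G']; first exact: hcompl_dotP.
change (hcompl_dot F (a *: G + G') =
  conjc a * hcompl_dot F G + hcompl_dot F G').
have conjcP (x y z : R[i]) : conjc (x * y + z) = conjc x * conjc y + conjc z.
  by rewrite (rmorphD (@conjc R)) /= (rmorphM (@conjc R)).
by rewrite hcompl_dotC hcompl_dotP conjcP -!hcompl_dotC.
Qed.

HB.instance Definition _ := bilinear_isBilinear.Build R[i] hcompletion
  hcompletion R[i] *%R (@conjc R \; *%R) hcompl_dot hcompl_dot_bilinear.

Lemma hcompl_dot_herm F G :
  hcompl_dot F G = (-1) ^+ false * conjc (hcompl_dot G F).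
Proof. by rewrite expr0 mul1r hcompl_dotC. Qed.

HB.instance Definition _ := isHermitianSesquilinear.Build R[i] hcompletion
  false (@conjc R) hcompl_dot hcompl_dot_herm.

Lemma hcompl_dot_gt0 F : F != 0 -> 0 < hcompl_dot F F.
Proof. by move=> F0; rewrite hcompl_dot_norm exprn_gt0// normr_gt0. Qed.

HB.instance Definition _ := isDotProduct.Build R[i] hcompletion
  hcompl_dot hcompl_dot_gt0.

HB.instance Definition _ := @CompleteNormedModule_isHilbert.Build R hcompletion
  (hcompl_dot : {dot hcompletion for @conjc R}) hcompl_dot_norm.

(** Reproducing property: evaluating an element of the completion at u is pairing it with the image
    of u. Operators defined by changing the argument u are handled through it. *)
Lemma hdot_hcompl_emb F u : hdot F (hcompl_emb u) = F u.
Proof.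
have [v vF] := hcompl_emb_dense F.
apply: (cvgn_unique (hcompl_dot_cvg vF (cvg_cst (hcompl_emb u)))).
apply/cvgn_rnormP => e e0.
have u1 : 0 < pre_norm u + 1 by rewrite ltr_wpDl// pre_norm_ge0.
have [N NP] := (cvgn_rnormP _ _).1 vF _ (divr_gt0 e0 u1).
exists N => n /NP; rewrite hcompl_dot_emb ltr_pdivlMr// => h.
rewrite -[F u - _]/((F - hcompl_emb (v n)) u).
rewrite (le_lt_trans (hcompl_normP _ _))//.
by have := hcompl_norm_ge0 (F - hcompl_emb (v n)); move: h; rewrite rnorm_hcompl;
  have := pre_norm_ge0 u; nra.
Qed.

End Completion.

(** * Dilation of a semispectral measure *)

Section Dilation.
Context {R : realType} d (T : measurableType d) (H : hilbertType R).
Variable M : semispectral T H.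

(* A semispectral measure is meaningful on measurable sets only. *)
Definition mset (A : set T) : set T := if `[< measurable A >] then A else set0.

Lemma mset_id A : measurable A -> mset A = A.
Proof. by move=> mA; rewrite /mset asboolT. Qed.

Lemma measurable_mset A : measurable (mset A).
Proof. by rewrite /mset; case: asboolP. Qed.
Hint Resolve measurable_mset : core.

Implicit Types (x y : set T * H) (l m : seq (set T * H)) (A B C : set T).

(** [C = setT] gives the form of the dilation. Other sets C give the form cut down to C, which the
    positivity proof needs for its induction and which later describes the projections. *)
Definition dil_ker C x y : R[i] :=
  hdot (M (C `&` (mset x.1 `&` mset y.1)) x.2) y.2.

Definition dil_sum C l m : R[i] := \sum_(x <- l) \sum_(y <- m) dil_ker C x y.

Lemma sspm0 : M set0 = 0.
Proof. by apply/(sspm_nullP M measurable0) => h; exact: measure0. Qed.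

Lemma sspmU A B : measurable A -> measurable B -> A `&` B = set0 ->
  M (A `|` B) = M A + M B.
Proof.
move=> mA mB AB; have mU := measurableU _ _ mA mB.
have [lA _] := sspm_bounded M mA; have [lB _] := sspm_bounded M mB.
apply: form_ext; first by have [] := sspm_bounded M mU.
  by have [] := bounded_opD (sspm_bounded M mA) (sspm_bounded M mB).
move=> h; rewrite -[(M A + M B) h]/(M A h + M B h) hdotDl !sspm_hdot//.
rewrite -(rmorphD (real_complex R)); congr (_%:C).
transitivity (fine (sspm_diag M h A + sspm_diag M h B)%E).
  congr fine; exact: (measureU (sspm_diag M h) mA mB AB).
by rewrite fineD// /sspm_diag.
Qed.

Lemma sspm_sym A h k : measurable A -> hdot (M A h) k = conjc (hdot (M A k) h).
Proof.
move=> mA; rewrite (nonneg_sym (sspm_bounded M mA) (sspm_ge0 M mA)).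
by rewrite -hdotC.
Qed.

Lemma dil_kerC C x y : measurable C -> dil_ker C x y = conjc (dil_ker C y x).
Proof.
move=> mC; rewrite /dil_ker sspm_sym; last by do 2?apply: measurableI.
by rewrite (setIC (mset x.1)).
Qed.

Lemma dil_sumC C l m : measurable C -> dil_sum C l m = conjc (dil_sum C m l).
Proof.
move=> mC; rewrite /dil_sum exchange_big rmorph_sum/=; apply: eq_bigr => y _.
by rewrite rmorph_sum/=; apply: eq_bigr => x _; exact: dil_kerC.
Qed.

Lemma dil_ker_split C A x y : measurable C -> measurable A ->
  dil_ker C x y = dil_ker (C `&` A) x y + dil_ker (C `\` A) x y.
Proof.
move=> mC mA; rewrite /dil_ker -hdotDl.
set B := mset _ `&` mset _.
have mB : measurable B by exact: measurableI.
have -> : M (C `&` B) = M (C `&` A `&` B) + M ((C `\` A) `&` B).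
  rewrite -sspmU.
  - by rewrite -setIUl setUIDK.
  - by apply: measurableI => //; exact: measurableI.
  - by apply: measurableI => //; exact: measurableD.
  - by apply/seteqP; split=> // z /= [[[_ Az] _] [[_ nAz] _]].
by [].
Qed.

Lemma dil_sum_split C A l m : measurable C -> measurable A ->
  dil_sum C l m = dil_sum (C `&` A) l m + dil_sum (C `\` A) l m.
Proof.
move=> mC mA; rewrite /dil_sum -big_split; apply: eq_bigr => x _ /=.
by rewrite -big_split; apply: eq_bigr => y _; exact: dil_ker_split.
Qed.

(* Replacing a combination by one with the same pairings does not change the
   value of the quadratic form. *)
Lemma dil_sum_eqv C l l' : measurable C ->
  (forall y, \sum_(x <- l) dil_ker C x y = \sum_(x <- l') dil_ker C x y) ->
  dil_sum C l l = dil_sum C l' l'.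
Proof.
move=> mC ll'.
have E m : dil_sum C l m = dil_sum C l' m.
  rewrite /dil_sum exchange_big/= [RHS]exchange_big/=.
  by apply: eq_bigr => y _.
by rewrite E dil_sumC// E -dil_sumC.
Qed.

(* The induction splits [C] along the sets occurring in the combination, until
   it reduces to a single vector. *)
Lemma dil_sum_ge0' l C h : measurable C ->
  0 <= dil_sum C ((setT, h) :: l) ((setT, h) :: l).
Proof.
elim: l C h => [C h mC|[A k] l IH C h mC].
  rewrite /dil_sum !big_seq1; apply: sspm_ge0.
  by do 2?apply: measurableI.
have mA := measurable_mset A.
(* Inside [A] the symbols of [setT] and [A] agree, so h and k merge into h + k; outside, the symbol
   of [A] vanishes. Either way one symbol disappears. *)
rewrite (@dil_sum_split _ (mset A))//; apply: addr_ge0.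
  rewrite (@dil_sum_eqv _ _ ((setT, h + k) :: l)); first exact/IH/measurableI.
    exact: measurableI.
  move=> y; rewrite !big_cons addrA; congr (_ + _); rewrite /dil_ker /=.
  have -> : mset setT = setT by rewrite mset_id.
  rewrite setTI; set B := mset y.1.
  have -> : C `&` mset A `&` (mset A `&` B) = C `&` mset A `&` B.
    by rewrite -!setIA (setIA (mset A) (mset A)) setIid.
  have mB : measurable (C `&` mset A `&` B).
    by apply: measurableI (measurable_mset _); exact: measurableI.
  have [lM _] := sspm_bounded M mB.
  by rewrite (linear_D lM) hdotDl.
rewrite (@dil_sum_eqv _ _ ((setT, h) :: l)); first exact/IH/measurableD.
  exact: measurableD.
move=> y; rewrite !big_cons; congr (_ + _).
rewrite [X in X + _](_ : _ = 0) ?add0r//.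
rewrite /dil_ker/= (_ : (C `\` mset A) `&` _ = set0) ?sspm0 ?hdot0l//.
by apply/seteqP; split=> // z /= [[_ nA] [zA _]]; exact: nA.
Qed.

Lemma dil_sum_ge0 l C : measurable C -> 0 <= dil_sum C l l.
Proof.
move=> mC; rewrite (@dil_sum_eqv _ _ ((setT, 0) :: l))//; first exact: dil_sum_ge0'.
move=> y; rewrite big_cons {2}/dil_ker /=.
have mB : measurable (C `&` (mset setT `&` mset y.1)) by do 2?apply: measurableI.
by have [lM _] := sspm_bounded M mB; rewrite (linear_0 lM) hdot0l add0r.
Qed.

Definition dil_scale (a : R[i]) l : seq (set T * H) :=
  [seq (x.1, a *: x.2) | x <- l].

Lemma dil_sum0 m : dil_sum setT [::] m = 0.
Proof. by rewrite /dil_sum big_nil. Qed.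

Lemma dil_sumD l l' m :
  dil_sum setT (l ++ l') m = dil_sum setT l m + dil_sum setT l' m.
Proof. by rewrite /dil_sum big_cat. Qed.

Lemma dil_sumZ a l m : dil_sum setT (dil_scale a l) m = a * dil_sum setT l m.
Proof.
rewrite /dil_sum big_map mulr_sumr; apply: eq_bigr => x _.
rewrite mulr_sumr; apply: eq_bigr => y _; rewrite /dil_ker/=.
have mB : measurable (setT `&` (mset x.1 `&` mset y.1)) by do 2?apply: measurableI.
by have [lM _] := sspm_bounded M mB; rewrite (linear_Z lM) hdotZl.
Qed.

Definition dil_pre : preHilbert R :=
  PreHilbert dil_sum0 dil_sumD dil_sumZ
    (fun l m => dil_sumC l m measurableT)
    (fun l => dil_sum_ge0 l measurableT).

Definition dil_space := hcompletion dil_pre.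

Definition dil_cut A l : seq (set T * H) := [seq (A `&` mset x.1, x.2) | x <- l].

Lemma dil_sum_cut A l m : measurable A ->
  dil_sum setT (dil_cut A l) m = dil_sum A l m.
Proof.
move=> mA; rewrite /dil_sum big_map; apply: eq_bigr => x _.
apply: eq_bigr => y _; rewrite /dil_ker/= setTI mset_id; last exact: measurableI.
by rewrite setIA.
Qed.

Lemma dil_sum_cutr A l m : measurable A ->
  dil_sum setT l (dil_cut A m) = dil_sum A l m.
Proof. by move=> mA; rewrite dil_sumC// dil_sum_cut// -dil_sumC. Qed.

Lemma dil_sum_cut_le A l : measurable A ->
  complex.Re (dil_sum A l l) <= complex.Re (dil_sum setT l l).
Proof.
move=> mA; rewrite (@dil_sum_split setT A)// setTI raddfD/= lerDl.
have := dil_sum_ge0 l (measurableD measurableT mA).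
by rewrite lecE => /andP[].
Qed.

Lemma dil_sum_cutI A B l m : measurable A -> measurable B ->
  dil_sum A (dil_cut B l) m = dil_sum (A `&` B) l m.
Proof.
move=> mA mB; rewrite /dil_sum big_map; apply: eq_bigr => x _.
apply: eq_bigr => y _; rewrite /dil_ker/= mset_id; last exact: measurableI.
by rewrite !setIA.
Qed.

Lemma dil_norm_cut A (l : dil_pre) : measurable A ->
  pre_norm (dil_cut A l : dil_pre) <= pre_norm l.
Proof.
move=> mA; rewrite /pre_norm ler_wsqrtr//= dil_sum_cutr// dil_sum_cutI//.
by rewrite setIid; exact: dil_sum_cut_le.
Qed.

Lemma dil_proj_subproof A (F : dil_space) :
  (fun l : dil_pre => F (dil_cut (mset A) l)) \in @pre_approx R dil_pre.
Proof.
apply/asboolP => e e0; have [u uP] := hcompl_approx F e0.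
exists (dil_cut (mset A) u) => w.
have -> : pre_dot (dil_cut (mset A) u : dil_pre) w =
    pre_dot u (dil_cut (mset A) w).
  by rewrite /pre_dot/= dil_sum_cut// dil_sum_cutr.
by rewrite (le_trans (uP _))// ler_wpM2l ?(ltW e0)// dil_norm_cut.
Qed.

(** Cutting to A is symmetric for the form, so on elements seen as functionals the projection is
    precomposition with the cut; no representative has to be chosen. *)
Definition dil_proj A (F : dil_space) : dil_space :=
  HCompletion (dil_proj_subproof A F).

Lemma dil_proj_emb A u : measurable A ->
  dil_proj A (hcompl_emb u) = hcompl_emb (dil_cut A u : dil_pre).
Proof.
move=> mA; apply: hcompl_ext => w.
by rewrite /= mset_id// dil_sum_cut// dil_sum_cutr.
Qed.

Lemma hdot_dil_proj A F u : measurable A ->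
  hdot (dil_proj A F) (hcompl_emb u) = F (dil_cut A u).
Proof. by move=> mA; rewrite hdot_hcompl_emb /= mset_id. Qed.

Lemma hcompl_emb_eq (u v : dil_pre) :
  (forall w, dil_sum setT u w = dil_sum setT v w) ->
  hcompl_emb u = hcompl_emb v.
Proof. by move=> uv; apply: hcompl_ext. Qed.

Lemma dil_projI A B : measurable A -> measurable B ->
  dil_proj (A `&` B) = dil_proj A \o dil_proj B.
Proof.
move=> mA mB; apply/funext => F; apply: hcompl_ext => w /=.
rewrite !mset_id//; last exact: measurableI.
rewrite -!hdot_hcompl_emb; congr (hdot F _); apply: hcompl_emb_eq => v.
by rewrite dil_sum_cut ?dil_sum_cut// ?dil_sum_cutI//; [rewrite setIC|exact: measurableI].
Qed.

Lemma dil_projT : dil_proj setT = id.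
Proof.
apply/funext => F; apply: hcompl_ext => w /=.
rewrite mset_id// -!hdot_hcompl_emb; congr (hdot F _).
by apply: hcompl_emb_eq => v; rewrite dil_sum_cut.
Qed.

Lemma linear_dil_proj A : linear (dil_proj A).
Proof. by move=> a F G; apply: hcompl_ext. Qed.

Lemma dil_proj_bound A F : rnorm (dil_proj A F) <= rnorm F.
Proof.
rewrite !rnorm_hcompl; apply: hcompl_norm_le => [|w].
  exact: hcompl_norm_ge0.
apply: le_trans (hcompl_normP F (dil_cut (mset A) w)) _.
by rewrite ler_wpM2l ?hcompl_norm_ge0// dil_norm_cut.
Qed.

Lemma bounded_dil_proj A : bounded_op (dil_proj A).
Proof.
apply/bounded_opP; split; first exact: linear_dil_proj.
by exists 1; split=> // F; rewrite mul1r dil_proj_bound.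
Qed.

Lemma cvg_hdotr (K : hilbertType R) (F : K) (u : nat -> K) G :
  u @ \oo --> G -> (fun n => hdot F (u n)) @ \oo --> hdot F G.
Proof.
move=> uG; apply/cvgn_rnormP => e e0.
have F1 : 0 < rnorm F + 1 by rewrite ltr_wpDl ?rnorm_ge0.
have [N NP] := (cvgn_rnormP _ _).1 uG _ (divr_gt0 e0 F1); exists N => n /NP.
rewrite -hdotBr ltr_pdivlMr// => h; rewrite (le_lt_trans (cauchy_schwarz _ _))//.
have := rnorm_ge0 (G - u n); lra.
Qed.

Lemma cvgn_op (K L : hilbertType R) (A : K -> L) (u : nat -> K) G :
  bounded_op A -> u @ \oo --> G -> (fun n => A (u n)) @ \oo --> A G.
Proof. by move=> [_ cA] uG; apply: (cvg_comp _ _ uG); exact: cA. Qed.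

Lemma dil_proj_sym A F G : measurable A ->
  hdot (dil_proj A F) G = hdot F (dil_proj A G).
Proof.
move=> mA; have [u uG] := hcompl_emb_dense G.
apply: (cvgn_unique (cvg_hdotr (F := dil_proj A F) uG)).
have h := cvg_hdotr (F := F) (cvgn_op (bounded_dil_proj A) uG).
under eq_fun do rewrite hdot_dil_proj// -hdot_hcompl_emb -dil_proj_emb//.
exact: h.
Qed.

Lemma dil_proj_ge0 A : measurable A -> nonneg_op (dil_proj A).
Proof.
move=> mA F; have -> : dil_proj A F = dil_proj A (dil_proj A F).
  by rewrite -[RHS]/((dil_proj A \o dil_proj A) F) -dil_projI// setIid.
by rewrite dil_proj_sym// hdot_norm exprn_ge0.
Qed.

Lemma dil_projU A B : measurable A -> measurable B -> A `&` B = set0 ->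
  dil_proj (A `|` B) = dil_proj A + dil_proj B.
Proof.
move=> mA mB AB; apply/funext => F; apply: hcompl_ext => w.
rewrite -[(dil_proj A + _) F]/(dil_proj A F + dil_proj B F) hcomplD /=.
rewrite !mset_id//; last exact: measurableU.
rewrite -!hdot_hcompl_emb -hdotDr -hcompl_emb_add; congr (hdot F _).
apply: hcompl_emb_eq => v; rewrite [RHS]dil_sumD !dil_sum_cut//; last exact: measurableU.
rewrite (@dil_sum_split (A `|` B) A)//; last exact: measurableU.
rewrite setUK; congr (dil_sum _ _ _ + dil_sum _ _ _).
by rewrite setUKD// AB.
Qed.

Lemma dil_proj0 F : dil_proj set0 F = 0.
Proof.
have : dil_proj (set0 `|` set0) F = dil_proj set0 F + dil_proj set0 F.
  by rewrite dil_projU// set0I.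
by rewrite setU0 => /(canLR (addrK _)); rewrite subrr.
Qed.

Lemma dil_proj_sum (S : nat -> set T) n : (forall k, measurable (S k)) ->
  trivIset setT S -> forall F,
  \sum_(0 <= k < n) dil_proj (S k) F = dil_proj (\big[setU/set0]_(0 <= k < n) S k) F.
Proof.
move=> mS tS F; elim: n => [|n IH]; first by rewrite !big_nil dil_proj0.
rewrite !big_nat_recr//= IH dil_projU//.
  by apply: bigsetU_measurable => k _; exact: mS.
rewrite big_mkord; apply: (@trivIset_bigsetUI _ xpredT) => //.
by apply: sub_trivIset tS.
Qed.

(** For embedded vectors the pairing is a finite sum of values of [M], whose sigma-additivity
    applies term by term. Density extends this to all vectors because the partial sums are
    themselves projections, hence uniformly bounded. *)
Lemma dil_proj_sigma_additive (S : nat -> set T) :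
  (forall n, measurable (S n)) -> trivIset setT S -> forall F G : dil_space,
  (fun n => \sum_(0 <= k < n) hdot (dil_proj (S k) F) G) @ \oo -->
    hdot (dil_proj (\bigcup_n S n) F) G.
Proof.
move=> mS tS F G.
have mU : measurable (\bigcup_n S n) by exact: bigcup_measurable.
have emb (u v : dil_pre) :
    (fun n => \sum_(0 <= k < n) hdot (dil_proj (S k) (hcompl_emb u)) (hcompl_emb v))
      @ \oo --> hdot (dil_proj (\bigcup_n S n) (hcompl_emb u)) (hcompl_emb v).
  have E A : measurable A ->
      hdot (dil_proj A (hcompl_emb u)) (hcompl_emb v) = dil_sum A u v.
    by move=> mA; rewrite hdot_dil_proj//= dil_sum_cutr.
  rewrite E//.
  have cvg_sum (I : Type) (r : seq I) (f : I -> nat -> R[i]) (l : I -> R[i]) :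
      (forall i, f i @ \oo --> l i) ->
      (fun n => \sum_(i <- r) f i n) @ \oo --> \sum_(i <- r) l i.
    move=> fl; elim: r => [|i r IH].
      rewrite big_nil; under eq_fun do rewrite big_nil; exact: cvg_cst.
    rewrite big_cons; under eq_fun do rewrite big_cons.
    by apply: cvgD; [exact: fl|exact: IH].
  have -> : (fun n => \sum_(0 <= k < n)
      hdot (dil_proj (S k) (hcompl_emb u)) (hcompl_emb v)) =
      (fun n => \sum_(x <- u) \sum_(y <- v) \sum_(0 <= k < n) dil_ker (S k) x y).
    apply/funext => n; under eq_bigr do rewrite E//.
    rewrite /dil_sum exchange_big/=; apply: eq_bigr => x _.
    by rewrite exchange_big.
  rewrite /dil_sum; apply: (cvg_sum _ u) => x; apply: (cvg_sum _ v) => y; rewrite /dil_ker setI_bigcupl.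
  apply: (@sspm_sigma_additive _ _ _ _ M (fun n => S n `&` (mset x.1 `&` mset y.1))).
    by move=> n; apply: measurableI => //; exact: measurableI.
  exact: trivIset_setIr.
have small (x e : R) (X : dil_space) : 0 <= x -> 0 < e ->
    exists u, x * rnorm (X - hcompl_emb u) < e.
  move=> x0 e0; have [u uX] := hcompl_emb_dense X.
  have x1 : 0 < x + 1 by rewrite ltr_wpDl.
  have [N /(_ N (leqnn N))] := (cvgn_rnormP _ _).1 uX _ (divr_gt0 e0 x1).
  rewrite ltr_pdivlMr// => h; exists (u N); have := rnorm_ge0 (X - hcompl_emb (u N)).
  lra.
pose P n := dil_proj (\big[setU/set0]_(0 <= k < n) S k).
have sumE X Y : (fun n => \sum_(0 <= k < n) hdot (dil_proj (S k) X) Y) =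
    (fun n => hdot (P n X) Y).
  by apply/funext => n; rewrite -hdot_suml dil_proj_sum.
rewrite sumE.
apply/cvgn_rnormP => e e0.
have e3 : 0 < e / 3 by rewrite divr_gt0.
have [u uF] := small (2 * rnorm G) _ F (mulr_ge0 (ler0n _ _) (rnorm_ge0 _)) e3.
set f := hcompl_emb u in uF.
(* The order matters: f is fixed first, and the precision required of g depends on the norm of f.
   The factor 2 bounds the difference of the two contractions [Q] and [P n]. *)
have [v vG] := small (2 * rnorm f) _ G (mulr_ge0 (ler0n _ _) (rnorm_ge0 _)) e3.
set g := hcompl_emb v in vG.
have := emb u v; rewrite sumE => /cvgn_rnormP/(_ _ e3)[N NP]; exists N => n /NP => h1.
rewrite -hdotBl -/f -/g in h1; rewrite -hdotBl.
set Q := dil_proj _ in h1 *.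
have QP X : rnorm (Q X - P n X) <= 2 * rnorm X.
  rewrite (le_trans (ler_rnormB _ _))// mulr_natl mulr2n.
  by rewrite lerD// dil_proj_bound.
have QB (X Y : dil_space) :
    Q (X - Y) - P n (X - Y) = (Q X - P n X) - (Q Y - P n Y).
  have lQ : linear Q by exact: linear_dil_proj.
  have lP : linear (P n) by exact: linear_dil_proj.
  rewrite (linear_B lQ) (linear_B lP) opprD opprK addrACA; congr (_ + _).
  by rewrite opprB addrC.
have -> : hdot (Q F - P n F) G = hdot (Q f - P n f) g +
   hdot (Q f - P n f) (G - g) + hdot (Q (F - f) - P n (F - f)) G.
  rewrite -hdotDr addrCA subrr addr0 QB.
  by rewrite (hdotBl (Q F - P n F)) [RHS]addrC subrK.
have h2 : rnorm (hdot (Q f - P n f) (G - g)) < e / 3.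
  rewrite (le_lt_trans _ vG)// (le_trans (cauchy_schwarz _ _))//.
  by rewrite ler_wpM2r ?rnorm_ge0 ?QP.
have h3 : rnorm (hdot (Q (F - f) - P n (F - f)) G) < e / 3.
  rewrite (le_lt_trans _ uF)// (le_trans (cauchy_schwarz _ _))// mulrAC.
  by rewrite ler_wpM2r ?rnorm_ge0 ?QP.
rewrite (le_lt_trans (ler_rnormD _ _))//.
have := ler_rnormD (hdot (Q f - P n f) g) (hdot (Q f - P n f) (G - g)).
move: h1 h2 h3; set a := rnorm _; set b := rnorm _; set c := rnorm _; lra.
Qed.

Definition dil_sspm : semispectral T dil_space :=
  @Semispectral _ _ _ _ dil_proj (fun A _ => bounded_dil_proj A)
    dil_proj_ge0 dil_proj_sigma_additive.

Definition dil_map (h : H) : dil_space :=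
  hcompl_emb ([:: (setT, h)] : dil_pre).

Lemma dil_cut_map A h : measurable A ->
  dil_proj A (dil_map h) = hcompl_emb ([:: (A, h)] : dil_pre).
Proof.
move=> mA; rewrite dil_proj_emb//; congr hcompl_emb.
by rewrite /dil_cut/= mset_id// setIT.
Qed.

Lemma linear_dil_map : linear dil_map.
Proof.
move=> a h k; rewrite -hcompl_emb_scale -hcompl_emb_add.
apply: hcompl_emb_eq => w; rewrite dil_sumD dil_sumZ /dil_sum !big_seq1.
rewrite mulr_sumr -big_split; apply: eq_bigr => y _; rewrite /dil_ker/=.
have mB : measurable (setT `&` (mset setT `&` mset y.1)) by do 2?apply: measurableI.
by have [lM _] := sspm_bounded M mB; rewrite lM hdotDl hdotZl.
Qed.

Lemma hdot_dil_map A h k : measurable A ->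
  hdot (dil_proj A (dil_map h)) (dil_map k) = hdot (M A h) k.
Proof.
move=> mA; rewrite hdot_dil_proj//.
change (dil_sum setT [:: (setT, h)] (dil_cut A [:: (setT, k)]) = hdot (M A h) k).
rewrite dil_sum_cutr// /dil_sum !big_seq1/=.
by rewrite /dil_ker/= mset_id// !setIT.
Qed.

Lemma bounded_dil_map : bounded_op dil_map.
Proof.
apply/bounded_opP; split; first exact: linear_dil_map.
have [_ [m [m0 mP]]] := (bounded_opP _).1 (sspm_bounded M measurableT).
(* The image of h has squared norm <M(setT) h, h>, at most m |h|^2, and m is at most (m + 1)^2. *)
exists (m + 1); split=> [|h]; first by rewrite addr_ge0.
rewrite -(@ler_pXn2r _ 2)// ?nnegrE ?mulr_ge0 ?rnorm_ge0 ?addr_ge0//.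
have := hdot_dil_map h h measurableT; rewrite dil_projT => /(congr1 (@complex.Re R)).
rewrite Re_hdot_rnorm => ->; rewrite (le_trans (ler_norm _))//.
rewrite (le_trans (ler_Re_rnorm _))// (le_trans (cauchy_schwarz _ _))//.
by have := mP h; have := rnorm_ge0 h; have := rnorm_ge0 (M setT h); nra.
Qed.

(** Minimality for [E]: the class of a single symbol (A, h) is the projection by A of the image of
    h, and finite lists of symbols are dense. *)
Lemma dil_dense (W : set dil_space) : closed W -> W 0 ->
  (forall F G, W F -> W G -> W (F + G)) ->
  (forall A h, measurable A -> W (dil_proj A (dil_map h))) -> W = setT.
Proof.
move=> cW W0 WD WA; apply/seteqP; split=> // F _.
have We u : W (hcompl_emb (u : dil_pre)).
  elim: u => [|[A h] u IH].
    by rewrite (_ : hcompl_emb _ = 0)//; apply: hcompl_ext => w; rewrite /= dil_sum0.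
  have -> : hcompl_emb ((A, h) :: u : dil_pre) =
      dil_proj (mset A) (dil_map h) + hcompl_emb (u : dil_pre).
    rewrite dil_cut_map; last exact: measurable_mset.
    rewrite -hcompl_emb_add; apply: hcompl_emb_eq => w.
    rewrite /= -[in RHS]cat1s !dil_sumD -cat1s dil_sumD; congr (_ + _).
    rewrite /dil_sum !big_seq1; apply: eq_bigr => y _.
    by rewrite /dil_ker/= (mset_id (measurable_mset _)).
  by apply: WD => //; apply: WA; exact: measurable_mset.
have [u uF] := hcompl_emb_dense F.
by apply: (closed_cvg _ cW _ _ uF); exact: nearW.
Qed.

End Dilation.

(** * Weierstrass approximation on compact subsets of the half-line *)

Section Weierstrass.
Context {R : realType}.
Implicit Types (p x y : R) (phi : nat -> R).

(* Expectation of [phi] under the binomial law of parameters [n] and [p]. *)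
Fixpoint bexp p n phi : R :=
  if n is n'.+1 then (1 - p) * bexp p n' phi + p * bexp p n' (phi \o S)
  else phi 0.

Lemma bexp_le p n phi psi : 0 <= p <= 1 -> (forall k, phi k <= psi k) ->
  bexp p n phi <= bexp p n psi.
Proof.
move=> /andP[p0 p1]; elim: n phi psi => [|n IH] phi psi h /=; first exact: h.
by rewrite lerD// ler_wpM2l ?subr_ge0//; apply: IH => k; exact: h.
Qed.

Lemma eq_bexp p n phi psi : (forall k, phi k = psi k) ->
  bexp p n phi = bexp p n psi.
Proof. by move=> h; congr bexp; apply/funext. Qed.

(** Variance n p (1 - p) plus squared bias. Keeping c general lets the induction absorb the shift
    [phi \o S] as a replacement of c by c - 1. *)
Lemma bexp_quadratic p n (a b c : R) :
  bexp p n (fun k => a + b * (k%:R - c) ^+ 2) =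
  a + b * (n%:R * p * (1 - p) + (n%:R * p - c) ^+ 2).
Proof.
elim: n c => [|n IH] c /=; first by rewrite mulr0n !mul0r !add0r.
rewrite IH (@eq_bexp _ _ _ (fun k => a + b * (k%:R - (c - 1)) ^+ 2)); last first.
  by move=> k /=; rewrite -natr1; congr (a + b * _ ^+ 2); ring.
by rewrite IH -natr1; ring.
Qed.

(** The recursion of [bexp] run in the polynomial ring: where u takes the value p, evaluation yields
    the expectation of phi under the binomial law. *)
Fixpoint bernstein (u : {poly R[i]}) n (phi : nat -> R[i]) : {poly R[i]} :=
  if n is n'.+1 then (1 - u) * bernstein u n' phi + u * bernstein u n' (phi \o S)
  else (phi 0)%:P.

Lemma rnorm_bernstein (u : {poly R[i]}) (x : R[i]) p n (phi : nat -> R[i]) (z : R[i]) : 0 <= p <= 1 ->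
  u.[x] = p%:C ->
  rnorm (z - (bernstein u n phi).[x]) <= bexp p n (fun k => rnorm (z - phi k)).
Proof.
move=> /andP[p0 p1] ux; elim: n phi => [|n IH] phi /=; first by rewrite hornerC.
rewrite hornerD !hornerM hornerD hornerN ux hornerC.
have -> : z - ((1 - p%:C) * (bernstein u n phi).[x] +
    p%:C * (bernstein u n (phi \o S)).[x]) =
  (1 - p)%:C * (z - (bernstein u n phi).[x]) +
    p%:C * (z - (bernstein u n (phi \o S)).[x]).
  by rewrite rmorphB rmorph1; ring.
rewrite (le_trans (ler_rnormD _ _))// !rnormM !rnormR !ger0_norm ?subr_ge0//.
by rewrite lerD// ler_wpM2l ?subr_ge0//; exact: IH.
Qed.

(* The Bernstein nodes need not lie in [A]: the values of [g] are sampled at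
   almost nearest points of [A]. *)
Lemma weierstrass_modulus (A : set R) (b : R) (g : R -> R[i]) :
  0 < b -> A !=set0 -> (forall x, A x -> 0 <= x <= b) ->
  (forall e : R, 0 < e -> exists2 C : R, 0 <= C &
     forall x y, A x -> A y -> rnorm (g x - g y) <= e + C * (x - y) ^+ 2) ->
  forall e : R, 0 < e -> exists q : {poly R[i]},
     forall x, A x -> rnorm (g x - q.[x%:C]) <= e.
Proof.
move=> b0 [a0 Aa0] Ab gC e e0.
have e2 : 0 < e / 2 by rewrite divr_gt0.
have [C C0 CP] := gC _ e2.
have near (t d : R) : 0 < d ->
    exists y, A y /\ forall x, A x -> `|y - t| <= `|x - t| + d.
  move=> d0; have hi : has_inf [set `|x - t| | x in A].
    by split; [exists `|a0 - t|, a0|exists 0 => _ [x _ <-]].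
  have [_ [y Ay <-] yd] := inf_adherent d0 hi; exists y; split=> // x Ax.
  rewrite (le_trans (ltW yd))// lerD2r; apply: ge_inf; last by exists x.
  by case: hi.
(* With d = 1 / n, the term 2 C accounts for the distance from nodes to sample points and 8 C b^2
   for the binomial variance; both errors together are at most d L. *)
pose L := C * (2 + 8 * b ^+ 2).
have L0 : 0 <= L by rewrite mulr_ge0// addr_ge0// mulr_ge0// sqr_ge0.
have [m _ /(_ m (leqnn m)) /= mP] :=
  near_infty_natSinv_lt (PosNum (divr_gt0 e2 (ltr_wpDl L0 ltr01))).
pose n := m.+1; pose d : R := n%:R^-1.
have n0 : (0 : R) < n%:R by rewrite ltr0n.
have d0 : 0 < d by rewrite invr_gt0.
have d1 : d <= 1 by rewrite invf_le1// ler1n.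
have dn : d * n%:R = 1 by rewrite /d mulVf ?gt_eqF.
have dL : d * L <= e / 2.
  move: mP; rewrite -/n -/d ltr_pdivlMr ?ltr_wpDl//; nra.
have [y yP] := choice (fun k : nat => near (k%:R * b * d) d d0).
exists (bernstein ((b^-1)%:C *: 'X) n (fun k => g (y k))) => x Ax.
have /andP[x0 xb] := Ab _ Ax.
have xb1 : x / b * b = x by rewrite divfK ?gt_eqF.
have p01 : 0 <= x / b <= 1.
  by rewrite divr_ge0 ?(ltW b0)//= ler_pdivrMr// mul1r.
rewrite (le_trans (@rnorm_bernstein _ _ (x / b) _ _ _ _ _))//.
  by rewrite hornerZ hornerX -rmorphM mulrC.
set p := x / b in xb1 p01 *.
have step k : rnorm (g x - g (y k)) <=
    (e / 2 + 2 * C * d ^+ 2) + (8 * C * b ^+ 2 * d ^+ 2) * (k%:R - n%:R * p) ^+ 2.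
  have [Ay yx] := yP k.
  rewrite (le_trans (CP _ _ Ax Ay))// -addrA lerD2l.
  set t := k%:R * b * d in yx.
  (* Since x itself competes for being nearest to the node t, the sample point satisfies |y k - t|
     <= |x - t| + d, hence |x - y k| <= 2 |x - t| + d. *)
  have h1 : (x - y k) ^+ 2 <= 8 * (x - t) ^+ 2 + 2 * d ^+ 2.
    have h2 : `|x - y k| <= 2 * `|x - t| + d.
      have := ler_normB (x - t) (y k - t); rewrite opprB subrKA.
      by have := yx _ Ax; lra.
    rewrite -real_normK ?num_real// -[(x - t) ^+ 2]real_normK ?num_real//.
    have := normr_ge0 (x - y k); have := normr_ge0 (x - t).
    move: h2; set r := `|x - y k|; set s := `|x - t| => h2 s0 r0.
    have : r ^+ 2 <= (2 * s + d) ^+ 2.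
      by rewrite ler_pXn2r// nnegrE// addr_ge0 ?mulr_ge0// ltW.
    by have := sqr_ge0 (2 * s - d); lra.
  have h3 : x - t = - (b * d) * (k%:R - n%:R * p).
    rewrite /t -[in LHS]xb1.
    have -> : - (b * d) * (k%:R - n%:R * p) = (d * n%:R) * (p * b) - k%:R * b * d.
      by ring.
    by rewrite dn mul1r.
  rewrite h3 exprMn sqrrN exprMn in h1.
  have := ler_wpM2l C0 h1; lra.
rewrite (le_trans (bexp_le _ p01 step))// bexp_quadratic subrr expr0n/= addr0.
have /andP[p0 p1] := p01.
have h4 : p * (1 - p) <= 1 by nra.
have h5 : d ^+ 2 * n%:R = d by rewrite expr2 -mulrA dn mulr1.
have -> : 8 * C * b ^+ 2 * d ^+ 2 * (n%:R * p * (1 - p)) =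
   8 * C * b ^+ 2 * (d ^+ 2 * n%:R) * (p * (1 - p)) by ring.
rewrite h5.
have h6 : d ^+ 2 <= d by rewrite expr2 -[leRHS]mulr1 ler_wpM2l// ltW.
have h7 : 2 * C * d ^+ 2 <= 2 * C * d by rewrite ler_wpM2l// mulr_ge0.
have h8 : 8 * C * b ^+ 2 * d * (p * (1 - p)) <= 8 * C * b ^+ 2 * d.
  by rewrite -[leRHS]mulr1 ler_wpM2l// !mulr_ge0 ?sqr_ge0// ltW.
by move: dL; rewrite /L; lra.
Qed.

End Weierstrass.

(** * Topology of the half-line, supports, and approximation on compact sets *)

Section RplusTopology.
Context {R : realType}.
Implicit Types (A U : set (Rplus R)).

Lemma open_RplusP U : open U <-> exists2 V : set R, open V & @Rval R @^-1` V = U.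
Proof. by split=> -[V oV <-]; exists V. Qed.

Lemma Rval_ge0 (x : Rplus R) : 0 <= Rval x.
Proof. by case: x => x; rewrite /Rval/= inE. Qed.

Lemma continuous_Rval : continuous (@Rval R).
Proof. exact: initial_continuous. Qed.

Lemma measurable_open_Rplus U : open U -> measurable U.
Proof. by move=> oU; exact: sub_sigma_algebra. Qed.

Definition rball (cr : rat * rat) : set (Rplus R) :=
  @Rval R @^-1` (ball (ratr cr.1 : R) (ratr cr.2)).

Lemma open_rball cr : open (rball cr).
Proof. by apply/open_RplusP; exists (ball (ratr cr.1 : R) (ratr cr.2)) => //; exact: ball_open. Qed.

Lemma open_rball_sub U x : open U -> U x -> exists2 cr, rball cr x & rball cr `<=` U.
Proof.
move=> /open_RplusP[V oV <-] Vx.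
have [c [r [/set_mem xB BV]]] := open_subball_rat oV (mem_set Vx).
by exists (c, r) => // y; exact: BV.
Qed.

(** Indexing by naturals makes countable additivity applicable; the empty set fills the codes that
    give no ball with P. *)
Definition rball_seq (P : set (Rplus R) -> Prop) (n : nat) : set (Rplus R) :=
  if unpickle n is Some cr then (if `[< P (rball cr) >] then rball cr else set0)
  else set0.

Lemma rball_seqP (P : set (Rplus R) -> Prop) n :
  rball_seq P n = set0 \/ exists2 cr, rball_seq P n = rball cr & P (rball cr).
Proof.
rewrite /rball_seq; case: unpickle => [cr|]; last by left.
by case: asboolP => Pc; [right; exists cr|left].
Qed.

Lemma bigcup_rball_seq (P : set (Rplus R) -> Prop) :
  \bigcup_n rball_seq P n = \bigcup_(cr in [set cr | P (rball cr)]) rball cr.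
Proof.
apply/seteqP; split=> [x [n _]|x [cr Pcr xcr]].
  have [->//|[cr -> Pcr] xcr] := rball_seqP P n; by exists cr.
exists (pickle cr); first exact: I.
by rewrite /rball_seq pickleK asboolT.
Qed.

Lemma measurable_rball_seq P n : measurable (rball_seq P n).
Proof.
have [->|[cr -> _]] := rball_seqP P n; first exact: measurable0.
by apply: measurable_open_Rplus; exact: open_rball.
Qed.

(** Rational balls form a countable base, so they generate the Borel sets. *)
Lemma sigma_algebra_rball (D : set (set (Rplus R))) :
  sigma_algebra setT D -> (forall cr, D (rball cr)) ->
  forall A, measurable A -> D A.
Proof.
move=> sD Db; apply: smallest_sub => // U oU.
have -> : U = \bigcup_n rball_seq (fun B => B `<=` U) n.
  rewrite bigcup_rball_seq; apply/seteqP; split=> [x Ux|x [cr /= h /h//]].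
  by have [cr xcr crU] := open_rball_sub oU Ux; exists cr.
have [D0 _ DU] := sD; apply: DU => n.
by have [->|[cr -> _]] := rball_seqP (fun B => B `<=` U) n.
Qed.

Section Support.
Variables (H : hilbertType R) (M : semispectral (Rplus R) H).

(** Lindelöf argument: a null open set contains a null rational ball around each of its points, and
    there are only countably many such balls. This is why the complement of the support is null. *)
Lemma setC_supp : ~` supp M = \bigcup_n rball_seq (fun B => M B = 0) n.
Proof.
rewrite bigcup_rball_seq; apply/seteqP; split=> [x|x [cr /= M0 xcr] sx]; last first.
  exact: sx (open_rball cr) xcr M0.
move=> /existsNP[U /not_implyP[oU /not_implyP[Ux /contrapT MU]]].
have [cr xcr crU] := open_rball_sub oU Ux; exists cr => //=.
apply: sspm_null_sub crU MU; apply: measurable_open_Rplus => //.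
exact: open_rball.
Qed.

Lemma measurable_supp : measurable (supp M).
Proof.
rewrite -[supp M]setCK setC_supp; apply: measurableC.
by apply: bigcup_measurable => n _; exact: measurable_rball_seq.
Qed.

Lemma sspm_setC_supp : M (~` supp M) = 0.
Proof.
rewrite setC_supp; apply: sspm_null_bigcup => n.
  exact: measurable_rball_seq.
have [->|[cr -> //]] := rball_seqP (fun B => M B = 0) n.
by apply/(sspm_nullP M measurable0) => h; exact: measure0.
Qed.

Lemma sspm_ae_supp : sspm_ae M (supp M).
Proof.
exists (~` supp M); split=> //; first by apply: measurableC; exact: measurable_supp.
exact: sspm_setC_supp.
Qed.

End Support.

Lemma compact_Rplus_bounded A : compact A ->
  exists2 b : R, 0 < b & forall x, A x -> Rval x <= b.
Proof.
move=> cA; have /compact_bounded[m [mr mP]] : compact (@Rval R @` A).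
  apply: continuous_compact => //; apply: continuous_subspaceT.
  exact: continuous_Rval.
exists (`|m| + 1); first by rewrite ltr_wpDl.
move=> x Ax; rewrite (le_trans (ler_norm _))//; apply: (mP (`|m| + 1)); last by exists x.
by rewrite (le_lt_trans (ler_norm m))// ltrDl.
Qed.

(** Continuity of the restriction to A, phrased for total functions, so that it applies to [ext0 g],
    which may jump at the boundary of A. *)
Definition eps_continuous A (g : Rplus R -> R[i]) := forall x, A x ->
  forall e : R, 0 < e -> exists2 d : R, 0 < d &
  forall y, A y -> `|Rval x - Rval y| < d -> rnorm (g x - g y) < e.

(** Uniform continuity handles close points, and boundedness of g handles distant ones once divided
    by d^2. The quadratic shape lets the second moment of the binomial law do all the work in
    [weierstrass_modulus]. *)
Lemma eps_modulus A g : compact A -> eps_continuous A g ->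
  forall e : R, 0 < e -> exists2 C : R, 0 <= C & forall x y, A x -> A y ->
    rnorm (g x - g y) <= e + C * (Rval x - Rval y) ^+ 2.
Proof.
move=> cA gA e e0; have e2 : 0 < e / 2 by rewrite divr_gt0.
pose good x (d : R) := 0 < d /\ forall y, A y -> `|Rval x - Rval y| < d ->
  rnorm (g x - g y) < e / 2.
have [dl dlP] : exists dl : Rplus R -> R, forall x, A x -> good x (dl x).
  exists (fun x => xget 1 (good x)) => x Ax; apply: (xgetPex 1).
  by have [d d0 dP] := gA x Ax _ e2; exists d.
(* Half radii, as for a Lebesgue number: a point within d of x then still lies in the full ball
   around the center chosen for x. *)
pose f x := @Rval R @^-1` ball (Rval x) (dl x / 2).
have : cover_compact A by rewrite -compact_cover.
move=> /(_ (Rplus R) A f)[|x Ax|D' D'A AD'].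
- by move=> x _; apply/open_RplusP; exists (ball (Rval x) (dl x / 2)) => //;
    exact: ball_open.
- exists x => //; rewrite /f /=; apply: ballxx.
  by have [d0 _] := dlP _ Ax; rewrite divr_gt0.
pose s : seq (Rplus R) := finmap.enum_fset D'.
have {}D'A x : x \in s -> A x by move=> xs; exact: set_mem (D'A x xs).
have {}AD' x : A x -> exists2 z, z \in s & f z x by move=> /AD'[z zD' zx]; exists z.
have [d [d0 dP]] : exists d : R, 0 < d /\ forall x, x \in s -> d <= dl x / 2.
  have : forall x, x \in s -> 0 < dl x / 2.
    by move=> x /D'A/dlP[? _]; rewrite divr_gt0.
  elim: (s) => [|x s' IH] h; first by exists 1.
  have [|d [d0 dP]] := IH; first by move=> y ys; apply: h; rewrite inE ys orbT.
  have dx := h x (mem_head _ _).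
  exists (Num.min d (dl x / 2)); rewrite lt_min d0 dx; split=> // y.
  by rewrite inE ge_min => /predU1P[->|/dP ->//]; rewrite lexx orbT.
have [B [B0 BP]] : exists B : R, 0 <= B /\ forall x, x \in s -> rnorm (g x) <= B.
  elim: s {D'A AD' dP} => [|x s [B [B0 BP]]]; first by exists 0.
  exists (Num.max B (rnorm (g x))); rewrite le_max B0; split=> // y.
  by rewrite inE le_max => /predU1P[->|/BP ->//]; rewrite lexx orbT.
have near x : A x -> exists2 z, z \in s & `|Rval z - Rval x| < dl z / 2.
  by move=> /AD'[z zD' zx]; exists z.
have d2 : 0 < d ^+ 2 by rewrite exprn_gt0.
(* B bounds g at the finitely many centers, so g is at most B + e / 2 on A and any two values differ
   by at most 2 B + e. *)
exists ((2 * B + e) / d ^+ 2).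
  by rewrite divr_ge0 ?sqr_ge0// addr_ge0 ?mulr_ge0// ltW.
move=> x y Ax Ay; have [z zD' zx] := near _ Ax.
have [z0 zP] := dlP z (D'A _ zD').
have gzx : rnorm (g z - g x) < e / 2 by apply: zP => //; lra.
have [xy|xy] := ltP `|Rval x - Rval y| d.
  have gzy : rnorm (g z - g y) < e / 2.
    apply: zP => //; have := ler_normD (Rval z - Rval x) (Rval x - Rval y).
    by rewrite subrKA; have := dP _ zD'; lra.
  have := ler_rnormD (g x - g z) (g z - g y); rewrite subrKA rnormB.
  have : 0 <= (2 * B + e) / d ^+ 2 * (Rval x - Rval y) ^+ 2.
    by rewrite mulr_ge0 ?sqr_ge0// divr_ge0 ?sqr_ge0// addr_ge0 ?mulr_ge0// ltW.
  move: gzx gzy; rewrite (rnormB (g x) (g z)).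
  set a := rnorm _; set a' := rnorm _; set a'' := rnorm (_ - _); lra.
have [z' z'D' z'y] := near _ Ay.
have [z'0 z'P] := dlP z' (D'A _ z'D').
have gz'y : rnorm (g z' - g y) < e / 2 by apply: z'P => //; lra.
have gx : rnorm (g x) <= B + e / 2.
  have := ler_rnormB (g z) (g z - g x); rewrite subKr.
  by have := BP _ zD'; move: gzx; set a := rnorm _; set a' := rnorm _;
    set a'' := rnorm _; lra.
have gy : rnorm (g y) <= B + e / 2.
  have := ler_rnormB (g z') (g z' - g y); rewrite subKr.
  by have := BP _ z'D'; move: gz'y; set a := rnorm _; set a' := rnorm _;
    set a'' := rnorm _; lra.
have h : 2 * B + e <= (2 * B + e) / d ^+ 2 * (Rval x - Rval y) ^+ 2.
  rewrite mulrAC ler_pdivlMr// ler_wpM2l ?addr_ge0 ?mulr_ge0 ?(ltW e0)//.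
  by rewrite -[leRHS]real_normK ?num_real// ler_pXn2r// nnegrE ltW.
have := ler_rnormB (g x) (g y).
move: gx gy h; set a := rnorm _; set a' := rnorm _; set a'' := rnorm _.
set X := _ * _ ^+ 2; lra.
Qed.

Lemma weierstrass A g : compact A -> eps_continuous A g ->
  forall e : R, 0 < e -> exists q : {poly R[i]},
    forall x, A x -> rnorm (g x - polyfun q x) <= e.
Proof.
move=> cA gA e e0.
have [[x0 Ax0]|A0] := pselect (A !=set0); last first.
  by exists 0 => x Ax; exfalso; apply: A0; exists x.
have [b b0 bP] := compact_Rplus_bounded cA.
(* A left inverse of [Rval], with a default value on negative reals, to view g as a function on the
   line. *)
pose lift t : Rplus R := xget point [set x | Rval x = t].
have liftK x : lift (Rval x) = x.
  apply: val_inj.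
  exact: (@xgetPex _ point [set y : Rplus R | Rval y = Rval x] (ex_intro _ x erefl)).
have [|_ [x Ax <-]|e' e'0|q qP] :=
  @weierstrass_modulus R (@Rval R @` A) b (g \o lift) b0 _ _ _ e e0.
- by exists (Rval x0), x0.
- by rewrite Rval_ge0 bP.
- have [C C0 CP] := eps_modulus cA gA e'0; exists C => // _ _ [x Ax <-] [y Ay <-].
  by rewrite /= !liftK; exact: CP.
by exists q => x Ax; have := qP (Rval x); rewrite /= liftK; apply; exists x.
Qed.

End RplusTopology.

(** * The coordinate function and polynomials as elements of L^oo(M) *)

Section RplusFunctions.
Context {R : realType}.

Definition coord : Rplus R -> R[i] := fun x => (Rval x)%:C.

Lemma measurable_Rval : measurable_fun setT (@Rval R).
Proof.
apply: (measurability (@RGenOpens.G R)); first exact: RGenOpens.measurableE.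
move=> _ [_ [x [y ->]] <-]; rewrite setTI; apply: measurable_open_Rplus.
by apply/open_RplusP; exists `]x, y[%classic => //; exact: interval_open.
Qed.

Lemma cmeasurable_coord : cmeasurable coord.
Proof. apply: cmeasurableR; exact: measurable_Rval. Qed.

Lemma cmeasurable_horner (f : Rplus R -> R[i]) (q : {poly R[i]}) :
  cmeasurable f -> cmeasurable (fun x => q.[f x]).
Proof.
move=> mf; elim/poly_ind: q => [|q c IH].
  have -> : (fun x => (0 : {poly R[i]}).[f x]) = fun=> 0.
    by apply/funext => x; rewrite horner0.
  exact: (bdd_cst _ 0).1.
have -> : (fun x => (q * 'X + c%:P).[f x]) =
    1 *: (fun x => q.[f x] * f x) + (fun=> c).
  by apply/funext => x; rewrite fct_linE hornerMXaddC mul1r.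
by apply: cmeasurable_lin; [exact: cmeasurableM|exact: (bdd_cst _ c).1].
Qed.

Lemma polyfunE (q : {poly R[i]}) : polyfun q = fun x => q.[coord x].
Proof. by []. Qed.

Lemma cmeasurable_polyfun (q : {poly R[i]}) : cmeasurable (polyfun q).
Proof. by apply: cmeasurable_horner; exact: cmeasurable_coord. Qed.

Lemma rnorm_coord x : rnorm (coord x) = Rval x.
Proof. by rewrite rnormR ger0_norm ?Rval_ge0. Qed.

Lemma bdd_ctrunc_coord (b : R) : 0 < b -> bdd_mfun (ctrunc coord b).
Proof. by move=> b0; apply: bdd_ctrunc; [exact: cmeasurable_coord|exact: ltW]. Qed.

Lemma ctrunc_coordE (b : R) x : Rval x <= b -> ctrunc coord b x = coord x.
Proof.
move=> xb; rewrite /ctrunc /cindic indicE mem_set ?mulr1//=.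
by rewrite rnorm_coord; apply/negP; rewrite -leNgt.
Qed.

Section LinfSupp.
Variables (H : hilbertType R) (M : semispectral (Rplus R) H).
Hypothesis cM : compact (supp M).

Lemma sspm_null_supp (P : set (Rplus R)) : measurable P ->
  (forall x, supp M x -> ~ P x) -> M P = 0.
Proof.
move=> mP sP; apply: sspm_null_sub (sspm_setC_supp M) => //.
  by apply: measurableC; exact: measurable_supp.
by move=> x Px sx; exact: sP Px.
Qed.

Lemma Linf_supp (f : Rplus R -> R[i]) c : cmeasurable f -> 0 <= c ->
  (forall x, supp M x -> rnorm (f x) <= c) -> Linf M f /\ Linf_norm M f <= c.
Proof.
move=> mf c0 fc; have h : M [set x | c < rnorm (f x)] = 0.
  apply: sspm_null_supp; first exact: measurable_rnorm_gt.
  by move=> x /fc /= xc; apply/negP; rewrite -leNgt.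
by split; [split=> //; exists c|exact: Linf_norm_le].
Qed.

Lemma sspm_ae_on_supp (P : set (Rplus R)) : supp M `<=` P -> sspm_ae M P.
Proof. by move=> sP; apply: sspm_ae_sub sP (sspm_ae_supp M). Qed.

Lemma opint_supp (f g : Rplus R -> R[i]) : cmeasurable f -> cmeasurable g ->
  (forall x, supp M x -> f x = g x) -> opint M f = opint M g.
Proof. by move=> mf mg fg; apply: opint_ae => //; exact: sspm_ae_on_supp. Qed.

Lemma rnorm_polyfun_le (q : {poly R[i]}) : exists2 c : R, 0 <= c &
  forall x, supp M x -> rnorm (polyfun q x) <= c.
Proof.
have [b b0 bP] := compact_Rplus_bounded cM.
elim/poly_ind: q => [|q a [c c0 cP]].
  by exists 0 => // x _; rewrite /polyfun horner0 rnorm0.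
exists (c * b + rnorm a) => [|x sx].
  by rewrite addr_ge0 ?mulr_ge0 ?rnorm_ge0// ltW.
rewrite /polyfun hornerMXaddC (le_trans (ler_rnormD _ _))// lerD2r rnormM.
by apply: ler_pM; rewrite ?rnorm_ge0 ?cP// -/(coord x) rnorm_coord bP.
Qed.

Lemma Linf_polyfun (q : {poly R[i]}) : Linf M (polyfun q).
Proof.
have [c c0 cP] := rnorm_polyfun_le q.
by have [] := Linf_supp (cmeasurable_polyfun q) c0 cP.
Qed.

End LinfSupp.

End RplusFunctions.

(** * Subspaces invariant under the integral of the coordinate function *)

Section InvariantSubspace.
Context {R : realType} (K : hilbertType R) (E : semispectral (Rplus R) K).
Hypothesis Emul : forall A B, measurable A -> measurable B ->
  E (A `&` B) = E A \o E B.
Hypothesis ET : E setT = id.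
Hypothesis cE : compact (supp E).

Variable W : set K.
Hypothesis clW : closed W.
Hypothesis W0 : W 0.
Hypothesis WP : forall (a : R[i]) w w', W w -> W w' -> W (a *: w + w').
Hypothesis WS : forall w, W w -> W (opint E (@coord R) w).

Lemma closed_approx w :
  (forall e : R, 0 < e -> exists2 w', W w' & rnorm (w - w') < e) -> W w.
Proof.
move=> h; have /choice[u uP] : forall n : nat, exists w',
    W w' /\ rnorm (w - w') < n.+1%:R^-1.
  by move=> n; have [|w' Ww' ww'] := h n.+1%:R^-1; [rewrite invr_gt0|exists w'].
have uw : u @ \oo --> w.
  apply/cvgn_rnormP => e e0.
  have [N _ NP] := near_infty_natSinv_lt (PosNum e0); exists N => n /NP.
  by apply: lt_trans; exact: (uP n).2.
apply: (closed_cvg _ clW _ _ uw); apply: nearW => n; exact: (uP n).1.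
Qed.

Lemma invariant_polyfun (q : {poly R[i]}) w : W w -> W (opint E (polyfun q) w).
Proof.
move=> Ww; have [b b0 bP] := compact_Rplus_bounded cE.
(* The coordinate is unbounded on the half-line. Truncated at a bound of the support it has the same
   integral and enters the bounded calculus. *)
have bt := bdd_ctrunc_coord b0.
have SE : opint E (@coord R) = opint E (ctrunc coord b).
  apply: opint_supp; [exact: cmeasurable_coord|exact: bt.1|].
  by move=> x /bP xb; rewrite ctrunc_coordE.
have [bq qE] := opint_horner Emul ET q bt.
rewrite (@opint_supp _ _ _ _ (fun x => q.[ctrunc coord b x])).
- rewrite qE fct_sumE; elim/big_ind: _ => //.
    by move=> x y Wx Wy; rewrite -[x]scale1r; exact: WP.
  move=> i _; rewrite -[(_ *: _) w]addr0; apply: WP => //; rewrite -SE.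
  by elim: (nat_of_ord i) => [//|n IH]; exact: WS.
- exact: cmeasurable_polyfun.
- exact: bq.1.
- by move=> x /bP xb; rewrite polyfunE ctrunc_coordE.
Qed.

Lemma invariant_continuous g w : bdd_mfun g -> eps_continuous (supp E) g ->
  W w -> W (opint E g w).
Proof.
move=> bg cg Ww; apply: closed_approx => e e0.
have w1 : 0 < rnorm w + 1 by rewrite ltr_wpDl ?rnorm_ge0.
have [q qP] := weierstrass cE cg (divr_gt0 e0 w1).
exists (opint E (polyfun q) w); first exact: invariant_polyfun.
have Lq := Linf_polyfun cE q; have Lg := bdd_Linf E bg.
have := opint_Linf_lin (-1) Lq Lg; rewrite !scaleN1r addrC [RHS]addrC => gq.
have -> : opint E g w - opint E (polyfun q) w = opint E (g - polyfun q) w.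
  by rewrite gq.
have [||| Lgq nle] := @Linf_supp _ _ E (g - polyfun q) (e / (rnorm w + 1)).
- by rewrite addrC -scaleN1r; apply: cmeasurable_lin; [exact: cmeasurable_polyfun|exact: bg.1].
- by rewrite divr_ge0 ?ltW.
- exact: qP.
rewrite (le_lt_trans (rnorm_opint_Linf Emul ET w Lgq))//.
rewrite (le_lt_trans (ler_wpM2r (rnorm_ge0 w) nle))//.
by rewrite mulrAC ltr_pdivrMr// ltr_pM2l// ltrDl.
Qed.

(** Continuous functions increasing with n to the indicator of the open ball: for n > 0 the value is
    1 where r - |x - c| >= 1 / n. *)
Definition bump (c r : R) (n : nat) (x : R) : R :=
  Num.min 1 (n%:R * Num.max 0 (r - `|x - c|)).

Lemma bump01 c r n x : 0 <= bump c r n x <= 1.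
Proof.
rewrite /bump ge_min lexx le_min ler01 mulr_ge0//.
by rewrite le_max lexx.
Qed.

Lemma continuous_bump c r n : continuous (bump c r n).
Proof.
have cg : continuous (fun y : R => r - `|y - c|).
  move=> x; apply: cvgB; first exact: cvg_cst.
  by apply: cvg_norm; apply: cvgB; [exact: cvg_id|exact: cvg_cst].
have c0 (a : R) : continuous (fun _ : R => a) by move=> x; exact: cvg_cst.
have cm := max_fun_continuous (c0 0) cg.
have cn : continuous (fun y : R => n%:R * ((fun=> 0) \max (fun y => r - `|y - c|)) y).
  by move=> x; apply: cvgM; [exact: cvg_cst|exact: cm].
exact: (min_fun_continuous (c0 1) cn).
Qed.

Lemma cvg_bump c r x :
  (fun n => bump c r n x) @ \oo --> ((`|x - c| < r)%R%:R : R).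
Proof.
case: ltP => [|xr]; last first.
  apply: cvg_near_cst; apply: nearW => n.
  by rewrite /bump max_l ?subr_le0// mulr0 min_r.
rewrite -subr_gt0 => xr; apply: cvg_near_cst.
have [N _ NP] := near_infty_natSinv_lt (PosNum xr).
exists N.+1 => // -[//|n] /= Nn; apply/eqP.
rewrite /bump max_r ?ltW// min_l//.
have := NP n Nn => /= /ltW h.
by rewrite -ler_pdivrMl// mulr1.
Qed.

Lemma indic_rball cr (x : Rplus R) :
  \1_(rball cr) x = (`|Rval x - ratr cr.1| < ratr cr.2)%R%:R :> R.
Proof.
rewrite indicE; congr (_%:R); congr nat_of_bool.
by apply/idP/idP => [/set_mem|h]; [|apply/mem_set];
  rewrite /rball/ball/= distrC.
Qed.

Lemma invariant_rball cr w : W w -> W (E (rball cr) w).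
Proof.
move=> Ww; set c : R := ratr cr.1; set r : R := ratr cr.2.
pose f n (x : Rplus R) : R := bump c r n (Rval x).
have mf n : measurable_fun setT (f n).
  apply: measurableT_comp; last exact: measurable_Rval.
  by apply: continuous_measurable_fun; exact: continuous_bump.
have mB : measurable (rball cr : set (Rplus R)).
  by apply: measurable_open_Rplus; exact: open_rball.
have bf n : bdd_mfun (fun x => (f n x)%:C).
  split; first exact: cmeasurableR.
  exists 1 => x; have /andP[f0 f1] := bump01 c r n (Rval x).
  by rewrite rnormR ger0_norm.
have Wf n : W (opint E (fun x => (f n x)%:C) w).
  apply: invariant_continuous => // x _ e e0.
  have /cvgrPdist_lt/(_ e e0)/nbhs_normP[d d0 dP] := @continuous_bump c r n (Rval x).
  exists d => // y _ xy; rewrite -rmorphB/= rnormR; exact: dP.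
apply: closed_approx => e e0.
pose h n (x : Rplus R) : R := (\1_(rball cr) x - f n x) ^+ 2.
(* The squared distance between the vectors is the integral of the squared difference of the
   functions, which tends to 0 by dominated convergence with the constant 1. *)
have hmu n : rnorm (E (rball cr) w - opint E (fun x => (f n x)%:C) w) ^+ 2 =
    \int[sspm_diag E w]_x h n x.
  rewrite -(opint_indic E mB).
  have -> : opint E (cindic (rball cr)) w - opint E (fun x => (f n x)%:C) w =
      opint E (-1 *: (fun x => (f n x)%:C) + cindic (rball cr)) w.
    rewrite (opint_lin E (-1) (bf n) (bdd_cindic mB)).
    rewrite -[RHS]/(-1 *: opint E (fun x => (f n x)%:C) w + opint E (cindic (rball cr)) w).
    by rewrite scaleN1r addrC.
  have bd : bdd_mfun (-1 *: (fun x => (f n x)%:C) + cindic (rball cr)).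
    by apply: bdd_mfun_lin => //; exact: bdd_cindic.
  rewrite -Re_hdot_rnorm (opint_sqr Emul _ bd)/=; congr fine.
  apply: eq_integral => x _; congr EFin.
  rewrite /h; ring.
have mh n : measurable_fun setT (h n).
  rewrite /h; under eq_fun do rewrite expr2.
  by apply: measurable_funM; apply: measurable_funB => //; exact: measurable_indic.
have hE n x : 0 <= h n x <= 1.
  have /andP[f0 f1] := bump01 c r n (Rval x).
  have i01 : 0 <= (\1_(rball cr) x : R) <= 1.
    by rewrite indicE; case: (_ \in _); rewrite ?lexx ler01.
  have /andP[i0 i1] := i01.
  rewrite /h sqr_ge0/= -real_normK ?num_real// expr_le1//.
  by rewrite ler_norml; apply/andP; rewrite /f; split; lra.
have h0 x : (fun n => h n x) @ \oo --> (0 : R).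
  rewrite -[0 : R](mul0r 0) -(subrr (\1_(rball cr) x)) /h.
  under eq_fun do rewrite expr2.
  have cf : (fun n => \1_(rball cr) x - f n x) @ \oo -->
      (\1_(rball cr) x - \1_(rball cr) x : R).
    apply: cvgB; first exact: cvg_cst.
    by rewrite [X in _ --> X]indic_rball; exact: cvg_bump.
  exact: cvgM.
have cv : (fun n => \int[sspm_diag E w]_x h n x) @ \oo --> (0 : R).
  apply: fine_cvg.
  rewrite (_ : 0%:E = \int[sspm_diag E w]_(x in setT) (0%:E : \bar R))%E; last first.
    by rewrite integral0.
  apply: (@dominated_cvg _ _ _ (sspm_diag E w) setT measurableT
    (fun n x => (h n x)%:E) (cst 0%:E) (cst 1%:E)).
  - by move=> n; apply/measurable_EFinP.
  - by move=> x _; apply: cvg_EFin; [exact: nearW|exact: h0].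
  - by [].
  - apply: (@bdd_integrable _ _ _ _ (sspm_diag_fin E w) (cst 1) 1).
      exact: measurable_cst.
    by move=> x; rewrite normr1.
  - move=> n x _; have /andP[h1 h2] := hE n x.
    by rewrite /= lee_fin ger0_norm.
have e2 : 0 < e ^+ 2 by rewrite exprn_gt0.
have /cvgrPdist_lt/(_ _ e2)[N _ /(_ N (leqnn N)) NP] := cv.
exists (opint E (fun x => (f N x)%:C) w); first exact: Wf.
rewrite -(@ltr_pXn2r _ 2)// ?nnegrE ?rnorm_ge0 ?ltW// hmu.
by move: NP; rewrite /= sub0r normrN; apply: le_lt_trans; exact: ler_norm.
Qed.

(** The measurable sets whose projection preserves W form a sigma-algebra: E(~B) = 1 - E(B),
    projections multiply on intersections, and countable unions are strong limits of finite ones. *)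
Lemma invariant_sspm A w : measurable A -> W w -> W (E A w).
Proof.
move=> mA Ww.
pose D := [set A | measurable A /\ forall w, W w -> W (E A w)].
suff : D A by move=> [_]; exact.
apply: sigma_algebra_rball mA; last first.
  move=> cr; split; last by move=> w'; exact: invariant_rball.
  by apply: measurable_open_Rplus; exact: open_rball.
have E0 : E set0 = 0 by exact: sspm0.
have DC B : D B -> D (~` B).
  move=> [mB WB]; split; [exact: measurableC|move=> v Wv].
  have mBC := measurableC mB.
  have -> : E (~` B) v = (-1) *: E B v + v.
    have := sspmU E mB mBC (setICr B); rewrite setUCr ET => /(congr1 (fun A => A v)).
    rewrite -[X in _ = X]/(E B v + E (~` B) v) /= => vE.
    by apply: (addrI (E B v)); rewrite -vE scaleN1r addrA subrr add0r.
  by apply: WP => //; exact: WB.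
have DI B C : D B -> D C -> D (B `&` C).
  move=> [mB WB] [mC WC]; split; [exact: measurableI|move=> v Wv].
  by rewrite Emul//; apply: WB; exact: WC.
split; first by split=> // v _; rewrite E0.
  by move=> B DB; rewrite setTD; exact: DC.
move=> F DF.
have DU n : D (\big[setU/set0]_(i < n) F i).
  elim: n => [|n IH]; first by rewrite big_ord0; split=> // v _; rewrite E0.
  rewrite big_ord_recr/= -[_ `|` _]setCK setCU; apply: (DC).
  by apply: DI; [exact: DC IH|exact: DC (DF n)].
pose B n := \big[setU/set0]_(i < n) F i.
have mF n : measurable (F n) by case: (DF n).
have mB n : measurable (B n) by case: (DU n).
have mU : measurable (\bigcup_n F n) by exact: bigcup_measurable.
have BU n : B n `<=` \bigcup_n F n by exact: bigsetU_bigcup.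
split=> // v Wv; apply: closed_approx => e e0.
pose G n := \bigcup_n F n `\` B n.
have mG n : measurable (G n) by exact: measurableD.
have nE n : rnorm (E (\bigcup_n F n) v - E (B n) v) ^+ 2 = fine (sspm_diag E v (G n)).
  have -> : E (\bigcup_n F n) v - E (B n) v = E (G n) v.
    have -> : E (\bigcup_n F n) = E (B n) + E (G n).
      by rewrite -sspmU ?setDUK// /G setDIK.
    by rewrite -[(_ + _) v]/(E (B n) v + E (G n) v) addrC addKr.
  rewrite -Re_hdot_rnorm -(nonneg_sym (sspm_bounded E (mG n)) (sspm_ge0 E (mG n))).
  rewrite -[X in hdot X _]/((E (G n) \o E (G n)) v) -Emul// setIid.
  by rewrite sspm_hdot.
(* The remainders [G n] decrease to the empty set, so continuity from above of a finite measure
   gives the strong limit. *)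
have cv : sspm_diag E v \o G @ \oo --> (0%:E : \bar R).
  rewrite (_ : 0%:E = (sspm_diag E v : {measure set _ -> \bar R}) (\bigcap_n G n)).
    apply: nonincreasing_cvg_mu => //.
    - by rewrite (le_lt_trans _ (sspm_diag_fin E v))// le_measure ?inE//.
    - exact: bigcapT_measurable.
    - move=> m n mn; apply/subsetPset; apply: setDS.
      exact: subset_bigsetU.
  rewrite (_ : \bigcap_n G n = set0) ?measure0//.
  apply/seteqP; split=> // x Gx; have [[n _ Fx] _] := Gx 0%N I.
  have [_ nB] := Gx n.+1 I; apply: nB; rewrite /B big_ord_recr; by right.
have e2 : 0 < e ^+ 2 by rewrite exprn_gt0.
have /fine_cvg/cvgrPdist_lt/(_ _ e2)[N _ /(_ N (leqnn N)) NP] := cv.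
exists (E (B N) v); first by case: (DU N) => _; exact.
rewrite -(@ltr_pXn2r _ 2)// ?nnegrE ?rnorm_ge0 ?ltW// nE.
by move: NP; rewrite /= sub0r normrN; apply: le_lt_trans; exact: ler_norm.
Qed.

End InvariantSubspace.

(** * Integrals through the dilation *)

Section DilationIntegral.
Context {R : realType} d (T : measurableType d) (H : hilbertType R).
Variable M : semispectral T H.
Local Notation E := (dil_sspm M).
Local Notation A := (dil_map M).

Lemma Linf_is_opint (K : hilbertType R) (N : semispectral T K) f :
  Linf N f -> is_opint N f (opint N f).
Proof.
move=> Lf; have [g bg [[Z [mZ Z0 fgZ]] ->]] := Linf_opint Lf.
have [[bog hg] _] := bdd_opintP N bg; split=> // h; rewrite hg.
apply/esym; exact: (ae_eq_cint (proj1 Lf) (proj1 bg) mZ ((sspm_nullP N mZ).1 Z0 h) fgZ).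
Qed.

Lemma sspm_diag_dil h : sspm_diag E (A h) = sspm_diag M h.
Proof.
apply/funext => B; rewrite /sspm_diag; case: asboolP => // mB.
by rewrite hdot_dil_map.
Qed.

(** The scalar measures of [E] at the image of h and of [M] at h are equal, so both operators have
    the same diagonal. *)
Lemma opint_dil f : Linf M f -> Linf E f ->
  opint M f = adj A \o opint E f \o A.
Proof.
move=> LM LE; apply: is_opint_opint; split.
  apply: bounded_op_comp; last exact: bounded_dil_map.
  apply: bounded_op_comp; last exact: bounded_Linf_opint.
  exact: bounded_adj (bounded_dil_map M).
move=> h /=; rewrite hdot_adjC; last exact: bounded_dil_map.
have [_ ->] := Linf_is_opint LE.
congr Complex; congr fine; apply: eq_measure_integral => B mB _;
  exact: (congr1 (fun m => m B) (sspm_diag_dil h)).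
Qed.

(** If [M B] vanishes, so does the form cut down to B, and the projection kills every embedded
    vector. Equality of null sets is what transfers L^oo(M) and the support to [E]. *)
Lemma dil_null B : measurable B -> E B = 0 <-> M B = 0.
Proof.
move=> mB; split=> [EB|MB].
  apply/funext => h; apply: hdot_ext => k.
  rewrite -hdot_dil_map//.
  have -> : dil_proj B (dil_map M h) = 0 by exact: (congr1 (fun P => P _) EB).
  by rewrite !hdot0l.
apply/funext => F; have [u uF] := hcompl_emb_dense F.
have := cvgn_op (bounded_dil_proj M B) uF.
have -> : (fun n => dil_proj B (hcompl_emb (u n))) = fun=> (0 : dil_space M).
  apply/funext => n; apply: hcompl_ext => w.
  rewrite dil_proj_emb//= dil_sum_cut// /dil_sum big1// => x _.
  rewrite big1// => y _; rewrite /dil_ker.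
  rewrite (@sspm_null_sub _ _ _ _ M _ B)//; first by rewrite hdot0l.
  by apply: measurableI => //; apply: measurableI; exact: measurable_mset.
by move=> h; rewrite -[LHS](cvgn_unique (cvg_cst 0) h).
Qed.

Lemma dil_Linf f : Linf M f -> Linf E f.
Proof.
move=> [mf [a a0 fa]]; split=> //; exists a => //.
by apply/dil_null => //; exact: measurable_rnorm_gt.
Qed.

Lemma dil_Linf_norm f : Linf M f -> Linf_norm E f = Linf_norm M f.
Proof.
move=> [mf _]; congr inf; apply/seteqP; split=> a [a0 h]; split=> //;
  by apply/dil_null => //; exact: measurable_rnorm_gt.
Qed.

Lemma dil_sspmI B C : measurable B -> measurable C -> E (B `&` C) = E B \o E C.
Proof. exact: dil_projI. Qed.

(** The vector k = (int f dM) h is paired with itself: with V = [dil_map M], |k|^2 is at most the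
    norm of f times |V h| |V k|, and |V x|^2 <= |M(setT)| |x|^2; dividing by |k| leaves the constant
    1. *)
Lemma rnorm_opint_semispectral f h : Linf M f ->
  rnorm (opint M f h) <= Linf_norm M f * opnorm (M setT) * rnorm h.
Proof.
move=> LM; have LE := dil_Linf LM.
have bT := sspm_bounded M measurableT.
have [c0 cP] := opnorm_bound bT.
have Ab k : rnorm (A k) ^+ 2 <= opnorm (M setT) * rnorm k ^+ 2.
  have := hdot_dil_map M k k measurableT; rewrite dil_projT => /(congr1 (@complex.Re R)).
  rewrite Re_hdot_rnorm => ->; rewrite (le_trans (ler_norm _))//.
  rewrite (le_trans (ler_Re_rnorm _))// (le_trans (cauchy_schwarz _ _))//.
  by rewrite expr2 mulrA ler_wpM2r ?rnorm_ge0.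
have n0 := Linf_norm_ge0 LM.
set k := opint M f h; set n := Linf_norm M f in n0 *; set c := opnorm _ in c0 Ab cP *.
have [k0|k0] := eqVneq (rnorm k) 0.
  by rewrite k0 !mulr_ge0// rnorm_ge0.
have kp : 0 < rnorm k by rewrite lt_def k0 rnorm_ge0.
have : rnorm k ^+ 2 <= n * (rnorm (A h) * rnorm (A k)).
  rewrite -Re_hdot_rnorm {1}/k (opint_dil LM LE)/= hdot_adjC; last exact: bounded_dil_map.
  rewrite (le_trans (ler_norm _))// (le_trans (ler_Re_rnorm _))//.
  rewrite (le_trans (cauchy_schwarz _ _))// mulrA ler_wpM2r ?rnorm_ge0//.
  rewrite /n -dil_Linf_norm//; apply: rnorm_opint_Linf => //.
    exact: dil_sspmI.
  exact: dil_projT.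
have : rnorm (A h) * rnorm (A k) <= c * rnorm h * rnorm k.
  rewrite -(@ler_pXn2r _ 2)// ?nnegrE ?mulr_ge0 ?rnorm_ge0//.
  rewrite !exprMn (le_trans (ler_pM _ _ (Ab h) (Ab k)))// ?sqr_ge0//.
  by rewrite expr2; lra.
move=> h1 h2; have := le_trans h2 (ler_wpM2l n0 h1).
by rewrite expr2 !mulrA ler_pM2r.
Qed.

Lemma opnorm_opint_le f : Linf M f ->
  opnorm (opint M f) <= Linf_norm M f * opnorm (M setT).
Proof.
move=> LM; apply: opnorm_le; split=> [|h]; last exact: rnorm_opint_semispectral.
rewrite mulr_ge0 ?Linf_norm_ge0//; apply: opnorm_ge0.
exact: sspm_bounded.
Qed.

End DilationIntegral.

(** * Linear spans and their closures *)

Section LinearSpan.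
Context {R : realType} (V : hilbertType R).
Implicit Types (X : set V) (x y : V).

Lemma lspan_incl X x : X x -> lspan X x.
Proof.
by move=> Xx; exists 1%N, (fun=> 1), (fun=> x); rewrite big_ord1 scale1r.
Qed.

Lemma lspan0 X : lspan X 0.
Proof.
exists 0%N, (fun=> 0), (fun=> 0); split; last by rewrite big_ord0.
by case.
Qed.

Lemma lspan_lin X a x y : lspan X x -> lspan X y -> lspan X (a *: x + y).
Proof.
move=> [m [c [v [vX ->]]]] [n [c' [v' [vX' ->]]]].
exists (m + n)%N, (fun i => match fintype.split i with inl j => a * c j | inr j => c' j end),
  (fun i => match fintype.split i with inl j => v j | inr j => v' j end); split.
  by move=> i; case: fintype.split.
rewrite big_split_ord/= scaler_sumr; congr (_ + _).
  apply: eq_bigr => i _; rewrite scalerA.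
  by rewrite (unsplitK (inl i : 'I_m + 'I_n)%type).
by apply: eq_bigr => i _; rewrite (unsplitK (inr i : 'I_m + 'I_n)%type).
Qed.

Lemma lspan_image X (S : V -> V) x : linear S -> (forall y, X y -> X (S y)) ->
  lspan X x -> lspan X (S x).
Proof.
move=> lS XS [n [c [v [vX ->]]]]; exists n, c, (S \o v); split.
  by move=> i; exact: XS.
rewrite (big_morph S (linear_D lS) (linear_0 lS)).
by apply: eq_bigr => i _; rewrite (linear_Z lS).
Qed.

Lemma closure_rnormP X x : closure X x <->
  forall e : R, 0 < e -> exists2 y, X y & rnorm (x - y) < e.
Proof.
split=> [cx e e0|h B /nbhs_normP[r /gtc0_Re[e0 rE] eB]].
  have : nbhs x [set y | rnorm (x - y) < e].
    apply/nbhs_normP; exists e%:C; first by rewrite /= ltcR.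
    by move=> y; rewrite /ball_/= -rnormE ltcR.
  by move=> /cx[y [Xy xy]]; exists y.
have [y Xy xy] := h _ e0; exists y; split=> //.
by apply: eB; rewrite /ball_/= -rnormE -rE ltcR.
Qed.

Lemma closure_lspan_lin X a x y : closure (lspan X) x -> closure (lspan X) y ->
  closure (lspan X) (a *: x + y).
Proof.
move=> /closure_rnormP cx /closure_rnormP cy; apply/closure_rnormP => e e0.
have a0 : 0 < 2 * (rnorm a + 1) by rewrite mulr_gt0// ltr_wpDl ?rnorm_ge0.
have e2 : 0 < e / 2 by rewrite divr_gt0.
have [x' Xx' xx'] := cx _ (divr_gt0 e0 a0).
have [y' Xy' yy'] := cy _ e2.
exists (a *: x' + y'); first exact: lspan_lin.
rewrite opprD addrACA -scalerBr (le_lt_trans (ler_rnormD _ _))// rnormZ.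
rewrite ltr_pdivlMr// in xx'.
have := rnorm_ge0 a; have := rnorm_ge0 (x - x'); nra.
Qed.

Lemma closure_lspan_image X (S : V -> V) x : bounded_op S ->
  (forall y, X y -> X (S y)) -> closure (lspan X) x -> closure (lspan X) (S x).
Proof.
move=> bS XS /closure_rnormP cx; apply/closure_rnormP => e e0.
have [lS [c [c0 cP]]] := (bounded_opP _).1 bS.
have c1 : 0 < c + 1 by rewrite ltr_wpDl.
have [y Xy xy] := cx _ (divr_gt0 e0 c1).
exists (S y); first exact: lspan_image.
rewrite -(linear_B lS) (le_lt_trans (cP _))//.
rewrite ltr_pdivlMr// in xy; have := rnorm_ge0 (x - y); nra.
Qed.

End LinearSpan.

(** * The operator S of the dilation and its cyclic vectors *)

Section DilationRplus.
Context {R : realType} (H : hilbertType R).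
Variable M : semispectral (Rplus R) H.
Hypothesis cM : compact (supp M).
Local Notation E := (dil_sspm M).
Local Notation A := (dil_map M).

Lemma supp_dil : supp E = supp M.
Proof.
apply/seteqP; split=> x sx U oU Ux; move: (sx U oU Ux); apply: contra_not => U0;
  by apply/dil_null => //; exact: measurable_open_Rplus.
Qed.

Let cE : compact (supp E). Proof. by rewrite supp_dil. Qed.

Lemma Linf_coord (K : hilbertType R) (N : semispectral (Rplus R) K) :
  compact (supp N) -> Linf N (@coord R).
Proof.
move=> cN; have [b b0 bP] := compact_Rplus_bounded cN.
have [] // := @Linf_supp _ _ N (@coord R) b (@cmeasurable_coord R) (ltW b0).
by move=> x sx; rewrite rnorm_coord bP.
Qed.

Definition dil_op : dil_space M -> dil_space M := opint E (@coord R).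

Lemma dil_op_spectral : spectral_measure_of dil_op E.
Proof.
split; [exact: dil_projT| |exact: cE|exact: Linf_is_opint (Linf_coord cE)].
by move=> B mB; rewrite -dil_sspmI// setIid.
Qed.

Lemma bounded_dil_op : bounded_op dil_op.
Proof. exact: bounded_Linf_opint (Linf_coord cE). Qed.

Lemma dil_op_ge0 : nonneg_op dil_op.
Proof.
apply: opint_ge0; first exact: Linf_coord cE.
exists set0; split; [exact: measurable0|exact: sspm0|].
by move=> x /=; apply; rewrite /coord ler0c Rval_ge0.
Qed.

Lemma dil_op_cyclic :
  closure (lspan (\bigcup_n [set iter n dil_op (A h) | h in setT])) = setT.
Proof.
set X := \bigcup_n _; apply: dil_dense.
- exact: closed_closure.
- exact/subset_closure/lspan0.
- by move=> F G WF WG; rewrite -[F]scale1r; exact: closure_lspan_lin.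
have linW (a : R[i]) F G : closure (lspan X) F -> closure (lspan X) G ->
    closure (lspan X) (a *: F + G) by exact: closure_lspan_lin.
have W0 : closure (lspan X) 0 by exact/subset_closure/lspan0.
have WS F : closure (lspan X) F -> closure (lspan X) (dil_op F).
  apply: closure_lspan_image; first exact: bounded_dil_op.
  by move=> _ [n _ [k _ <-]]; exists n.+1 => //; exists k.
move=> B h mB; apply: (@invariant_sspm _ _ E (@dil_sspmI _ _ _ _ M) (@dil_projT _ _ _ _ M) cE
  _ (@closed_closure _ _) W0 linW WS) => //.
(* The power n = 0 already provides the images of [dil_map]; invariance under [E] then yields the
   vectors that span densely. *)
by apply: subset_closure; apply: lspan_incl; exists 0%N => //; exists h.
Qed.

End DilationRplus.

(** * Hereditary calculus and the representation formula *)

Section Hereditary.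
Context {R : realType} (H : hilbertType R) (T : H -> H).
Hypothesis bT : bounded_op T.

Lemma fct_addE (X : Type) (V : zmodType) (f g : X -> V) x : (f + g) x = f x + g x.
Proof. by []. Qed.

Lemma fct_scaleE (X : Type) (V : lmodType R[i]) a (f : X -> V) x :
  (a *: f) x = a *: f x.
Proof. by []. Qed.

(** Padding with zero coefficients gives polynomials of different sizes a common index range. *)
Lemma hereditary_wide n (p : {poly R[i]}) : (size p <= n)%N ->
  hereditary T p = \sum_(i < n) p`_i *: (iter i (adj T) \o iter i T).
Proof.
move=> pn.
rewrite /hereditary (big_ord_widen n (fun i => p`_i *: (iter i (adj T) \o iter i T)) pn).
rewrite big_mkcond; apply: eq_bigr => i _.
by case: ltnP => // /(nth_default 0) ->; rewrite scale0r.
Qed.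

Lemma hereditary_lin a (p q : {poly R[i]}) :
  hereditary T (a *: p + q) = a *: hereditary T p + hereditary T q.
Proof.
pose n := maxn (size (a *: p + q)) (maxn (size p) (size q)).
rewrite !(@hereditary_wide n) ?leq_max ?leqnn ?orbT//.
rewrite scaler_sumr -big_split; apply: eq_bigr => i _ /=.
by rewrite coefD coefZ scalerDl scalerA.
Qed.

(** The hereditary calculus is not multiplicative in general, but a factor X wraps the operator
    between [adj T] and [T]. This is where the operators T^{*j} B_2(T) T^j come from. *)
Lemma hereditary_mulX (p : {poly R[i]}) :
  hereditary T (p * 'X) = adj T \o hereditary T p \o T.
Proof.
have [la _] := bounded_adj bT.
rewrite (@hereditary_wide (size p).+1); last first.
  by have [->|p0] := eqVneq p 0; rewrite ?mul0r ?size_poly0// size_mulX.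
rewrite big_ord_recl coefMX eqxx scale0r add0r; apply/funext => h /=.
rewrite /hereditary !fct_sumE (big_morph _ (linear_D la) (linear_0 la)).
apply: eq_bigr => i _; rewrite coefMX/= !fct_scaleE (linear_Z la)/=.
by rewrite -iterSr.
Qed.

Lemma hereditary_mulXn (p : {poly R[i]}) n :
  hereditary T (p * 'X^n) = iter n (adj T) \o hereditary T p \o iter n T.
Proof.
elim: n => [|n IH]; first by rewrite expr0 mulr1.
by rewrite exprSr mulrA hereditary_mulX IH; apply/funext => h /=; rewrite -iterSr.
Qed.

Lemma hereditary_X1sqr : hereditary T (('X - 1) ^+ 2) = B2 T.
Proof.
have h1 : hereditary T 1 = id.
  by rewrite /hereditary size_polyC oner_eq0 big_ord1 coefC eqxx scale1r.
have -> : ('X - 1) ^+ 2 = (- 2%:R) *: (1 * 'X) + (1 * 'X * 'X + 1) :> {poly R[i]}.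
  by rewrite scaleNr scaler_nat; ring.
rewrite !(hereditary_lin _ _ _) -[1 * 'X * 'X]scale1r hereditary_lin.
rewrite !hereditary_mulX h1; apply/funext => h.
rewrite !(fct_addE, fct_scaleE)/= /B2 scale1r scaleNr.
by rewrite addrA addrC addrA.
Qed.

Lemma hereditary_mul_sum (p : {poly R[i]}) n (a : nat -> R[i]) :
  hereditary T (p * \sum_(j < n) a j *: 'X^j) =
  \sum_(j < n) a j *: (iter j (adj T) \o hereditary T p \o iter j T).
Proof.
rewrite mulr_sumr; elim/big_rec2: _ => [|j A q _ IH].
  by rewrite /hereditary size_poly0 big_ord0.
by rewrite -scalerAr hereditary_lin hereditary_mulXn IH.
Qed.

End Hereditary.

(** * Norm and continuity of maps into B(H) *)

Section MapNorm.
Context {R : realType} (V : lmodType R[i]) (D : set V) (N : V -> R).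
Context (H : hilbertType R) (Phi : V -> H -> H).

Lemma mapnorm_attained (c : R) f0 :
  (forall f, D f -> N f <= 1 -> opnorm (Phi f) <= c) ->
  D f0 -> N f0 <= 1 -> opnorm (Phi f0) = c ->
  mapnorm D N Phi = c.
Proof.
move=> ub D0 N0 E0; apply/eqP; rewrite eq_le; apply/andP; split.
  apply: ge_sup; first by exists c, f0.
  by move=> _ [f [Df Nf] <-]; exact: ub.
by apply: ub_le_sup; [exists c => _ [f [Df Nf] <-]; exact: ub|exists f0].
Qed.

Lemma lipschitz_continuous_on (c : R) : 0 <= c ->
  (forall f g, D f -> D g -> 0 <= N (g - f) /\
     opnorm (Phi g - Phi f) <= N (g - f) * c) ->
  continuous_on D N Phi.
Proof.
move=> c0 L f Df e e0; have c1 : 0 < c + 1 by rewrite ltr_wpDl.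
exists (e / (c + 1)) => [|g Dg]; first by rewrite divr_gt0.
rewrite ltr_pdivlMr// => gd; have [n0 h] := L f g Df Dg.
by apply: le_lt_trans h _; apply: le_lt_trans gd; rewrite ler_wpM2l// lerDl.
Qed.

End MapNorm.

Section MomentFormula.
Context {R : realType}.

(** The double zero at 1 removes the two affine terms of the representation formula, leaving only
    the integral. *)
Lemma X1sqr_mul_values (q : {poly R[i]}) :
  (('X - 1) ^+ 2 * q).[1] = 0 /\ (('X - 1) ^+ 2 * q)^`().[1] = 0.
Proof.
have h : ('X - 1 : {poly R[i]}).[1] = 0 by rewrite !hornerE subrr.
rewrite derivM expr2 derivM !(hornerD, hornerM).
by rewrite -!hornerD h !(mulr0, mul0r) !addr0 mul0r.
Qed.

Lemma D12_X1sqr_mul (q : {poly R[i]}) : D12 (('X - 1) ^+ 2 * q) = q.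
Proof.
have [h0 h1] := X1sqr_mul_values q.
have d0 : ('X - 1) ^+ 2 != 0 :> {poly R[i]}.
  by rewrite expf_eq0/= polyXsubC_eq0.
rewrite /D12 h0 h1; move: (('X - 1) ^+ 2) d0 => p p0.
by rewrite scale0r polyC0 !subr0; exact: mulKp.
Qed.

End MomentFormula.

(** * Continuous functions on the support *)

Section UniformLimit.
Context {R : realType} d (T : measurableType d).

Lemma cmeasurable_uniform_lim (f : T -> R[i]) (g : nat -> T -> R[i]) :
  (forall n, cmeasurable (g n)) ->
  (forall n x, rnorm (f x - g n x) <= n.+1%:R^-1) -> cmeasurable f.
Proof.
move=> mg fg.
have conv (u : R[i] -> R) (x : T) :
    (forall z w, `|u z - u w| <= rnorm (z - w)) ->
    u (g n x) @[n --> \oo] --> u (f x).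
  move=> u1; apply/cvgrPdist_lt => e e0.
  have [N _ NP] := near_infty_natSinv_lt (PosNum e0); exists N => // n /NP.
  by apply: le_lt_trans; apply: le_trans (u1 _ _) (fg n x).
split; [apply: (@measurable_fun_cvg _ _ _ _ (fun n x => complex.Re (g n x)))
       |apply: (@measurable_fun_cvg _ _ _ _ (fun n x => complex.Im (g n x)))].
- by move=> n; exact: (mg n).1.
- move=> x _; apply: (conv (@complex.Re R)) => z w.
  by rewrite -raddfB; exact: ler_Re_rnorm.
- by move=> n; exact: (mg n).2.
- move=> x _; apply: (conv (@complex.Im R)) => z w.
  by rewrite -raddfB; exact: ler_Im_rnorm.
Qed.

End UniformLimit.

(** Made for uniqueness: A and B are the values of two continuous maps at one function, and C is
    their common value at a nearby polynomial. *)
Lemma opnorm_sub_approx (R : realType) (H : hilbertType R) (A B : H -> H) :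
  bounded_op A -> bounded_op B ->
  (forall e : R, 0 < e -> exists C,
     [/\ bounded_op C, opnorm (C - A) < e & opnorm (C - B) < e]) -> A = B.
Proof.
move=> bA bB h; apply/funext => x; apply: subr0_eq; apply: rnorm_eq0; apply/eqP.
have bsub (C D : H -> H) : bounded_op C -> bounded_op D -> bounded_op (C - D).
  by move=> bC bD; rewrite -scaleN1r; apply: bounded_opD => //; exact: bounded_opZ.
rewrite eq_le rnorm_ge0 andbT; apply/ler_addgt0Pr => e e0; rewrite add0r.
have x1 : 0 < 2 * (rnorm x + 1) by rewrite mulr_gt0// ltr_wpDl ?rnorm_ge0.
have [C [bC CA CB]] := h _ (divr_gt0 e0 x1).
have [_ /(_ x) hA] := opnorm_bound (bsub _ _ bC bA).
have [_ /(_ x) hB] := opnorm_bound (bsub _ _ bC bB).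
have -> : A x - B x = (C - B) x - (C - A) x.
  by rewrite -[RHS]/((C x - B x) - (C x - A x)) opprB [RHS]addrC subrKA.
rewrite (le_trans (ler_rnormB _ _))// (le_trans (lerD hB hA))//.
move: CA CB; rewrite !ltr_pdivlMr//; have := rnorm_ge0 x.
set a := opnorm _; set b := opnorm _; have : 0 <= a by exact: opnorm_ge0 (bsub _ _ _ _).
have : 0 <= b by exact: opnorm_ge0 (bsub _ _ _ _).
nra.
Qed.

Section ContinuousFunctions.
Context {R : realType} (Omega : set (Rplus R)).
Hypothesis cO : compact Omega.

Lemma ext0_in (g : Omega -> R[i]) x (xO : x \in Omega) :
  ext0 g x = g (SigSub xO).
Proof. by rewrite /ext0/= oinv_set_val insubT. Qed.

Lemma ext0_out (g : Omega -> R[i]) x : ~ Omega x -> ext0 g x = 0.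
Proof.
by move=> xO; rewrite /ext0/= oinv_set_val insubN//; apply: contra_notN xO => /set_mem.
Qed.

Lemma ext0_lin a (f g : Omega -> R[i]) : ext0 (a *: f + g) = a *: ext0 f + ext0 g.
Proof.
apply/funext => x; rewrite fct_linE.
have [xO|xO] := pselect (Omega x); last by rewrite !ext0_out// mulr0 addr0.
by rewrite !(ext0_in _ (mem_set xO)).
Qed.

Lemma ext0_sigL (f : Rplus R -> R[i]) x : Omega x -> ext0 (sigL Omega f) x = f x.
Proof. by move=> xO; rewrite (ext0_in _ (mem_set xO)). Qed.

Lemma Cspace_lin a f g : Cspace Omega f -> Cspace Omega g ->
  Cspace Omega (a *: f + g).
Proof.
move=> cf cg x; apply: continuousD; last exact: cg.
by apply: continuousZl_tmp; exact: cf.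
Qed.

Lemma continuous_coord : continuous (@coord R).
Proof.
move=> x; apply/(cvg_rnormP (FF := nbhs_filter x)) => e e0.
have /cvgrPdist_lt/(_ _ e0) := @continuous_Rval R x.
apply: filterS => y; by rewrite /coord -rmorphB/= rnormR.
Qed.

Lemma continuous_polyfun (q : {poly R[i]}) : continuous (polyfun q).
Proof.
elim/poly_ind: q => [|q a IH].
  have -> : polyfun (0 : {poly R[i]}) = fun=> 0.
    by apply/funext => x; rewrite /polyfun horner0.
  by move=> x; exact: cst_continuous.
have -> : polyfun (q * 'X + a%:P) = fun x => polyfun q x * coord x + a.
  by apply/funext => x; rewrite /polyfun hornerMXaddC.
move=> x; apply: (cvgD (FF := nbhs_filter x)); last exact: cst_continuous.
by apply: (cvgM (FF := nbhs_filter x)); [exact: IH|exact: continuous_coord].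
Qed.

Lemma Cspace_polyfun (q : {poly R[i]}) : Cspace Omega (sigL Omega (polyfun q)).
Proof.
move=> x; apply: continuous_comp; last exact: continuous_polyfun.
exact: initial_continuous.
Qed.

Lemma Cspace_eps_continuous g : Cspace Omega g -> eps_continuous Omega (ext0 g).
Proof.
move=> cg x Ox e e0; set x' : Omega := SigSub (mem_set Ox).
have /(cvg_rnormP (FF := nbhs_filter x'))/(_ e e0) := cg x'.
(* Two nested initial topologies: an open set of [Omega] is the trace of one of [Rplus R], itself
   the trace of one of the line. *)
rewrite nbhsE => -[B [[V oV <-] /= Vx] VB].
have [W oW WV] := (open_RplusP V).1 oV.
move: Vx; rewrite -WV /= => Wx.
have /nbhs_normP[d d0 dW] := open_nbhs_nbhs (conj oW Wx).
exists d => // y Oy xy; rewrite (ext0_in _ (mem_set Ox)) (ext0_in _ (mem_set Oy)).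
by apply: (VB (SigSub (mem_set Oy))); rewrite /= -WV; exact: dW.
Qed.

Lemma supnorm_le g (c : R) : 0 <= c -> (forall x : Omega, rnorm (g x) <= c) ->
  supnorm Omega g <= c.
Proof.
move=> c0 gc; have [[x _]|e0] := pselect ([set: Omega] !=set0).
  by apply: ge_sup; [exists (rnorm (g x)), x|move=> _ [y _ <-]].
rewrite /supnorm (_ : [set rnorm (g x) | x in setT] = set0) ?sup0//.
by apply/seteqP; split=> // t [y _ _]; exfalso; apply: e0; exists y.
Qed.

Lemma supnorm_ub g : Cspace Omega g -> forall x : Omega, rnorm (g x) <= supnorm Omega g.
Proof.
move=> cg x; apply: ub_le_sup; last by exists x.
(* Boundedness of g, without which [sup] is not an upper bound, is read off the modulus with e =
   1. *)
have [C C0 CP] := eps_modulus cO (Cspace_eps_continuous cg) ltr01.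
have [b b0 bP] := compact_Rplus_bounded cO.
exists (rnorm (g x) + (1 + C * b ^+ 2)) => _ [y _ <-].
have Ox : Omega (\val x) := set_mem (valP x).
have Oy : Omega (\val y) := set_mem (valP y).
have := CP _ _ Oy Ox; rewrite (ext0_in _ (valP x)) (ext0_in _ (valP y)).
have -> : SigSub (valP x) = x by exact: val_inj.
have -> : SigSub (valP y) = y by exact: val_inj.
move=> h; have := ler_rnormD (g x) (g y - g x); rewrite addrC subrK => h1.
rewrite (le_trans h1)// lerD2l (le_trans h)// lerD2l ler_wpM2l//.
have := bP _ Ox; have := bP _ Oy; have := Rval_ge0 (\val x); have := Rval_ge0 (\val y).
nra.
Qed.

Lemma supnorm_ge0 g : Cspace Omega g -> 0 <= supnorm Omega g.
Proof.
move=> cg; have [[x _]|e0] := pselect ([set: Omega] !=set0).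
  by apply: le_trans (supnorm_ub cg x); exact: rnorm_ge0.
rewrite /supnorm (_ : [set rnorm (g x) | x in setT] = set0) ?sup0//.
by apply/seteqP; split=> // t [y _ _]; exfalso; apply: e0; exists y.
Qed.

Lemma rnorm_ext0 g : Cspace Omega g -> forall x, Omega x ->
  rnorm (ext0 g x) <= supnorm Omega g.
Proof. by move=> cg x Ox; rewrite (ext0_in _ (mem_set Ox)); exact: supnorm_ub. Qed.

(** Measurability is a by-product of Weierstrass: the extension by 0 is the uniform limit of
    polynomials multiplied by the indicator of [Omega]. *)
Lemma cmeasurable_ext0 g : measurable Omega -> Cspace Omega g -> cmeasurable (ext0 g).
Proof.
move=> mO cg.
have natSinv_gt0 (n : nat) : 0 < n.+1%:R^-1 :> R by rewrite invr_gt0.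
have [q qP] := choice (fun n : nat => weierstrass cO (Cspace_eps_continuous cg)
  (natSinv_gt0 n)).
apply: (@cmeasurable_uniform_lim _ _ _ _ (fun n x => cindic Omega x * polyfun (q n) x)).
  move=> n; apply: cmeasurableM; first exact: (bdd_cindic mO).1.
  exact: cmeasurable_polyfun.
move=> n x; have [Ox|Ox] := pselect (Omega x).
  by rewrite /cindic indicE mem_set// mul1r; exact: qP.
by rewrite /cindic indicE memNset// mul0r ext0_out// subr0 rnorm0.
Qed.

End ContinuousFunctions.

(** * The integral on L^oo(M) and its restriction to C(supp M) *)

Section RestrictionToSupport.
Context {R : realType} (H : hilbertType R) (M : semispectral (Rplus R) H).
Hypothesis cM : compact (supp M).
Local Notation Omega := (supp M).
Local Notation L := (fun f : Rplus R -> R[i] => opint M f).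
Local Notation LOmega := (fun g : Omega -> R[i] => L (ext0 g)).

Lemma Linf_sub f g : Linf M f -> Linf M g -> Linf M (g - f).
Proof. by move=> Lf Lg; rewrite addrC -scaleN1r; exact: Linf_lin. Qed.

Lemma opint_Linf_sub f g : Linf M f -> Linf M g ->
  opint M (g - f) = opint M g - opint M f.
Proof. by move=> Lf Lg; rewrite addrC -scaleN1r opint_Linf_lin// scaleN1r addrC. Qed.

Lemma ext0_sub (Om : set (Rplus R)) (f g : Om -> R[i]) :
  ext0 (g - f) = ext0 g - ext0 f.
Proof. by rewrite addrC -scaleN1r ext0_lin scaleN1r addrC. Qed.

Lemma Cspace_sub (Om : set (Rplus R)) (f g : Om -> R[i]) :
  Cspace Om f -> Cspace Om g -> Cspace Om (g - f).
Proof. by move=> cf cg; rewrite addrC -scaleN1r; exact: Cspace_lin. Qed.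

Lemma Linf_ext0 g : Cspace Omega g ->
  Linf M (ext0 g) /\ Linf_norm M (ext0 g) <= supnorm Omega g.
Proof.
move=> cg; apply: Linf_supp; [|exact: supnorm_ge0|exact: rnorm_ext0].
by apply: cmeasurable_ext0 => //; exact: measurable_supp.
Qed.

Lemma continuous_opint_Linf : continuous_on (Linf M) (Linf_norm M) L.
Proof.
apply: (@lipschitz_continuous_on _ _ _ _ _ _ (opnorm (M setT))).
  by apply: opnorm_ge0; exact: sspm_bounded.
move=> f g Lf Lg; have Lgf := Linf_sub Lf Lg; split; first exact: Linf_norm_ge0.
by rewrite -opint_Linf_sub//; exact: opnorm_opint_le.
Qed.

Lemma continuous_opint_ext0 : continuous_on (Cspace Omega) (supnorm Omega) LOmega.
Proof.
have M0 : 0 <= opnorm (M setT) by apply: opnorm_ge0; exact: sspm_bounded.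
apply: (@lipschitz_continuous_on _ _ _ _ _ _ (opnorm (M setT))) => // f g cf cg.
have cgf := Cspace_sub cf cg; split; first exact: supnorm_ge0.
have [Lf _] := Linf_ext0 cf; have [Lg _] := Linf_ext0 cg.
have [Lgf le] := Linf_ext0 cgf.
rewrite -opint_Linf_sub// -ext0_sub (le_trans (opnorm_opint_le Lgf))//.
exact: ler_wpM2r.
Qed.

Lemma cindicT : cindic setT = polyfun 1 :> (Rplus R -> R[i]).
Proof. by apply/funext => x; rewrite /cindic indicT /polyfun hornerC. Qed.

Lemma Linf_norm_cindicT : Linf_norm M (polyfun 1) <= 1.
Proof.
have [] // := @Linf_supp _ _ M (polyfun 1) 1 (@cmeasurable_polyfun R 1).
by move=> x _; rewrite /polyfun hornerC rnorm1.
Qed.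

Lemma mapnorm_opint : mapnorm (Linf M) (Linf_norm M) L = opnorm (M setT).
Proof.
have M0 : 0 <= opnorm (M setT) by apply: opnorm_ge0; exact: sspm_bounded.
apply: (@mapnorm_attained _ _ _ _ _ _ _ (polyfun 1)).
- move=> f Lf f1; rewrite (le_trans (opnorm_opint_le Lf))//.
  by rewrite -[leRHS]mul1r ler_wpM2r.
- exact: Linf_polyfun.
- exact: Linf_norm_cindicT.
- by rewrite -cindicT opint_indic.
Qed.

Lemma opint_ext0_sigL q : L (ext0 (sigL Omega (polyfun q))) = L (polyfun q).
Proof.
apply: opint_supp; [|exact: cmeasurable_polyfun|by move=> x; exact: ext0_sigL].
apply: cmeasurable_ext0 => //; [exact: measurable_supp|exact: Cspace_polyfun].
Qed.

Lemma mapnorm_opint_ext0 :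
  mapnorm (Cspace Omega) (supnorm Omega) LOmega = opnorm (M setT).
Proof.
have M0 : 0 <= opnorm (M setT) by apply: opnorm_ge0; exact: sspm_bounded.
apply: (@mapnorm_attained _ _ _ _ _ _ _ (sigL Omega (polyfun 1))).
- move=> g cg g1; have [Lg le] := Linf_ext0 cg.
  rewrite (le_trans (opnorm_opint_le Lg))// -[leRHS]mul1r ler_wpM2r//.
  exact: le_trans le g1.
- exact: Cspace_polyfun.
- by apply: supnorm_le => // x; rewrite /sigL/= /polyfun hornerC rnorm1.
- by rewrite opint_ext0_sigL -cindicT opint_indic.
Qed.

Lemma polyfun_dense_Linf g : Cspace Omega g -> forall e : R, 0 < e ->
  exists q : {poly R[i]}, Linf_norm M (ext0 g - polyfun q) < e.
Proof.
move=> cg e e0; have e2 : 0 < e / 2 by rewrite divr_gt0.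
have [q qP] := weierstrass cM (Cspace_eps_continuous cg) e2; exists q.
have [||_ le] := @Linf_supp _ _ M (ext0 g - polyfun q) (e / 2) _ (ltW e2).
- apply: (Linf_sub (Linf_polyfun cM q) (Linf_ext0 cg).1).1.
- exact: qP.
by rewrite (le_lt_trans le)// ltr_pdivrMr// ltr_pMr// ltr1n.
Qed.

Lemma polyfun_dense_Cspace g : Cspace Omega g -> forall e : R, 0 < e ->
  exists q : {poly R[i]}, supnorm Omega (sigL Omega (polyfun q) - g) < e.
Proof.
move=> cg e e0; have e2 : 0 < e / 2 by rewrite divr_gt0.
have [q qP] := weierstrass cM (Cspace_eps_continuous cg) e2; exists q.
apply: (@le_lt_trans _ _ (e / 2)).
  apply: supnorm_le (ltW e2) _ => x; have Ox : Omega (\val x) := set_mem (valP x).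
  have := qP _ Ox; rewrite (ext0_in _ (valP x)) rnormB.
  by have -> : SigSub (valP x) = x by exact: val_inj.
by rewrite ltr_pdivrMr// ltr_pMr// ltr1n.
Qed.

Lemma opint_ext0_unique (Phi : (Omega -> R[i]) -> H -> H) :
  into_BH (Cspace Omega) Phi ->
  continuous_on (Cspace Omega) (supnorm Omega) Phi ->
  (forall q : {poly R[i]}, Phi (sigL Omega (polyfun q)) = L (polyfun q)) ->
  forall g, Cspace Omega g -> Phi g = LOmega g.
Proof.
move=> bPhi cPhi PhiE g cg; apply: opnorm_sub_approx; first exact: bPhi.
  exact: bounded_Linf_opint (Linf_ext0 cg).1.
move=> e e0; have [d d0 dP] := cPhi _ cg _ e0.
have [d' d'0 d'P] := continuous_opint_ext0 cg e0.
(* The same polynomial must serve the continuity estimates of both maps. *)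
have dd : 0 < Num.min d d' by rewrite lt_min d0.
have [q] := polyfun_dense_Cspace cg dd; rewrite lt_min => /andP[qd qd'].
have cq := @Cspace_polyfun _ Omega q.
exists (Phi (sigL Omega (polyfun q))); split; [exact: bPhi|exact: dP|].
by rewrite PhiE -opint_ext0_sigL; exact: d'P.
Qed.

End RestrictionToSupport.

Theorem theorem4p1p2 (R : realType) (H : hilbertType R) (T : H -> H)
    (M : semispectral (Rplus R) H)
    (T_bounded : bounded_op T) (T_cpd : cpd_op T)
    (M_compact : compact (supp M))
    (M_repr : forall p : {poly R[i]},
       hereditary T p =
         (fun h => p.[1] *: h - p^`().[1] *: (h - adj T (T h)))
         + opint M (polyfun (D12 p))) :
  let L := fun f : Rplus R -> R[i] => opint M f in
  (* L is a continuous linear map from L^oo(M) to B(H) *)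
  [/\ forall f g, Linf M f -> Linf M g ->
        sspm_ae M [set x | f x = g x] -> L f = L g,
      into_BH (Linf M) L,
      linear_on (Linf M) L &
      continuous_on (Linf M) (Linf_norm M) L]
  /\
  [/\ (* (i) *)
      forall q : {poly R[i]},
        L (polyfun q) = hereditary T (('X - 1) ^+ 2 * q),
      (* (ii) *)
      forall f, Linf M f -> sspm_ae M [set x | 0 <= f x] -> nonneg_op (L f),
      (* (iii) *)
      exists (K : hilbertType R) (A : H -> K) (S : K -> K)
             (E : semispectral (Rplus R) K),
        [/\ bounded_op A,
            bounded_op S /\ nonneg_op S,
            closure (lspan (\bigcup_n [set iter n S (A h) | h in setT]))
              = setT,
            spectral_measure_of S E &
            [/\ forall f, Linf M f -> Linf E f,
                forall f g, Linf M f -> Linf M g ->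
                  sspm_ae M [set x | f x = g x] -> opint E f = opint E g &
                forall f, Linf M f -> L f = adj A \o opint E f \o A]],
      (* (iv) *)
      mapnorm (Linf M) (Linf_norm M) L = opnorm (B2 T) &
      (* (v) *)
      (exists2 D, measurable D & M D <> 0) ->
      let Omega := supp M in
      let LOmega := fun g : Omega -> R[i] => L (ext0 g) in
      [/\ forall g, Cspace Omega g -> forall e : R, 0 < e ->
            exists q : {poly R[i]}, Linf_norm M (ext0 g - polyfun q) < e,
          [/\ into_BH (Cspace Omega) LOmega,
              linear_on (Cspace Omega) LOmega,
              continuous_on (Cspace Omega) (supnorm Omega) LOmega &
              forall q : {poly R[i]}, LOmega (sigL Omega (polyfun q))
                = hereditary T (('X - 1) ^+ 2 * q)],
          forall Phi : (Omega -> R[i]) -> H -> H,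
            into_BH (Cspace Omega) Phi ->
            linear_on (Cspace Omega) Phi ->
            continuous_on (Cspace Omega) (supnorm Omega) Phi ->
            (forall q : {poly R[i]}, Phi (sigL Omega (polyfun q))
               = hereditary T (('X - 1) ^+ 2 * q)) ->
            forall g, Cspace Omega g -> Phi g = LOmega g,
          mapnorm (Cspace Omega) (supnorm Omega) LOmega
            = mapnorm (Linf M) (Linf_norm M) L &
          forall (n : nat) (a : nat -> R[i]),
            opnorm (\sum_(j < n.+1)
                      a j *: (iter j (adj T) \o B2 T \o iter j T))
            <= opnorm (B2 T) *
               sup [set rnorm (\sum_(j < n.+1) a j * (Rval x)%:C ^+ j)
                   | x in Omega]]].

Proof.
move=> L.
have LpolyE q : L (polyfun q) = hereditary T (('X - 1) ^+ 2 * q).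
  rewrite M_repr; have [-> ->] := X1sqr_mul_values q; rewrite D12_X1sqr_mul.
  rewrite -[LHS]add0r; congr (_ + _).
  by apply/funext => h; rewrite !scale0r subr0.
have MT : M setT = B2 T.
  by rewrite -(opint_indic M measurableT) cindicT -[LHS]/(L (polyfun 1)) LpolyE mulr1 hereditary_X1sqr.
have bL f : Linf M f -> bounded_op (L f) by exact: bounded_Linf_opint.
split.
  split; [|exact: bL|by move=> a f g; exact: opint_Linf_lin|exact: continuous_opint_Linf].
  by move=> f g [mf _] [mg _]; exact: opint_ae.
split.
- exact: LpolyE.
- exact: opint_ge0.
- exists (dil_space M), (dil_map M), (@dil_op _ _ M), (dil_sspm M); split.
  + exact: bounded_dil_map.
  + by split; [exact: bounded_dil_op|exact: dil_op_ge0].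
  + exact: dil_op_cyclic.
  + exact: dil_op_spectral.
  split; [exact: dil_Linf| |by move=> f Lf; apply: opint_dil => //; exact: dil_Linf].
  move=> f g [mf _] [mg _] [N [mN N0 fgN]]; apply: opint_ae => //.
  by exists N; split=> //; apply/dil_null.
- by rewrite mapnorm_opint// MT.
move=> _ Omega LOmega; split.
- exact: polyfun_dense_Linf.
- split.
  + by move=> g cg; exact: bL (Linf_ext0 M_compact cg).1.
  + move=> a f g cf cg; rewrite /LOmega ext0_lin.
    by apply: opint_Linf_lin; [exact: (Linf_ext0 M_compact cf).1|exact: (Linf_ext0 M_compact cg).1].
  + exact: continuous_opint_ext0.
  + by move=> q; rewrite -LpolyE; exact: opint_ext0_sigL.
- move=> Phi bPhi _ cPhi PhiE; apply: opint_ext0_unique => // q.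
  by rewrite PhiE -LpolyE.
- by rewrite mapnorm_opint// mapnorm_opint_ext0.
move=> n a; set q := \sum_(j < n.+1) a j *: 'X^j : {poly R[i]}.
have -> : \sum_(j < n.+1) a j *: (iter j (adj T) \o B2 T \o iter j T) = L (polyfun q).
  by rewrite LpolyE hereditary_mul_sum// hereditary_X1sqr.
have qE (x : Rplus R) : \sum_(j < n.+1) a j * (Rval x)%:C ^+ j = polyfun q x.
  rewrite /polyfun horner_sum; apply: eq_bigr => j _.
  by rewrite hornerZ hornerXn.
rewrite (_ : [set _ | _ in _] = [set rnorm (polyfun q x) | x in Omega]); last first.
  by apply: eq_imagel => x _; rewrite qE.
set c := sup _.
(* Compactness of the support makes q bounded on it, so the supremum is a genuine upper bound. *)
have cP x : Omega x -> rnorm (polyfun q x) <= c.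
  have [b b0 bP] := rnorm_polyfun_le M_compact q.
  move=> Ox; apply: ub_le_sup; last by exists x.
  by exists b => _ [y Oy <-]; exact: bP.
have c0 : 0 <= c.
  have [[x Ox]|Oe] := pselect (Omega !=set0).
    exact: le_trans (rnorm_ge0 _) (cP x Ox).
  rewrite /c (_ : [set _ | _ in _] = set0) ?sup0//.
  by apply/seteqP; split=> // t [x Ox _]; exfalso; apply: Oe; exists x.
have [Lq le] := Linf_supp (cmeasurable_polyfun q) c0 cP.
rewrite (le_trans (opnorm_opint_le Lq))// MT mulrC ler_wpM2l//.
by rewrite -MT; apply: opnorm_ge0; exact: sspm_bounded.
Qed.
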